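(* Let $\Theta$ be a connected linear Nakayama algebra of rank $n$ with defect vector $v_\Theta=(\operatorname{def}P_1,\operatorname{def}P_2,\ldots,\operatorname{def}P_n)$. Then, for the vector $w=(\operatorname{def}P_1,\operatorname{def}P_2,\ldots,\operatorname{def}P_n,1)$ (whose entries sum to $1+\operatorname{def}\Theta$), there exists a cyclic Nakayama algebra $\Lambda$ such that $\boldsymbol\varepsilon(\Lambda)\cong\Theta\oplus\mathbb{A}_1$, $\operatorname{def}\Lambda=1+\operatorname{def}\Theta$ and $\operatorname{dom.dim}\Lambda=2$.
   Context: A Nakayama algebra is $\mathbb{K}Q/I$ over a field $\mathbb{K}$ with $I$ admissible, $Q$ an oriented cycle (cyclic case) or a linearly oriented quiver of type $\mathbb{A}$ (connected linear case); rank is the number of vertices. $\mathbb{A}_1$ is the one-dimensional algebra $\mathbb{K}$. Simples are labelled so that $S_{i+1}\cong\tau S_i$ ($\tau$ the Auslander--Reiten translate), $P_i=P(S_i)$ has composition factors $S_i,S_{i+1},\dots$ from top to socle. Defect: for an indecomposable projective $P$, $\operatorname{def}P$ is the number of (nonzero) proper injective quotients of $P$; $\operatorname{def}\Lambda=\sum_P\operatorname{def}P$ over isomorphism classes of indecomposable projectives. For a cyclic Nakayama algebra $\Lambda$, let $\mathcal{S}(\Lambda)$ be a complete set of representatives of isomorphism classes of socles of indecomposable projective $\Lambda$-modules; $\boldsymbol\varepsilon(\Lambda):=\operatorname{End}_\Lambda\big(\bigoplus_{S\in\mathcal{S}(\Lambda)}P(\tau S)\big)$. Dominant dimension: for a module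 $M$ with minimal injective resolution $0\to M\to I_0\to I_1\to\cdots$, the maximal $t$ (or $\infty$) such that $I_j$ is projective for all $j<t$; for an algebra, the infimum over projective non-injective modules.
   Formalization: The rank n is required to be at least 2: for n = 1 (Θ = A_1) the claim fails, since ε(Λ) ≅ K ⊕ K with def Λ = 1 would force rank Λ = 3 and then a simple projective Λ-module, impossible for a cyclic Nakayama algebra. *)

(* Defs.v *)
From HB Require Import structures.
From mathcomp Require Import all_boot all_order all_algebra all_field.
From mathcomp Require Import finmap boolp classical_sets cardinality.
From mathcomp Require Import monalg.

(* Conventions: paths are composed from left to right (in [x * y] the path [x]
   is travelled first) and modules are finite-dimensional right modules.  Thus
   P(i) = e_i A has the paths starting at i as a spanning set, and the
   endomorphism algebra of the regular module A_A, with multiplication the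
   composition of maps, is A itself. *)

Set Implicit Arguments.
Unset Strict Implicit.
Unset Printing Implicit Defensive.

Import GRing.Theory.

Local Open Scope ring_scope.

(* [vertex0] makes the path algebra nonzero, as [nzRingType] demands. *)
Record quiver := Quiver {
  vertex : finType;
  arrow : finType;
  source : arrow -> vertex;
  target : arrow -> vertex;
  vertex0 : vertex
}.

Section Paths.
Variable Q : quiver.

Fixpoint composable (v : vertex Q) (s : seq (arrow Q)) : bool :=
  if s is a :: s' then (source a == v) && composable (target a) s' else true.

(* A path is a starting vertex together with a composable list of arrows; the
   empty list gives the stationary path at that vertex. *)
Record qpath : Type := QPath {
  path_val : vertex Q * seq (arrow Q);
  _ : composable path_val.1 path_val.2
}.

HB.instance Definition _ := [isSub for path_val].
HB.instance Definition _ := [Choice of qpath by <:].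

Definition path_source (p : qpath) : vertex Q := (path_val p).1.
Definition path_arrows (p : qpath) : seq (arrow Q) := (path_val p).2.
Definition path_length (p : qpath) : nat := size (path_arrows p).
Definition path_target (p : qpath) : vertex Q :=
  last (path_source p) [seq target a | a <- path_arrows p].

Definition stationary (v : vertex Q) : qpath := @QPath (v, [::]) isT.

Lemma composable_cat v s t :
  composable v (s ++ t) =
  composable v s && composable (last v [seq target a | a <- s]) t.
Proof. by elim: s v => [|a s IH] v //=; rewrite IH andbA. Qed.

Definition path_cat (p q : qpath) : option qpath :=
  if path_target p == path_source q
  then insub (path_source p, path_arrows p ++ path_arrows q) else None.

Variant path_cat_spec (p q : qpath) : option qpath -> Type :=
  | PathCatSome r of path_target p = path_source q
      & path_source r = path_source p
      & path_arrows r = path_arrows p ++ path_arrows q :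
      path_cat_spec p q (Some r)
  | PathCatNone of path_target p <> path_source q : path_cat_spec p q None.

Lemma path_catP p q : path_cat_spec p q (path_cat p q).
Proof.
rewrite /path_cat; case: eqP => [e|]; last by constructor.
have pqP : composable (path_source p) (path_arrows p ++ path_arrows q).
  rewrite composable_cat (valP p) -/(path_target p) e.
  exact: (valP q).
by rewrite insubT; constructor.
Qed.

Lemma qpath_eq (p q : qpath) :
  path_source p = path_source q -> path_arrows p = path_arrows q -> p = q.
Proof.
move=> es ea; apply: val_inj; rewrite [LHS]surjective_pairing.
by rewrite [RHS]surjective_pairing; congr pair.
Qed.

Lemma path_target_cat p q r : path_target p = path_source q ->
  path_source r = path_source p ->
  path_arrows r = path_arrows p ++ path_arrows q ->
  path_target r = path_target q.
Proof.
by rewrite /path_target => e er ea; rewrite ea map_cat last_cat er e.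
Qed.

Lemma path_catA p q r :
  obind (path_cat^~ r) (path_cat p q) = obind (path_cat p) (path_cat q r).
Proof.
case: (path_catP p q) => [pq e1 s1 a1|n1]; case: (path_catP q r) => /=
  [qr e2 s2 a2|n2] //.
- have t1 := path_target_cat e1 s1 a1.
  case: (path_catP pq r) => [u e3 s3 a3|]; last by rewrite t1.
  case: (path_catP p qr) => [w e4 s4 a4|]; last by rewrite s2.
  by congr Some; apply: qpath_eq; rewrite ?s3 ?s4 ?s1 // a3 a4 a1 a2 catA.
- have t1 := path_target_cat e1 s1 a1.
  by case: (path_catP pq r) => // u; rewrite t1.
- by case: (path_catP p qr) => // w; rewrite s2.
Qed.

Lemma path_cat_stationary_l (v : vertex Q) (p : qpath) :
  path_cat (stationary v) p = if v == path_source p then Some p else None.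
Proof.
case: path_catP => [r|]; rewrite -[path_target _]/v => e; last by case: eqP.
rewrite -e eqxx => s a.
by congr Some; apply: qpath_eq; rewrite // s -e.
Qed.

Lemma path_cat_stationary_r (v : vertex Q) (p : qpath) :
  path_cat p (stationary v) = if v == path_target p then Some p else None.
Proof.
case: path_catP => [r|]; rewrite -[path_source (stationary v)]/v => e.
  move=> s a; rewrite e eqxx; congr Some.
  by apply: qpath_eq; rewrite // a cats0.
by case: eqP => // e'; case: e.
Qed.

End Paths.

Section LinearExtension.
Variables (K : fieldType) (T : choiceType).

Definition lin_ext (V : lmodType K) (f : T -> V) (x : {malg K[T]}) : V :=
  \sum_(p <- msupp x) x@_p *: f p.

Lemma lin_extE (V : lmodType K) (f : T -> V) (x : {malg K[T]})
  (d : {fset T}) : (msupp x `<=` d)%fset ->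
  lin_ext f x = \sum_(p <- d) x@_p *: f p.
Proof.
move=> sub; rewrite /lin_ext (big_fset_incl _ sub) // => p _ /mcoeff_outdom ->.
by rewrite scale0r.
Qed.

Lemma lin_ext_linear (V : lmodType K) (f : T -> V) : linear (lin_ext f).
Proof.
move=> c x y; pose d := (msupp (c *: x + y)%R `|` (msupp x `|` msupp y))%fset.
rewrite !(@lin_extE _ f _ d) ?fsubsetUl //.
- rewrite scaler_sumr -big_split /=; apply: eq_bigr => p _.
  by rewrite mcoeffD mcoeffZ scalerDl scalerA.
- by apply/fsubsetP => k ky; rewrite !inE ky !orbT.
- by apply/fsubsetP => k kx; rewrite !inE kx !orbT.
Qed.

HB.instance Definition _ (V : lmodType K) (f : T -> V) :=
  GRing.isLinear.Build K {malg K[T]} V _ (lin_ext f) (lin_ext_linear f).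

Lemma lin_extU (V : lmodType K) (f : T -> V) p : lin_ext f << p >> = f p.
Proof.
rewrite (@lin_extE _ f _ [fset p]%fset) ?msuppU_le //.
by rewrite big_seq_fset1 mcoeffUU scale1r.
Qed.

Lemma malg_sum (x : {malg K[T]}) : x = \sum_(p <- msupp x) x@_p *: << p >>.
Proof.
rewrite {1}(monalgE x); apply: eq_bigr => p _; apply/malgP => k.
by rewrite mcoeffZ !mcoeffU mulr_natr.
Qed.

Lemma eq_linear_malg (V : lmodType K) (f g : {linear {malg K[T]} -> V}) :
  (forall p, f << p >> = g << p >>) -> f =1 g.
Proof.
move=> fg x; rewrite (malg_sum x) !linear_sum /=; apply: eq_bigr => p _.
by rewrite !linearZ /= fg.
Qed.

Lemma eq_lin_ext (V : lmodType K) (f g : T -> V) :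
  f =1 g -> lin_ext f =1 lin_ext g.
Proof. by move=> fg x; apply: eq_bigr => p _; rewrite fg. Qed.

Lemma lin_ext_comp (V W : lmodType K) (g : {linear V -> W}) (f : T -> V) x :
  g (lin_ext f x) = lin_ext (fun p => g (f p)) x.
Proof. by rewrite linear_sum; apply: eq_bigr => p _; rewrite linearZ. Qed.

Lemma lin_ext_lin (V W : lmodType K) (f : T -> {linear V -> W}) x :
  linear (fun y => lin_ext (fun p => f p y) x).
Proof.
move=> c y z; rewrite /lin_ext scaler_sumr -big_split; apply: eq_bigr => p _.
by rewrite linearP scalerDr !scalerA mulrC.
Qed.

End LinearExtension.

Definition path_algebra (K : fieldType) (Q : quiver) : Type := {malg K[qpath Q]}.

Definition path_mul (K : fieldType) (Q : quiver) (p q : qpath Q)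
    : {malg K[qpath Q]} :=
  if path_cat p q is Some r then << r >> else 0.

HB.lock Definition pa_mul (K : fieldType) (Q : quiver)
    (x y : {malg K[qpath Q]}) : {malg K[qpath Q]} :=
  lin_ext (fun p => lin_ext (path_mul K p) y) x.

Section PathAlgebra.
Variables (K : fieldType) (Q : quiver).
Local Notation KQ := {malg K[qpath Q]}.
Local Notation path_mul := (@path_mul K Q).
Local Notation pa_mul := (@pa_mul K Q).

Definition pa_one : KQ := \sum_(v : vertex Q) << stationary v >>.

Fact pa_mul_linear_l y : linear (pa_mul^~ y).
Proof. by move=> c x z; rewrite unlock; apply: lin_ext_linear. Qed.

Fact pa_mul_linear_r x : linear (pa_mul x).
Proof.
rewrite unlock => c y z.
exact: (lin_ext_lin (fun p => lin_ext (path_mul p)) x c y z).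
Qed.

HB.instance Definition _ x :=
  GRing.isLinear.Build K KQ KQ _ (pa_mul x) (pa_mul_linear_r x).

Definition pa_mulr y x := pa_mul x y.

HB.instance Definition _ y :=
  GRing.isLinear.Build K KQ KQ _ (pa_mulr y) (pa_mul_linear_l y).

Lemma pa_mul0x x : pa_mul 0 x = 0.
Proof. exact: (linear0 (pa_mulr x)). Qed.

Lemma pa_mulx0 x : pa_mul x 0 = 0.
Proof. exact: linear0. Qed.

Lemma pa_mulUU p q : pa_mul << p >> << q >> = path_mul p q.
Proof. by rewrite unlock !lin_extU. Qed.

Lemma pa_mulA_basis (g : qpath Q -> KQ) :
  (forall p q,
     pa_mul (g p) (g q) = if path_cat p q is Some r then g r else 0) ->
  forall p q r, pa_mul (g p) (pa_mul (g q) (g r)) =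
                pa_mul (pa_mul (g p) (g q)) (g r).
Proof.
move=> gM p q r; rewrite !gM; have := path_catA p q r.
case: (path_cat p q) => [pq|]; case: (path_cat q r) => [qr|] /=.
- by rewrite !gM => ->.
- by rewrite gM pa_mulx0 => ->.
- by rewrite gM pa_mul0x => <-.
- by rewrite pa_mul0x pa_mulx0.
Qed.

Fact pa_mulA : associative pa_mul.
Proof.
move=> x y z.
have -> : pa_mul x (pa_mul y z) = (pa_mulr (pa_mul y z)) x by [].
have -> : pa_mul (pa_mul x y) z = (pa_mulr z \o pa_mulr y) x by [].
apply: (eq_linear_malg (f := pa_mulr (pa_mul y z))
                       (g := pa_mulr z \o pa_mulr y)) => p /=.
change ((pa_mul << p >> \o pa_mulr z) y = (pa_mulr z \o pa_mul << p >>) y).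
apply: (eq_linear_malg (f := pa_mul << p >> \o pa_mulr z)
                       (g := pa_mulr z \o pa_mul << p >>)) => q /=.
change ((pa_mul << p >> \o pa_mul << q >>) z = pa_mul (pa_mul << p >> << q >>) z).
apply: (eq_linear_malg (f := pa_mul << p >> \o pa_mul << q >>)
                       (g := pa_mul (pa_mul << p >> << q >>))) => r /=.
exact: (pa_mulA_basis (g := fun p => << p >>) pa_mulUU).
Qed.

Fact pa_mul1 : left_id pa_one pa_mul.
Proof.
move=> x; apply: (eq_linear_malg (f := pa_mul pa_one) (g := idfun)) => p /=.
rewrite -[pa_mul _ _]/(pa_mulr _ _) linear_sum (bigD1 (path_source p)) //=.
rewrite /pa_mulr pa_mulUU /path_mul path_cat_stationary_l eqxx big1 ?addr0 //.
by move=> v /negPf nv; rewrite pa_mulUU /path_mul path_cat_stationary_l nv.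
Qed.

Fact pa_1mul : right_id pa_one pa_mul.
Proof.
move=> x; rewrite -[pa_mul _ _]/(pa_mulr _ _).
apply: (eq_linear_malg (f := pa_mulr pa_one) (g := idfun)) => p /=.
rewrite /pa_mulr linear_sum (bigD1 (path_target p)) //=.
rewrite pa_mulUU /path_mul path_cat_stationary_r eqxx big1 ?addr0 //.
by move=> v /negPf nv; rewrite pa_mulUU /path_mul path_cat_stationary_r nv.
Qed.

Fact pa_mulDl : left_distributive pa_mul +%R.
Proof. by move=> x y z; rewrite -[LHS]/(pa_mulr _ _) linearD. Qed.

Fact pa_mulDr : right_distributive pa_mul +%R.
Proof. by move=> x y z; rewrite linearD. Qed.

Fact pa_one_neq0 : pa_one != 0.
Proof.
apply/eqP => /(congr1 (mcoeff (stationary (vertex0 Q)))).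
rewrite mcoeff0 raddf_sum (bigD1 (vertex0 Q)) //= mcoeffUU big1 ?addr0.
  by move/eqP; rewrite oner_eq0.
move=> v nv; rewrite mcoeffU; case: eqP => // /(congr1 (@path_source Q)) /eqP.
by rewrite (negPf nv).
Qed.

Local Notation PA := (path_algebra K Q).

HB.instance Definition _ := GRing.Lmodule.copy PA KQ.
HB.instance Definition _ := GRing.Zmodule_isNzRing.Build PA
  pa_mulA pa_mul1 pa_1mul pa_mulDl pa_mulDr pa_one_neq0.

Fact pa_scaleAl (c : K) (x y : PA) : c *: (x * y) = c *: x * y.
Proof. by rewrite -[RHS]/(pa_mulr _ _) linearZ. Qed.

HB.instance Definition _ := GRing.Lmodule_isLalgebra.Build K PA pa_scaleAl.

Fact pa_scaleAr (c : K) (x y : PA) : c *: (x * y) = x * (c *: y).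
Proof. by rewrite -[RHS]/(pa_mul _ _) linearZ. Qed.

HB.instance Definition _ := GRing.Lalgebra_isAlgebra.Build K PA pa_scaleAr.

End PathAlgebra.

(* The k-th power of the arrow ideal: the span of the paths of length >= k. *)
Definition arrow_ideal (K : fieldType) (Q : quiver) (k : nat)
    (x : path_algebra K Q) : Prop :=
  forall p : qpath Q, mcoeff p x != 0 -> (k <= path_length p)%N.

(* An ideal is admissible if it lies between some power R^m (m >= 2) of the
   arrow ideal R and R^2. *)
Definition admissible (K : fieldType) (Q : quiver)
    (I : path_algebra K Q -> Prop) : Prop :=
  (exists2 m, (2 <= m)%N & forall x, arrow_ideal m x -> I x) /\
  (forall x, I x -> arrow_ideal 2 x).

(* A is isomorphic to KQ/I for an admissible ideal I. *)
Definition bound_quiver_algebra (K : fieldType) (Q : quiver)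
    (A : falgType K) : Prop :=
  exists f : {lrmorphism path_algebra K Q -> A},
    (forall a, exists x, f x = a) /\ admissible (fun x => f x = 0).

(* 0 -> 1 -> ... -> m, of type A_{m+1} *)
Definition linear_quiver (m : nat) : quiver :=
  @Quiver 'I_m.+1 'I_m (widen_ord (leqnSn m)) (lift ord0) ord0.

(* 0 -> 1 -> ... -> m -> 0, with m.+1 vertices (a loop for m = 0) *)
Definition cyclic_quiver (m : nat) : quiver :=
  @Quiver 'I_m.+1 'I_m.+1 id (@ordS m.+1) ord0.

Definition connected_linear_nakayama (K : fieldType) (n : nat)
    (A : falgType K) : Prop :=
  exists2 m, n = m.+1 & bound_quiver_algebra (linear_quiver m) A.

Definition cyclic_nakayama (K : fieldType) (A : falgType K) : Prop :=
  exists m, bound_quiver_algebra (cyclic_quiver m) A.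

Record fdmod (K : fieldType) (A : falgType K) := FdMod {
  mcar :> vectType K;
  mact : 'Hom(A, 'End(mcar));
  mact1 : mact 1 = \1%VF;
  mactM : forall a b, mact (a * b) = (mact b \o mact a)%VF
}.

Section Modules.
Variables (K : fieldType) (A : falgType K).
Implicit Types M N P S X Y : fdmod A.

Definition is_hom M N (f : 'Hom(M, N)) : Prop :=
  forall a x, f (mact M a x) = mact N a (f x).

Definition mod_iso M N : Prop :=
  exists f : 'Hom(M, N), [/\ is_hom f, lker f = 0%VS & limg f = fullv].

Definition submodule M (U : {vspace M}) : Prop :=
  forall a x, x \in U -> mact M a x \in U.

Definition simple_submodule M (U : {vspace M}) : Prop :=
  [/\ submodule U, U <> 0%VS &
      forall W, submodule W -> (W <= U)%VS -> W = 0%VS \/ W = U].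

Definition simple_module M : Prop := simple_submodule (fullv : {vspace M}).

Definition indecomposable M : Prop :=
  (fullv : {vspace M}) <> 0%VS /\
  forall U W : {vspace M}, submodule U -> submodule W ->
    (U + W)%VS = fullv -> (U :&: W)%VS = 0%VS -> U = 0%VS \/ W = 0%VS.

Definition projective_module P : Prop :=
  forall X Y (g : 'Hom(X, Y)) (h : 'Hom(P, Y)),
    is_hom g -> limg g = fullv -> is_hom h ->
    exists2 l : 'Hom(P, X), is_hom l & (g \o l)%VF = h.

Definition injective_module N : Prop :=
  forall X Y (g : 'Hom(X, Y)) (h : 'Hom(X, N)),
    is_hom g -> lker g = 0%VS -> is_hom h ->
    exists2 l : 'Hom(Y, N), is_hom l & (l \o g)%VF = h.

Definition indecomposable_projective P : Prop :=
  indecomposable P /\ projective_module P.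

Definition superfluous M (U : {vspace M}) : Prop :=
  forall W : {vspace M}, submodule W -> (U + W)%VS = fullv -> W = fullv.

Definition essential M (U : {vspace M}) : Prop :=
  forall W : {vspace M}, submodule W -> (U :&: W)%VS = 0%VS -> W = 0%VS.

Definition projective_cover_map P M (p : 'Hom(P, M)) : Prop :=
  [/\ is_hom p, projective_module P, limg p = fullv & superfluous (lker p)].

Definition projective_cover P M : Prop :=
  exists p : 'Hom(P, M), projective_cover_map p.

Definition is_socle M (U : {vspace M}) : Prop :=
  (forall W, simple_submodule W -> (W <= U)%VS) /\
  (forall V : {vspace M}, (forall W, simple_submodule W -> (W <= V)%VS) ->
     (U <= V)%VS).

Definition socle_of P S : Prop :=
  exists f : 'Hom(S, P), [/\ is_hom f, lker f = 0%VS & is_socle (limg f)].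

Definition direct_sum_of n (X : 'I_n -> fdmod A) M : Prop :=
  exists i_ : forall k, 'Hom(X k, M),
    [/\ forall k, is_hom (i_ k), forall k, lker (i_ k) = 0%VS,
        (\sum_k limg (i_ k))%VS = fullv & directv (\sum_k limg (i_ k))].

Definition complete_reps (C : fdmod A -> Prop) n (X : 'I_n -> fdmod A) : Prop :=
  [/\ forall i, C (X i), forall i j, mod_iso (X i) (X j) -> i = j &
      forall M, C M -> exists i, mod_iso M (X i)].

(* The Auslander-Reiten translate N = D Tr M.  For a minimal projective
   presentation P1 -p-> P0 -q-> M -> 0, Tr M is the cokernel of
   Hom_A(P0, A) -> Hom_A(P1, A), h |-> h \o p, a left A-module through
   (a g)(y) = a * g y.  The map [b] below induces an isomorphism of N with the
   right A-module D Tr M of K-linear forms on Hom_A(P1, A) that vanish on the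
   image of Hom_A(P0, A); forms on Hom_A(P1, A) are written as restrictions of
   forms on Hom_K(P1, A), and [is_Ahom] singles out Hom_A inside Hom_K. *)
Definition is_Ahom P (g : 'Hom(P, A)) : Prop :=
  forall a x, g (mact P a x) = g x * a.

Definition minimal_presentation P1 P0 M (p : 'Hom(P1, P0)) (q : 'Hom(P0, M))
    : Prop :=
  [/\ projective_cover_map q, projective_module P1, is_hom p,
      limg p = lker q & superfluous (lker p)].

Definition is_tau M N : Prop :=
  exists (P1 P0 : fdmod A) (p : 'Hom(P1, P0)) (q : 'Hom(P0, M)),
  minimal_presentation p q /\
  exists b : 'Hom(N, 'Hom('Hom(P1, A), K^o)),
  [/\ forall a x g, is_Ahom g -> b (mact N a x) g = b x (amull a \o g)%VF,
      forall x h, is_Ahom h -> b x (h \o p)%VF = 0,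
      forall x, (forall g, is_Ahom g -> b x g = 0) -> x = 0 &
      forall phi : 'Hom('Hom(P1, A), K^o),
        (forall h, is_Ahom h -> phi (h \o p)%VF = 0) ->
        exists x, forall g, is_Ahom g -> b x g = phi g].

(* Quotients are counted as the submodules by which one divides; for a uniserial
   P these are finitely many and give pairwise non-isomorphic quotients. *)
Definition proper_injective_quotient P (U : {vspace P}) : Prop :=
  [/\ U <> 0%VS, U <> fullv &
      exists (N : fdmod A) (f : 'Hom(P, N)),
        [/\ is_hom f, limg f = fullv, lker f = U & injective_module N]].

Definition defect P : nat :=
  #|` fset_set [set U : {vspace P} | proper_injective_quotient U]%classic|%fset.

Definition algebra_defect (d : nat) : Prop :=
  exists m (P : 'I_m -> fdmod A),
    complete_reps indecomposable_projective P /\ d = \sum_i defect (P i).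

Definition minimal_injective_resolution M (I : nat -> fdmod A)
    (e : 'Hom(M, I 0)) (d : forall j, 'Hom(I j, I j.+1)) : Prop :=
  [/\ [/\ is_hom e, lker e = 0%VS & essential (limg e)],
      forall j, injective_module (I j),
      forall j, is_hom (d j) /\ essential (limg (d j)),
      lker (d 0%N) = limg e &
      forall j, lker (d j.+1) = limg (d j)].

Definition dominant_dimension M (t : nat) : Prop :=
  exists (I : nat -> fdmod A) (e : 'Hom(M, I 0)) (d : forall j, 'Hom(I j, I j.+1)),
    [/\ minimal_injective_resolution e d,
        forall j, (j < t)%N -> projective_module (I j) &
        ~ projective_module (I t)].

(* Only finite values occur: modules of infinite dominant dimension do not
   affect an infimum equal to a natural number. *)
Definition algebra_dominant_dimension (t : nat) : Prop :=
  (exists M, [/\ projective_module M, ~ injective_module M &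
                 dominant_dimension M t]) /\
  (forall M s, projective_module M -> ~ injective_module M ->
     dominant_dimension M s -> (t <= s)%N).

(* The indecomposable projectives P_1, ..., P_n (indexed from 0), where
   P_i = P(S_i) for a labelling of the simples such that S_{i+1} = tau S_i. *)
Definition standard_projectives n (P : 'I_n -> fdmod A) : Prop :=
  exists S : 'I_n -> fdmod A,
    [/\ complete_reps simple_module S,
        forall i j : 'I_n, j = i.+1 :> nat -> is_tau (S i) (S j) &
        forall i, projective_cover (P i) (S i)].

Definition end_algebra_iso M (B : algType K) : Prop :=
  exists phi : B -> 'End(M),
    [/\ linear phi, injective phi, phi 1 = \1%VF,
        forall x y, phi (x * y) = (phi x \o phi y)%VF &
        forall f : 'End(M), is_hom f <-> exists x, phi x = f].

(* epsilon(A), the endomorphism algebra of the direct sum of the P(tau S) with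
   S running over the socles of indecomposable projectives up to isomorphism,
   is isomorphic to B. *)
Definition epsilon_iso (B : algType K) : Prop :=
  exists k (S T R : 'I_k -> fdmod A) (M : fdmod A),
    [/\ complete_reps
          (fun S0 => exists2 P, indecomposable_projective P & socle_of P S0) S,
        forall i, is_tau (S i) (T i),
        forall i, projective_cover (R i) (T i),
        direct_sum_of R M &
        end_algebra_iso M B].

End Modules.

(* Main.v *)
(* Both algebras have a basis of paths in an oriented cycle (in the linear case
   no nonzero path uses the last arrow), so they are determined by the lengths
   c i of the projectives P_i.  Indecomposable modules are intervals [i, i + l)
   of the universal cover; such an interval is projective iff l = c i and
   injective iff it is not the radical part of [i - 1, i + l), whence
   def P_(i+1) = max(0, c (i+1) - c i).

   Number the vertices of Theta + A_1 from 0 to n, with A_1 at n, and let c' be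
   its lengths.  To build Lambda, insert after each vertex j as many new points
   as the defect of P_(j+1) says, but one after the last vertex n - 1 of Theta;
   call this number gap j and let top j be the place of j in Lambda.  Let
   P(top j + k), 0 <= k <= gap j, end just before top (j + c' j + k).  Then the
   socles are the vertices before the top j, so epsilon(Lambda) is the corner
   algebra at the vertices top j, which is Theta + A_1; the defects telescope to
   rank Lambda - (n + 1); and every projective has a copresentation by two
   projective-injective modules.  The vertex inserted after n - 1 makes all
   lengths at least 2 and the third term of the injective resolution of P(top n)
   nonprojective. *)

From HB Require Import structures.
Require Import Defs.
From mathcomp Require Import all_boot all_order all_algebra all_field.
From mathcomp Require Import finmap boolp classical_sets cardinality monalg
  zify.

Set Implicit Arguments.
Unset Strict Implicit.
Unset Printing Implicit Defensive.

Import GRing.Theory.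

Local Open Scope ring_scope.

(** * Modules over a finite-dimensional algebra *)

(** Why the dominant dimension is 2: from [p] to [p.+1] in Lambda the end of the projective either
    advances to the next top or stalls, and it stalls only if [p.+1] is itself a top. So a
    non-injective projective starts at a top, and its first cosyzygy ends just before that top.
    Projectives end exactly before tops, hence the cosyzygy embeds in a projective-injective module.
    The vertex inserted after n - 1 turns a rise into a stall; there the second cosyzygy is
    injective and one shorter than its projective cover. Dominant dimension ranges over all
    projectives and all minimal injective resolutions. The lower bound therefore uses
    copresentations that need not be minimal and add up over direct sums; for equality one explicit
    resolution suffices. The interface [nak] serves all algebras. Theta and its product with the
    field get it from their paths. Lambda is built from its lengths as an algebra of operators on
    matrices, which avoids quotients of an infinite-dimensional path algebra, and only then
    presented by the cyclic quiver. *)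

Lemma linfunE (K : fieldType) (U V : vectType K) (f : U -> V) :
  linear f -> linfun f =1 f.
Proof.
move=> lf x.
pose g : {linear U -> V} := HB.pack f (GRing.isLinear.Build K U V _ f lf).
exact: (lfunE g x).
Qed.

Lemma lfunD (K : fieldType) (U V : vectType K) (f : 'Hom(U, V)) x y :
  f (x + y) = f x + f y.
Proof. exact: linearD. Qed.

Lemma lfunB (K : fieldType) (U V : vectType K) (f : 'Hom(U, V)) x y :
  f (x - y) = f x - f y.
Proof. exact: linearB. Qed.

Lemma lfunZ (K : fieldType) (U V : vectType K) (f : 'Hom(U, V)) c x :
  f (c *: x) = c *: f x.
Proof. exact: linearZ. Qed.

Lemma lfun0 (K : fieldType) (U V : vectType K) (f : 'Hom(U, V)) : f 0 = 0.
Proof. exact: linear0. Qed.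

Lemma lfun_sum (K : fieldType) (U V : vectType K) (f : 'Hom(U, V)) J
    (r : seq J) (P : pred J) (F : J -> U) :
  f (\sum_(j <- r | P j) F j) = \sum_(j <- r | P j) f (F j).
Proof. exact: linear_sum. Qed.

Lemma lker_eq0 (K : fieldType) (U V : vectType K) (f : 'Hom(U, V)) :
  (forall x, f x = 0 -> x = 0) -> lker f = 0%VS.
Proof.
move=> f0; apply/eqP; rewrite -subv0; apply/subvP => x.
by rewrite memv_ker memv0 => /eqP /f0 ->.
Qed.

Lemma lker0_eq0 (K : fieldType) (U V : vectType K) (f : 'Hom(U, V)) x :
  lker f = 0%VS -> f x = 0 -> x = 0.
Proof. by move=> k0 fx; apply/eqP; rewrite -memv0 -k0 memv_ker fx. Qed.

Lemma lker0_inj (K : fieldType) (U V : vectType K) (f : 'Hom(U, V)) :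
  lker f = 0%VS -> injective f.
Proof. by move/eqP/lker0P. Qed.

Lemma limg_fullP (K : fieldType) (U V : vectType K) (f : 'Hom(U, V)) :
  limg f = fullv <-> forall y, exists x, f x = y.
Proof.
split=> [im y|sur].
  by have := memvf y; rewrite -im => /memv_imgP[x _ ->]; exists x.
apply/eqP; rewrite eqEsubv subvf; apply/subvP => y _.
by have [x <-] := sur y; rewrite memv_img ?memvf.
Qed.

Lemma lkerP (K : fieldType) (U V : vectType K) (f : 'Hom(U, V)) x :
  reflect (f x = 0) (x \in lker f).
Proof. by rewrite memv_ker; apply: eqP. Qed.

Section Modules.
Variables (K : fieldType) (A : falgType K).
Implicit Types M N P X Y Q I : fdmod A.

Section ActionModule.
Variables (V : vectType K) (act : A -> V -> V).
Hypothesis act_lin : forall a, linear (act a).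
Hypothesis act_linA : forall x, linear (act^~ x).
Hypothesis act1 : forall x, act 1 x = x.
Hypothesis actM : forall a b x, act (a * b) x = act b (act a x).

Definition mod_act : 'Hom(A, 'End(V)) := linfun (fun a => linfun (act a)).

Lemma mod_actE a x : mod_act a x = act a x.
Proof.
rewrite /mod_act linfunE ?linfunE // => c u v; apply/lfunP => y.
by rewrite !lfunE /= !lfunE /= !linfunE //; apply: act_linA.
Qed.

Fact mod_act1 : mod_act 1 = \1%VF.
Proof. by apply/lfunP => x; rewrite mod_actE act1 id_lfunE. Qed.

Fact mod_actM a b : mod_act (a * b) = (mod_act b \o mod_act a)%VF.
Proof. by apply/lfunP => x; rewrite comp_lfunE !mod_actE actM. Qed.

Definition action_module : fdmod A := FdMod mod_act1 mod_actM.

Lemma action_moduleE a (x : V) : mact action_module a x = act a x.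
Proof. exact: mod_actE. Qed.

End ActionModule.

Lemma mact_mul M a b (x : M) : mact M (a * b) x = mact M b (mact M a x).
Proof. by rewrite mactM comp_lfunE. Qed.

Lemma mact_one M (x : M) : mact M 1 x = x.
Proof. by rewrite mact1 id_lfunE. Qed.

Lemma mact0 M (x : M) : mact M 0 x = 0.
Proof. by rewrite linear0 zero_lfunE. Qed.

Lemma mactZ M c a (x : M) : mact M (c *: a) x = c *: mact M a x.
Proof. by rewrite linearZ scale_lfunE. Qed.

Lemma mact_sum M (J : Type) (r : seq J) (F : J -> A) (x : M) :
  mact M (\sum_(j <- r) F j) x = \sum_(j <- r) mact M (F j) x.
Proof. by rewrite linear_sum sum_lfunE. Qed.

Lemma is_hom_id M : is_hom (\1%VF : 'Hom(M, M)).
Proof. by move=> a x; rewrite !id_lfunE. Qed.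

Lemma is_hom_comp M N P (f : 'Hom(M, N)) (g : 'Hom(N, P)) :
  is_hom f -> is_hom g -> is_hom (g \o f)%VF.
Proof. by move=> hf hg a x; rewrite !comp_lfunE hf hg. Qed.

Lemma is_hom0 M N : is_hom (0 : 'Hom(M, N)).
Proof. by move=> a x; rewrite !zero_lfunE linear0. Qed.

Lemma submodule_lker M N (f : 'Hom(M, N)) : is_hom f -> submodule (lker f).
Proof. by move=> hf a x /lkerP fx; apply/lkerP; rewrite hf fx linear0. Qed.

Lemma submodule_img M N (f : 'Hom(M, N)) (U : {vspace M}) :
  is_hom f -> submodule U -> submodule (f @: U)%VS.
Proof.
move=> hf sU a _ /memv_imgP[x xU ->]; rewrite -hf; apply: memv_img.
exact: sU.
Qed.

Lemma submodule_full M : submodule (fullv : {vspace M}).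
Proof. by move=> a x _; apply: memvf. Qed.

Lemma submodule_limg M N (f : 'Hom(M, N)) : is_hom f -> submodule (limg f).
Proof. by move=> hf; apply: submodule_img => //; apply: submodule_full. Qed.

Lemma submodule_preim M N (f : 'Hom(M, N)) (U : {vspace N}) :
  is_hom f -> submodule U -> submodule (f @^-1: U)%VS.
Proof. by move=> hf sU a x; rewrite -!memv_preim hf; apply: sU. Qed.

Lemma submodule0 M : submodule (0%VS : {vspace M}).
Proof. by move=> a x; rewrite memv0 => /eqP ->; rewrite linear0 mem0v. Qed.

Section Subquotient.
Variables (M : fdmod A) (V : vectType K) (i : 'Hom(V, M)) (p : 'Hom(M, V)).
Hypothesis piK : cancel i p.
Hypothesis piM : forall a b x,
  p (mact M b (i (p (mact M a (i x))))) = p (mact M b (mact M a (i x))).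

Definition subquotient_act a x := p (mact M a (i x)).

Fact subquotient_lin a : linear (subquotient_act a).
Proof. by move=> c x y; rewrite /subquotient_act !linearP. Qed.

Fact subquotient_linA x : linear (subquotient_act^~ x).
Proof.
by move=> c a b; rewrite /subquotient_act linearP add_lfunE scale_lfunE linearP.
Qed.

Fact subquotient1 x : subquotient_act 1 x = x.
Proof. by rewrite /subquotient_act mact_one piK. Qed.

Fact subquotientM a b x :
  subquotient_act (a * b) x = subquotient_act b (subquotient_act a x).
Proof. by rewrite /subquotient_act mact_mul piM. Qed.

Definition subquotient : fdmod A :=
  action_module subquotient_lin subquotient_linA subquotient1 subquotientM.

Lemma subquotientE a (x : V) : mact subquotient a x = p (mact M a (i x)).
Proof. exact: action_moduleE. Qed.

End Subquotient.

Lemma submodule_mod M (U : {vspace M}) : submodule U ->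
  exists (N : fdmod A) (i : 'Hom(N, M)), [/\ is_hom i, lker i = 0%VS & limg i =
    U].
Proof.
move=> sU; pose i : 'Hom(subvs_of U, M) := linfun vsval.
pose p : 'Hom(M, subvs_of U) := linfun (vsproj U).
have iE x : i x = vsval x by rewrite lfunE.
have pK x : x \in U -> i (p x) = x by move=> xU; rewrite iE lfunE /= vsprojK.
have piK : cancel i p by move=> x; rewrite iE lfunE /= vsvalK.
have iU x : i x \in U by rewrite iE subvsP.
have piM a b x :
    p (mact M b (i (p (mact M a (i x))))) = p (mact M b (mact M a (i x))).
  by rewrite pK //; apply: sU.
exists (subquotient piK piM), i; split.
- by move=> a x; rewrite subquotientE pK //; apply: sU.
- by apply: lker_eq0 => x ix0; rewrite -[x]piK ix0 linear0.
- apply/eqP; rewrite eqEsubv; apply/andP; split; apply/subvP => x.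
    by move/memv_imgP => [y _ ->].
  by move/pK <-; rewrite memv_img ?memvf.
Qed.

Lemma quotient_mod M (U : {vspace M}) : submodule U ->
  exists (N : fdmod A) (p : 'Hom(M, N)),
    [/\ is_hom p, limg p = fullv & lker p = U].
Proof.
(* The quotient is realised on a linear complement of [U], in general not a submodule. *)
move=> sU; pose C := (U^C)%VS.
pose i : 'Hom(subvs_of C, M) := linfun vsval.
pose q : 'Hom(M, M) := daddv_pi C U.
pose p : 'Hom(M, subvs_of C) := (linfun (vsproj C) \o q)%VF.
have CU : (C :&: U = 0)%VS by rewrite capvC; apply: capv_compl.
have UC : (U :&: C = 0)%VS by apply: capv_compl.
have qC x : q x \in C by apply: memv_pi.
have iE x : i x = vsval x by rewrite lfunE.
have ip x : i (p x) = q x by rewrite comp_lfunE iE lfunE /= vsprojK.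
have piK : cancel i p.
  move=> x; rewrite comp_lfunE iE lfunE /= daddv_pi_id ?subvsP //.
  by rewrite vsvalK.
have full x : x \in (C + U)%VS by rewrite addvC addv_complf memvf.
have qU x : x - q x \in U.
  have := daddv_pi_add CU (full x); rewrite -/q => e.
  by rewrite -{1}e [q x + _]addrC addrK memv_pi.
have q0 x : x \in U -> q x = 0.
  move=> xU; have := daddv_pi_add CU (full x).
  by rewrite (daddv_pi_id UC xU) => /eqP;
    rewrite eq_sym -subr_eq subrr eq_sym => /eqP.
have p0 x : x \in U -> p x = 0 by move=> xU; rewrite comp_lfunE q0 ?linear0.
have piM a b x :
    p (mact M b (i (p (mact M a (i x))))) = p (mact M b (mact M a (i x))).
  rewrite ip; set y := mact M a _; apply/esym/eqP; rewrite -subr_eq0 -!linearB.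
  by apply/eqP/p0/sU.
exists (subquotient piK piM), p; split.
- move=> a x; rewrite subquotientE ip; apply/eqP.
  by rewrite -subr_eq0 -!linearB; apply/eqP/p0/sU.
- by apply/limg_fullP => y; exists (i y).
- apply/eqP; rewrite eqEsubv; apply/andP; split; apply/subvP => x.
    move/lkerP => px; have := ip x; rewrite px linear0 => q0x.
    by have := qU x; rewrite -q0x subr0.
  by move=> xU; apply/lkerP/p0.
Qed.

Fact regular_lin a : linear (fun x : A => x * a).
Proof. by move=> c x y; rewrite mulrDl scalerAl. Qed.

Fact regular_linA (x : A) : linear (fun a => x * a).
Proof. by move=> c a b; rewrite mulrDr scalerAr. Qed.

Definition regular_module : fdmod A :=
  action_module (act := fun a x => x * a) regular_lin regular_linA
    (@mulr1 A) (fun a b x => mulrA x a b).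

Lemma regular_moduleE a (x : A) : mact regular_module a x = x * a.
Proof. exact: action_moduleE. Qed.

Section Product.
Variables M N : fdmod A.

Definition prod_act a (x : M * N) := (mact M a x.1, mact N a x.2).

Fact prod_act_lin a : linear (prod_act a).
Proof. by move=> c x y; rewrite /prod_act !linearP. Qed.

Fact prod_act_linA x : linear (prod_act^~ x).
Proof.
by move=> c a b; rewrite /prod_act !linearP !add_lfunE !scale_lfunE.
Qed.

Fact prod_act1 x : prod_act 1 x = x.
Proof. by rewrite /prod_act !mact_one -surjective_pairing. Qed.

Fact prod_actM a b x : prod_act (a * b) x = prod_act b (prod_act a x).
Proof. by rewrite /prod_act !mact_mul. Qed.

Definition prod_module : fdmod A :=
  action_module prod_act_lin prod_act_linA prod_act1 prod_actM.

Lemma prod_moduleE a (x : prod_module) :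
  mact prod_module a x = (mact M a x.1, mact N a x.2).
Proof. exact: action_moduleE. Qed.

Definition prod_fst : 'Hom(prod_module, M) := linfun fst.
Definition prod_snd : 'Hom(prod_module, N) := linfun snd.
Definition prod_inl : 'Hom(M, prod_module) := linfun (fun x => (x, 0)).
Definition prod_inr : 'Hom(N, prod_module) := linfun (fun x => (0, x)).

Lemma prod_fstE (x : prod_module) : prod_fst x = x.1.
Proof. by rewrite lfunE. Qed.
Lemma prod_sndE (x : prod_module) : prod_snd x = x.2.
Proof. by rewrite lfunE. Qed.
Lemma prod_inlE x : prod_inl x = (x, 0).
Proof. by rewrite linfunE // => c u v; congr pair;
  rewrite /= scaler0 addr0. Qed.
Lemma prod_inrE x : prod_inr x = (0, x).
Proof. by rewrite linfunE // => c u v; congr pair;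
  rewrite /= scaler0 addr0. Qed.

Lemma is_hom_fst : is_hom prod_fst.
Proof. by move=> a x; rewrite !prod_fstE prod_moduleE. Qed.
Lemma is_hom_snd : is_hom prod_snd.
Proof. by move=> a x; rewrite !prod_sndE prod_moduleE. Qed.
Lemma is_hom_inl : is_hom prod_inl.
Proof. by move=> a x; rewrite prod_moduleE !prod_inlE /= linear0. Qed.
Lemma is_hom_inr : is_hom prod_inr.
Proof. by move=> a x; rewrite prod_moduleE !prod_inrE /= linear0. Qed.

End Product.

End Modules.

(** * Projective covers, invariance of the defect, and copresentations *)

Section Modules.
Variables (K : fieldType) (A : falgType K).
Implicit Types M N P X Y Q I S : fdmod A.

(** [f^-1] is only a linear section of [f]; the inclusion of kernels makes [g \o f^-1] independent
    of that choice and hence equivariant. *)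
Lemma hom_factor X Y P (f : 'Hom(X, Y)) (g : 'Hom(X, P)) :
  is_hom f -> is_hom g -> limg f = fullv -> (lker f <= lker g)%VS ->
  exists2 h : 'Hom(Y, P), is_hom h & forall x, h (f x) = g x.
Proof.
move=> hf hg imf kfg.
have fK y : f ((f^-1)%VF y) = y by apply: limg_lfunVK; rewrite imf memvf.
have kg x y : f x = f y -> g x = g y.
  move=> fxy; apply/eqP; rewrite -subr_eq0 -lfunB; apply/eqP/lkerP.
  by apply: (subvP kfg); apply/lkerP; rewrite lfunB fxy subrr.
exists (g \o f^-1)%VF => [a y|x]; rewrite ?comp_lfunE.
  by rewrite -hg; apply: kg; rewrite fK hf fK.
by apply: kg; rewrite fK.
Qed.

Lemma iso_inverse X Y (f : 'Hom(X, Y)) :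
  is_hom f -> lker f = 0%VS -> limg f = fullv ->
  exists2 g : 'Hom(Y, X), is_hom g & cancel f g /\ cancel g f.
Proof.
move=> hf kf imf.
have [|g hg gf] := hom_factor hf (@is_hom_id _ _ X) imf.
  by rewrite kf sub0v.
have fg x : g (f x) = x by rewrite gf id_lfunE.
exists g => //; split=> // y.
by have /limg_fullP/(_ y)[x <-] := imf; rewrite fg.
Qed.

Lemma can_mod_iso X Y (f : 'Hom(X, Y)) (g : 'Hom(Y, X)) :
  is_hom f -> cancel f g -> cancel g f -> mod_iso X Y.
Proof.
move=> hf fg gf; exists f; split=> //.
  by apply: lker_eq0 => x fx; rewrite -[x]fg fx lfun0.
by apply/limg_fullP => y; exists (g y).
Qed.

Lemma mod_iso_refl X : mod_iso X X.
Proof. by apply: (can_mod_iso (g := \1%VF) (@is_hom_id _ _ X)) => x;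
  rewrite !id_lfunE. Qed.

Lemma mod_iso_sym X Y : mod_iso X Y -> mod_iso Y X.
Proof.
case=> f [hf kf imf]; have [g hg [fg gf]] := iso_inverse hf kf imf.
exact: can_mod_iso hg gf fg.
Qed.

Lemma mod_iso_trans X Y P : mod_iso X Y -> mod_iso Y P -> mod_iso X P.
Proof.
case=> f [hf kf imf] [f' [hf' kf' imf']].
have [g hg [fg gf]] := iso_inverse hf kf imf.
have [g' hg' [fg' gf']] := iso_inverse hf' kf' imf'.
apply: (@can_mod_iso _ _ (f' \o f)%VF (g \o g')%VF).
- exact: is_hom_comp.
- by move=> x; rewrite !comp_lfunE fg' fg.
- by move=> x; rewrite !comp_lfunE gf gf'.
Qed.

Lemma same_kernel_iso P X Y (f : 'Hom(P, X)) (g : 'Hom(P, Y)) :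
  is_hom f -> is_hom g -> limg f = fullv -> limg g = fullv ->
  lker f = lker g -> mod_iso X Y.
Proof.
move=> hf hg imf img kfg.
have [|u hu uf] := hom_factor hf hg imf; first by rewrite kfg.
have [|v hv vg] := hom_factor hg hf img; first by rewrite kfg.
apply: (can_mod_iso hu (g := v)) => y.
  by have /limg_fullP/(_ y)[x <-] := imf; rewrite uf vg.
by have /limg_fullP/(_ y)[x <-] := img; rewrite vg uf.
Qed.

Lemma projective_retract P Q (i : 'Hom(P, Q)) (r : 'Hom(Q, P)) :
  is_hom i -> is_hom r -> cancel i r -> projective_module Q ->
  projective_module P.
Proof.
move=> hi hr ir pQ X Y g h hg img hh.
have [l hl gl] := pQ _ _ _ _ hg img (is_hom_comp hr hh).
exists (l \o i)%VF; first exact: is_hom_comp.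
by apply/lfunP => x; rewrite comp_lfunA gl !comp_lfunE ir.
Qed.

Lemma injective_retract N Q (i : 'Hom(N, Q)) (r : 'Hom(Q, N)) :
  is_hom i -> is_hom r -> cancel i r -> injective_module Q ->
  injective_module N.
Proof.
move=> hi hr ir iQ X Y g h hg kg hh.
have [l hl lg] := iQ _ _ _ _ hg kg (is_hom_comp hh hi).
exists (r \o l)%VF; first exact: is_hom_comp.
by apply/lfunP => x; rewrite -comp_lfunA lg !comp_lfunE ir.
Qed.

Lemma injective_iso P Q : mod_iso P Q -> injective_module Q ->
  injective_module P.
Proof.
case=> f [hf kf imf]; have [g hg [fg gf]] := iso_inverse hf kf imf.
exact: injective_retract hf hg fg.
Qed.

Lemma projective_split M P (l : 'Hom(M, P)) : projective_module P ->
  is_hom l -> limg l = fullv -> exists2 s : 'Hom(P, M), is_hom s & cancel s l.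
Proof.
move=> pP hl iml.
have [s hs ls] := pP _ _ _ _ hl iml (@is_hom_id _ _ P).
by exists s => // x; rewrite -comp_lfunE ls id_lfunE.
Qed.

Lemma injective_split N M (i : 'Hom(N, M)) : injective_module N ->
  is_hom i -> lker i = 0%VS -> exists2 r : 'Hom(M, N), is_hom r & cancel i r.
Proof.
move=> iN hi ki.
have [r hr ri] := iN _ _ _ _ hi ki (@is_hom_id _ _ N).
by exists r => // x; rewrite -comp_lfunE ri id_lfunE.
Qed.

Lemma projective_prod P Q : projective_module P -> projective_module Q ->
  projective_module (prod_module P Q).
Proof.
move=> pP pQ X Y g h hg img hh.
have [l hl gl] := pP _ _ _ _ hg img (is_hom_comp (@is_hom_inl _ _ P Q) hh).
have [l' hl' gl'] := pQ _ _ _ _ hg img (is_hom_comp (@is_hom_inr _ _ P Q) hh).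
exists ((l \o prod_fst P Q) + (l' \o prod_snd P Q))%VF.
  move=> a x; rewrite !add_lfunE !comp_lfunE is_hom_fst is_hom_snd hl hl'.
  by rewrite lfunD.
apply/lfunP => x; rewrite comp_lfunE add_lfunE !comp_lfunE lfunD.
rewrite -[g (l _)]comp_lfunE -[g (l' _)]comp_lfunE gl gl' !comp_lfunE.
rewrite -lfunD prod_inlE prod_inrE prod_fstE prod_sndE; congr (h _).
by case: x => a b; congr pair; rewrite /= ?addr0 ?add0r.
Qed.

Lemma injective_prod P Q : injective_module P -> injective_module Q ->
  injective_module (prod_module P Q).
Proof.
move=> iP iQ X Y g h hg kg hh.
have [l hl lg] := iP _ _ _ _ hg kg (is_hom_comp hh (@is_hom_fst _ _ P Q)).
have [l' hl' lg'] := iQ _ _ _ _ hg kg (is_hom_comp hh (@is_hom_snd _ _ P Q)).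
exists ((prod_inl P Q \o l) + (prod_inr P Q \o l'))%VF.
  move=> a x; rewrite !add_lfunE !comp_lfunE hl hl' is_hom_inl is_hom_inr.
  by rewrite lfunD.
apply/lfunP => x; rewrite comp_lfunE add_lfunE !comp_lfunE.
rewrite -[l (g _)]comp_lfunE -[l' (g _)]comp_lfunE lg lg' !comp_lfunE.
rewrite prod_inlE prod_inrE prod_fstE prod_sndE.
by case: (h x) => a b; congr pair; rewrite /= ?addr0 ?add0r.
Qed.

(** Divide by a proper submodule of largest dimension. *)
Lemma exists_simple_quotient M : (fullv : {vspace M}) <> 0%VS ->
  exists S (p : 'Hom(M, S)), [/\ simple_module S, is_hom p & limg p = fullv].
Proof.
move=> M0.
pose proper d := `[< exists U : {vspace M},
  [/\ submodule U, U <> fullv & \dim U = d] >].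
have ex : exists d, proper d.
  exists 0%N; apply/asboolP; exists 0%VS; split; last exact: dimv0.
    exact: submodule0.
  by move=> e; apply: M0.
have bnd d : proper d -> (d <= \dim (fullv : {vspace M}))%N.
  by move/asboolP => [U [_ _ <-]]; apply/dimvS/subvf.
have [d /asboolP[U [sU nU dU]] max] := ex_maxnP ex bnd.
have [S [p [hp imp kp]]] := quotient_mod sU.
exists S, p; split=> //; split.
- exact: submodule_full.
- move=> S0; apply: nU; rewrite -kp; apply/eqP; rewrite eqEsubv subvf /=.
  apply/subvP => x _; apply/lkerP/eqP; rewrite -memv0 -S0; exact: memvf.
- move=> W sW _; pose V := (p @^-1: W)%VS.
  have sV : submodule V by apply: submodule_preim.
  have UV : (U <= V)%VS.
    apply/subvP => x; rewrite -kp => /lkerP px.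
    by rewrite -memv_preim px mem0v.
  have pV y : y \in W -> exists2 x, x \in V & p x = y.
    move=> yW; have /limg_fullP/(_ y)[x px] := imp.
    by exists x => //; rewrite -memv_preim px.
  have [Vf|Vn] := pselect (V = fullv).
    right; apply/eqP; rewrite eqEsubv subvf /=; apply/subvP => y _.
    have /limg_fullP/(_ y)[x <-] := imp.
    by rewrite memv_preim -/V Vf memvf.
  left; apply/eqP; rewrite -subv0; apply/subvP => y /pV[x xV <-].
  have : V = U.
    apply/esym/eqP; rewrite eqEdim UV dU max //.
    by apply/asboolP; exists V.
  by move=> VU; move: xV; rewrite VU -kp => /lkerP ->; rewrite mem0v.
Qed.

Lemma cover_submodule P S (p : 'Hom(P, S)) (W : {vspace P}) :
  simple_module S -> projective_cover_map p -> submodule W ->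
  W = fullv \/ (W <= lker p)%VS.
Proof.
move=> [_ _ smin] [hp _ imp sup] sW.
have [|pW|pW] := smin (p @: W)%VS (submodule_img hp sW); first exact: subvf.
  right; apply/subvP => x xW; apply/lkerP/eqP.
  by rewrite -memv0 -pW memv_img.
left; apply: sup => //; apply/eqP; rewrite eqEsubv subvf /=.
apply/subvP => x _; have : p x \in (p @: W)%VS by rewrite pW memvf.
move=> /memv_imgP[y yW pxy]; rewrite -[x](subrK y).
by rewrite memv_add //; apply/lkerP; rewrite lfunB pxy subrr.
Qed.

Lemma cover_lker_proper P S (p : 'Hom(P, S)) :
  simple_module S -> projective_cover_map p -> lker p <> fullv.
Proof.
move=> [_ S0 _] [hp _ imp sup] kp; apply: S0; rewrite -imp.
apply/eqP; rewrite -subv0; apply/subvP => y /memv_imgP[x xf ->].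
by rewrite -kp in xf; move/lkerP: xf => ->; rewrite mem0v.
Qed.

Lemma cover_indecomposable P S : simple_module S -> projective_cover P S ->
  indecomposable_projective P.
Proof.
move=> sS [p cp]; split; last by case: cp.
have kp := cover_lker_proper sS cp.
split.
  move=> P0; apply: kp; apply/eqP; rewrite eqEsubv subvf P0.
  exact: sub0v.
move=> U W sU sW UW UW0.
have [Uf|Uk] := cover_submodule sS cp sU.
  by right; rewrite -UW0 Uf; apply/esym/capv_idPr/subvf.
have [Wf|Wk] := cover_submodule sS cp sW.
  by left; rewrite -UW0 Wf; apply/esym/capv_idPl/subvf.
case: kp; apply/eqP; rewrite eqEsubv subvf /= -UW.
by rewrite subv_add Uk Wk.
Qed.

Lemma cover_iso P S P' S' : simple_module S -> simple_module S' ->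
  projective_cover P S -> projective_cover P' S' -> mod_iso P P' ->
  mod_iso S S'.
Proof.
move=> sS sS' [p cp] [p' cp'] [h [hh kh imh]].
have [hp _ imp _] := cp; have [hp' _ imp' _] := cp'.
have hph := is_hom_comp hh hp'.
have imph : limg (p' \o h)%VF = fullv by rewrite limg_comp imh.
apply: (same_kernel_iso hp hph imp imph); apply/eqP; rewrite eqEsubv.
apply/andP; split.
  have [hf|/subvP le] := cover_submodule sS' cp' (submodule_img hh
    (submodule_lker hp)).
    case: (cover_lker_proper sS cp); apply/eqP; rewrite eqEsubv subvf /=.
    apply/subvP => x _; have : h x \in (h @: lker p)%VS by rewrite hf memvf.
    by move=> /memv_imgP[y yk /(lker0_inj kh) ->].
  apply/subvP => x xk; apply/lkerP; rewrite comp_lfunE; apply/lkerP/le.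
  exact: memv_img.
have [kf|//] := cover_submodule sS cp (submodule_lker hph).
case: sS' => _ S0 _; case: S0; rewrite -imph; apply/eqP; rewrite -subv0.
apply/subvP => y /memv_imgP[x xf ->].
by rewrite -kf in xf; move/lkerP: xf => ->; rewrite mem0v.
Qed.

Section Covers.
Variables (n : nat) (S P : 'I_n -> fdmod A).
Hypothesis repS : complete_reps (@simple_module K A) S.
Hypothesis coverP : forall i, projective_cover (P i) (S i).

Lemma simple_rep i : simple_module (S i).
Proof. by case: repS. Qed.

(** A simple quotient of [M] lifts, by projectivity, to a map into its cover [P i]; the image is not
    inside the kernel of the cover, so it is all of [P i]. *)
Lemma projective_surjects M : projective_module M ->
  (fullv : {vspace M}) <> 0%VS ->
  exists i (l : 'Hom(M, P i)), is_hom l /\ limg l = fullv.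
Proof.
move=> pM /exists_simple_quotient[T [q [sT hq imq]]].
have [_ _ /(_ _ sT)[i [f [hf kf imf]]]] := repS.
have [p cp] := coverP i; have [hp _ imp _] := cp.
have [l hl pl] := pM _ _ _ _ hp imp (is_hom_comp hq hf).
exists i, l; split=> //.
have [//|le] := cover_submodule (simple_rep i) cp (submodule_limg hl).
case: (simple_rep i) => _ S0 _; case: S0; rewrite -imf; apply/eqP;
  rewrite -subv0.
apply/subvP => y /memv_imgP[x _ ->]; have /limg_fullP/(_ x)[z <-] := imq.
rewrite -comp_lfunE -pl comp_lfunE memv0.
by apply/eqP/lkerP/(subvP le); rewrite memv_img ?memvf.
Qed.

(** An indecomposable projective surjects onto some [P i]; the surjection splits, and
    indecomposability makes its kernel zero. *)
Lemma complete_covers : complete_reps (@indecomposable_projective K A) P.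
Proof.
split=> [i|i j ij|M [iM pM]].
- exact: cover_indecomposable (simple_rep i) (coverP i).
- have [_ inj _] := repS; apply: inj.
  exact: cover_iso (simple_rep i) (simple_rep j) (coverP i) (coverP j) ij.
have [M0 dec] := iM.
have [i [l [hl iml]]] := projective_surjects pM M0.
have [[P0 _] pP] := cover_indecomposable (simple_rep i) (coverP i).
have [s hs sl] := projective_split pP hl iml.
exists i, l; split=> //.
have [||||//|s0] := dec (lker l) (limg s).
- exact: submodule_lker.
- exact: submodule_limg.
- apply/eqP; rewrite eqEsubv subvf; apply/subvP => x _.
  rewrite -[x](subrK (s (l x))) memv_add ?memv_img ?memvf //.
  by apply/lkerP; rewrite lfunB sl subrr.
- apply/eqP; rewrite -subv0; apply/subvP => x /memv_capP[/lkerP lx].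
  by move=> /memv_imgP[y _ xy]; move: lx; rewrite xy sl => ->;
    rewrite lfun0 mem0v.
case: P0; apply/eqP; rewrite -subv0; apply/subvP => y _.
have : s y \in limg s by rewrite memv_img ?memvf.
by rewrite s0 !memv0 => /eqP sy; rewrite -[y]sl sy lfun0.
Qed.

End Covers.

Lemma proper_injective_quotient_img P P' (h : 'Hom(P, P')) (U : {vspace P}) :
  is_hom h -> lker h = 0%VS -> limg h = fullv ->
  proper_injective_quotient U -> proper_injective_quotient (h @: U)%VS.
Proof.
move=> hh kh imh [U0 Uf [N [f [hf imf kf iN]]]].
have [g hg [hg1 hg2]] := iso_inverse hh kh imh.
have memU x : (h x \in (h @: U)%VS) = (x \in U).
  apply/idP/idP => [/memv_imgP[y yU /(lker0_inj kh) ->] //|]; exact: memv_img.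
split.
- move=> hU; apply: U0; apply/eqP; rewrite -subv0; apply/subvP => x.
  by rewrite -memU hU !memv0 => /eqP hx; rewrite -[x]hg1 hx lfun0.
- move=> hU; apply: Uf; apply/eqP; rewrite eqEsubv subvf; apply/subvP => x _.
  by rewrite -memU hU memvf.
exists N, (f \o g)%VF; split=> //.
- exact: is_hom_comp.
- apply/limg_fullP => y; have /limg_fullP/(_ y)[x <-] := imf.
  by exists (h x); rewrite comp_lfunE hg1.
- apply/eqP; rewrite eqEsubv; apply/andP; split; apply/subvP => y.
    by move=> /lkerP; rewrite comp_lfunE => /lkerP; rewrite kf -memU hg2.
  move=> yU; apply/lkerP; rewrite comp_lfunE; apply/lkerP.
  by rewrite kf -memU hg2.
Qed.

Lemma limg_can M M' (h : 'Hom(M, M')) (g : 'Hom(M', M)) (U : {vspace M}) :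
  cancel h g -> (g @: (h @: U) = U)%VS.
Proof.
move=> hg; rewrite -limg_comp (_ : (g \o h)%VF = \1%VF) ?lim1g //.
by apply/lfunP => x; rewrite comp_lfunE hg id_lfunE.
Qed.

Lemma defect_iso P P' :
  finite_set [set U : {vspace P} | proper_injective_quotient U]%classic ->
  mod_iso P P' -> defect P' = defect P.
Proof.
move=> fin [h [hh kh imh]].
have [g hg [hg1 hg2]] := iso_inverse hh kh imh.
have kg : lker g = 0%VS.
  by apply: lker_eq0 => x gx; rewrite -[x]hg2 gx lfun0.
have img : limg g = fullv by apply/limg_fullP => x; exists (h x).
have ghU (U : {vspace P}) : (g @: (h @: U) = U)%VS := limg_can U hg1.
have hgU (U : {vspace P'}) : (h @: (g @: U) = U)%VS := limg_can U hg2.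
rewrite /defect.
have -> : [set U : {vspace P'} | proper_injective_quotient U]%classic =
   ((fun U => (h @: U)%VS) @`
     [set U : {vspace P} | proper_injective_quotient U])%classic.
  rewrite eqEsubset; split=> [U /= qU|_ [U /= qU <-]].
    by exists (g @: U)%VS => //=; apply: proper_injective_quotient_img.
  exact: proper_injective_quotient_img.
rewrite fset_set_image // card_imfset //=.
exact: (can_inj ghU).
Qed.

(** Dominant dimension at least 2, expressed by an exact sequence 0 -> M -> Q -> Q' that need not be
    minimal. In this form the property passes to direct sums; [copresentation_resolution] returns to
    minimal resolutions. *)
Definition projective_injective_copresentation M : Prop :=
  exists (Q Q' : fdmod A) (f : 'Hom(M, Q)) (g : 'Hom(Q, Q')),
    [/\ projective_module Q /\ injective_module Q,
        projective_module Q' /\ injective_module Q',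
        is_hom f /\ lker f = 0%VS, is_hom g & lker g = limg f].

Lemma essential_mono M I Q (e : 'Hom(M, I)) (u : 'Hom(I, Q)) :
  essential (limg e) -> is_hom u -> lker (u \o e)%VF = 0%VS -> lker u = 0%VS.
Proof.
move=> ess hu k0; apply: ess; first exact: submodule_lker.
apply/eqP; rewrite -subv0; apply/subvP => y /memv_capP[/memv_imgP[x _ ->]].
move=> /lkerP uex; have -> : x = 0 by apply: (lker0_eq0 k0); rewrite comp_lfunE.
by rewrite lfun0 mem0v.
Qed.

(** As [limg e] is essential, I_0 embeds in [Q] and splits off. The cosyzygy I_0/M then embeds in
    [Q'] and is essential in I_1, so I_1 embeds in [Q'] and splits off too. *)
Lemma copresentation_resolution M (I : nat -> fdmod A) (e : 'Hom(M, I 0%N))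
    (d : forall j, 'Hom(I j, I j.+1)) :
  projective_injective_copresentation M -> minimal_injective_resolution e d ->
  projective_module (I 0%N) /\ projective_module (I 1%N).
Proof.
move=> [Q [Q' [f [g [[pQ iQ] [pQ' iQ'] [hf kf] hg kg]]]]].
move=> [[he ke ee] iI hd kd0 _].
have [u hu ue] := iQ _ _ _ _ he ke hf.
have ku : lker u = 0%VS by apply: (essential_mono ee hu); rewrite ue.
have [r hr ru] := injective_split (iI 0%N) hu ku.
split; first exact: projective_retract hu hr ru pQ.
have [hd0 ed0] := hd 0%N.
have [X [i [hi ki imi]]] := submodule_mod (submodule_limg hd0).
have hgu : is_hom (g \o u)%VF by apply: is_hom_comp.
have kgu : lker (g \o u)%VF = lker (d 0%N).
  rewrite kd0; apply/eqP; rewrite eqEsubv; apply/andP; split; apply/subvP => x.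
    move=> /lkerP; rewrite comp_lfunE => /lkerP; rewrite kg.
    move=> /memv_imgP[m _]; rewrite -ue comp_lfunE => /(lker0_inj ku) ->.
    by rewrite memv_img ?memvf.
  move=> /memv_imgP[m _ ->]; apply/lkerP; rewrite comp_lfunE.
  by apply/lkerP; rewrite kg -comp_lfunE ue memv_img ?memvf.
(* [w] is [d 0] with its codomain cut down to the image [X], the first cosyzygy of [M]. *)
pose w := (i^-1 \o d 0%N)%VF.
have iw x : i (w x) = d 0%N x.
  by rewrite comp_lfunE limg_lfunVK // imi memv_img ?memvf.
have hw : is_hom w by move=> a x; apply: (lker0_inj ki); rewrite hi !iw hd0.
have imw : limg w = fullv.
  apply/limg_fullP => x; have : i x \in limg (d 0%N).
    by rewrite -imi memv_img ?memvf.
  by move=> /memv_imgP[y _ ixy]; exists y; apply: (lker0_inj ki); rewrite iw.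
have kw : lker w = lker (d 0%N).
  apply/eqP; rewrite eqEsubv; apply/andP; split; apply/subvP => x /lkerP wx.
    by apply/lkerP; rewrite -iw wx lfun0.
  by apply/lkerP/(lker0_inj ki); rewrite iw wx lfun0.
have [|h hh hwx] := hom_factor hw hgu imw; first by rewrite kw kgu.
have kh : lker h = 0%VS.
  apply: lker_eq0 => x; have /limg_fullP/(_ x)[y <-] := imw.
  by rewrite hwx => /lkerP; rewrite kgu -kw => /lkerP.
have [v hv vi] := iQ' _ _ _ _ hi ki hh.
have kv : lker v = 0%VS.
  by apply: (essential_mono (e := i)) => //; rewrite ?imi ?vi.
have [r' hr' rv] := injective_split (iI 1%N) hv kv.
exact: projective_retract hv hr' rv pQ'.
Qed.

(** Here [M] is the direct sum of [X], embedded as [lker l], and [P]; the two copresentations are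
    added. *)
Lemma copresentation_split M P (l : 'Hom(M, P)) (s : 'Hom(P, M))
    X (i : 'Hom(X, M)) : is_hom l -> is_hom s -> cancel s l -> is_hom i ->
  lker i = 0%VS -> limg i = lker l ->
  projective_injective_copresentation X ->
  projective_injective_copresentation P ->
  projective_injective_copresentation M.
Proof.
move=> hl hs sl hi ki imi.
move=> [Q1 [R1 [f1 [g1 [[pQ1 iQ1] [pR1 iR1] [hf1 kf1] hg1 kg1]]]]].
move=> [Q2 [R2 [f2 [g2 [[pQ2 iQ2] [pR2 iR2] [hf2 kf2] hg2 kg2]]]]].
(* [i \o w] is the projection onto [lker l] along [limg s]. *)
pose w := (i^-1 \o (\1 - (s \o l)))%VF.
have iw x : i (w x) = x - s (l x).
  rewrite comp_lfunE limg_lfunVK ?add_lfunE ?opp_lfunE ?id_lfunE ?comp_lfunE //.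
  by rewrite imi; apply/lkerP; rewrite lfunB sl subrr.
clearbody w; have hw : is_hom w.
  by move=> a x; apply: (lker0_inj ki); rewrite hi !iw hl hs lfunB.
have li x : l (i x) = 0 by apply/lkerP; rewrite -imi memv_img ?memvf.
have wi x : w (i x) = x.
  by apply: (lker0_inj ki); rewrite iw li lfun0 subr0.
have ws x : w (s x) = 0.
  by apply: (lker0_inj ki); rewrite iw sl subrr lfun0.
pose f := ((prod_inl Q1 Q2 \o (f1 \o w)) + (prod_inr Q1 Q2 \o (f2 \o l)))%VF.
pose g := ((prod_inl R1 R2 \o (g1 \o prod_fst Q1 Q2))
           + (prod_inr R1 R2 \o (g2 \o prod_snd Q1 Q2)))%VF.
have fE x : f x = (f1 (w x), f2 (l x)).
  rewrite add_lfunE !comp_lfunE.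
  by rewrite prod_inlE prod_inrE; congr pair; rewrite /= ?addr0 ?add0r.
have gE x : g x = (g1 x.1, g2 x.2).
  rewrite add_lfunE !comp_lfunE prod_inlE prod_inrE prod_fstE prod_sndE.
  by congr pair; rewrite /= ?addr0 ?add0r.
exists (prod_module Q1 Q2), (prod_module R1 R2), f, g; split.
- by split; [apply: projective_prod|apply: injective_prod].
- by split; [apply: projective_prod|apply: injective_prod].
- split=> [a x|]; first by rewrite prod_moduleE !fE hw hl hf1 hf2.
  apply: lker_eq0 => x; rewrite fE => -[/(lker0_eq0 kf1) wx].
  move=> /(lker0_eq0 kf2) lx.
  by have := iw x; rewrite wx lx !lfun0 subr0.
- by move=> a x; rewrite prod_moduleE !gE prod_moduleE /= hg1 hg2.
apply/eqP; rewrite eqEsubv; apply/andP; split; apply/subvP => x.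
  move=> /lkerP; rewrite gE => -[/lkerP x1 /lkerP x2]; move: x1 x2.
  rewrite kg1 kg2 => /memv_imgP[y1 _ e1] /memv_imgP[y2 _ e2].
  have -> : x = f (i y1 + s y2).
    rewrite fE !lfunD wi ws li sl !lfun0 addr0 add0r -e1 -e2.
    exact: surjective_pairing.
  by rewrite memv_img ?memvf.
move=> /memv_imgP[y _ ->]; apply/lkerP; rewrite gE fE /=.
congr pair; apply/lkerP; rewrite ?kg1 ?kg2 memv_img ?memvf //.
Qed.

(** The dominant dimension of the algebra concerns decomposable projectives too: split off one [P i]
    and induct on the dimension. *)
Lemma projective_copresentation n (S P : 'I_n -> fdmod A) :
  complete_reps (@simple_module K A) S ->
  (forall i, projective_cover (P i) (S i)) ->
  (forall i, projective_injective_copresentation (P i)) ->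
  forall M, projective_module M -> projective_injective_copresentation M.
Proof.
move=> rS cP copP M; have [d] := ubnP (\dim (fullv : {vspace M})).
elim: d M => // d IH M dM pM.
have [M0|M0] := pselect ((fullv : {vspace M}) = 0%VS).
  have z (x : M) : x = 0 by apply/eqP; rewrite -memv0 -M0 memvf.
  have iM : injective_module M.
    move=> X Y g h _ _ _; exists 0; first exact: is_hom0.
    by apply/lfunP => x; rewrite [LHS]z [RHS]z.
  exists M, M, \1%VF, 0; split=> //.
  - split; first exact: is_hom_id.
    by apply: lker_eq0 => x _; apply: z.
  - exact: is_hom0.
  - apply/eqP; rewrite eqEsubv; apply/andP.
    by split; apply/subvP => x _; rewrite [x]z mem0v.
have [i [l [hl iml]]] := projective_surjects rS cP pM M0.
have [[P0 _] pP] := cover_indecomposable (simple_rep rS i) (cP i).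
have [s hs sl] := projective_split pP hl iml.
have [X [u [hu ku imu]]] := submodule_mod (submodule_lker hl).
apply: (copresentation_split hl hs sl hu ku imu) => //.
apply: IH.
  have := limg_ker_dim u fullv; rewrite ku capv0 dimv0 add0n => <-.
  rewrite -ltnS; apply: leq_trans dM; rewrite imu !ltnS.
  rewrite -(limg_ker_dim l fullv) iml capfv.
  by rewrite -[X in (X < _)%N]addn0 ltn_add2l lt0n dimv_eq0; apply/eqP.
pose w := (u^-1 \o (\1 - (s \o l)))%VF.
have iw x : u (w x) = x - s (l x).
  rewrite comp_lfunE limg_lfunVK ?add_lfunE ?opp_lfunE ?id_lfunE ?comp_lfunE //.
  by rewrite imu; apply/lkerP; rewrite lfunB sl subrr.
have hw : is_hom w.
  by move=> a x; apply: (lker0_inj ku); rewrite hu !iw hl hs lfunB.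
have li x : l (u x) = 0 by apply/lkerP; rewrite -imu memv_img ?memvf.
have wi : cancel u w.
  by move=> x; apply: (lker0_inj ku); rewrite iw li lfun0 subr0.
exact: projective_retract hu hw wi pM.
Qed.

End Modules.

(** * Nakayama algebras with a basis of paths *)

(** A Kupisch series, continued periodically to all natural numbers. The condition [kup_step]
    reflects that the radical of P_i is a quotient of P_(i+1). *)
Record kupisch (N : nat) (c : nat -> nat) : Prop := Kupisch {
  kup_gt0 : (0 < N)%N;
  kup_pos : forall i, (0 < c i)%N;
  kup_mod : forall i, c (i + N)%N = c i;
  kup_step : forall i, (c i <= (c i.+1).+1)%N
}.

Lemma periodic_modn (T : Type) (N : nat) (f : nat -> T) :
  (forall i, f (i + N)%N = f i) -> forall i j, i = j %[mod N] -> f i = f j.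
Proof.
move=> fN i j; have fq k r : f (k * N + r)%N = f r.
  by elim: k => [|k IH] //; rewrite mulSn -addnA addnC fN.
by rewrite {2}(divn_eq i N) {2}(divn_eq j N) !fq => ->.
Qed.

(** In the universal cover: the right end [i + c i] of the projective at [i] never moves left. *)
Lemma kup_drop N c i m : kupisch N c -> (c i <= m + c (i + m))%N.
Proof.
move=> kc; elim: m => [|m IH]; first by rewrite addn0.
by have := kup_step kc (i + m); rewrite -addnS; lia.
Qed.

(* The quotient of the path algebra of an oriented cycle with N vertices in
   which the paths starting at i of length at least c i vanish: [nb i k] is the
   path of length k from i, [nco i k] the coefficient at it, and vertices are
   natural numbers modulo N. *)
Record nak (K : fieldType) (A : algType K) (N : nat) (c : nat -> nat) := Nak {
  nb : nat -> nat -> A;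
  nco : nat -> nat -> A -> K;
  nak_kupisch : kupisch N c;
  nb_mod : forall i k, nb (i + N) k = nb i k;
  nbM : forall i k j l,
    nb i k * nb j l = if (i + k == j %[mod N])%N then nb i (k + l) else 0;
  nb_out : forall i k, (c i <= k)%N -> nb i k = 0;
  nb_sum1 : \sum_(i < N) nb i 0 = 1;
  nco_lin : forall i k a x y, nco i k (a *: x + y) = a * nco i k x + nco i k y;
  nco_nb : forall i k j l,
    nco i k (nb j l) = [&& i == j %[mod N], k == l & k < c i]%N%:R;
  nak_span : forall x, x = \sum_(i < N) \sum_(k < c i) nco i k x *: nb i k
}.

Section Nakayama.
Variables (K : fieldType) (A : algType K) (N : nat) (c : nat -> nat).
Variable nk : nak A N c.
Local Notation kc := (nak_kupisch nk).
Local Notation nb := (nb nk).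
Local Notation nco := (nco nk).

Lemma nb_eqmod i j k : i = j %[mod N] -> nb i k = nb j k.
Proof. exact: (periodic_modn (f := nb^~ k) ((nb_mod nk)^~ k)). Qed.

Lemma kup_eqmod i j : i = j %[mod N] -> c i = c j.
Proof. exact: periodic_modn (kup_mod kc) i j. Qed.

Lemma ncoD i k x y : nco i k (x + y) = nco i k x + nco i k y.
Proof. by rewrite -[x]scale1r nco_lin mul1r scale1r. Qed.

Lemma nco0 i k : nco i k 0 = 0.
Proof. by apply: (addIr (nco i k 0)); rewrite -ncoD !add0r. Qed.

Lemma ncoZ i k a x : nco i k (a *: x) = a * nco i k x.
Proof. by rewrite -[a *: x]addr0 nco_lin nco0 addr0. Qed.

Lemma nco_sum i k J (r : seq J) (P : pred J) (F : J -> A) :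
  nco i k (\sum_(j <- r | P j) F j) = \sum_(j <- r | P j) nco i k (F j).
Proof. exact: (big_morph (nco i k) (ncoD i k) (nco0 i k)). Qed.

Lemma nak_linear_eq (V : lmodType K) (f g : A -> V) : linear f -> linear g ->
  (forall i k, f (nb i k) = g (nb i k)) -> f =1 g.
Proof.
move=> lf lg fg x; rewrite (nak_span nk x).
pose f' : {linear A -> V} := HB.pack f (GRing.isLinear.Build K A V _ f lf).
pose g' : {linear A -> V} := HB.pack g (GRing.isLinear.Build K A V _ g lg).
rewrite -[f]/(f' : A -> V) -[g]/(g' : A -> V) !linear_sum;
  apply: eq_bigr => i _.
by rewrite !linear_sum; apply: eq_bigr => k _; rewrite !linearZ /= fg.
Qed.

Lemma nco_eqmod i j k x : i = j %[mod N] -> nco i k x = nco j k x.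
Proof.
move=> ij; move: x;
  apply: (nak_linear_eq (V := K^o) (nco_lin nk i k) (nco_lin nk j k)).
by move=> p l; rewrite !nco_nb ij (kup_eqmod ij).
Qed.

Lemma nco1 i k : nco i k 1 = (k == 0)%N%:R.
Proof.
have iN : (i %% N < N)%N by rewrite ltn_mod (kup_gt0 kc).
rewrite -(nb_sum1 nk) nco_sum (bigD1 (Ordinal iN)) //= big1 => [|j ji].
  rewrite nco_nb modn_mod eqxx addr0 /=; case: eqP => // ->.
  by rewrite (kup_pos kc).
rewrite nco_nb; case: eqP => //= ij; case/eqP: ji; apply: val_inj => /=.
by rewrite ij modn_small.
Qed.

(* The coefficient at the path from vertex p to vertex q of the universal
   cover. *)
Definition nentry (a : A) p q : K := if (p <= q)%N then nco p (q - p) a else 0.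

Lemma nentry_lin p q b x y :
  nentry (b *: x + y) p q = b * nentry x p q + nentry y p q.
Proof. by rewrite /nentry; case: ifP; rewrite ?nco_lin // mulr0 addr0. Qed.

Lemma nentry_nb i k j p l : (j < c i)%N ->
  nentry (nb p l) (i + k) (i + j) = ((i + k == p %[mod N]) && (j == k +
    l))%N%:R.
Proof.
move=> ji; rewrite /nentry nco_nb leq_add2l; case: (leqP k j) => kj; last first.
  have -> : (j == k + l)%N = false by lia.
  by rewrite andbF.
have -> : (i + j - (i + k) < c (i + k))%N by have := kup_drop i k kc; lia.
by rewrite andbT; congr (_ && _)%:R; lia.
Qed.

Lemma nb_mulr i k a :
  nb i k * a = \sum_(j < c i) nentry a (i + k) (i + j) *: nb i j.
Proof.
move: a; apply: (nak_linear_eq (f := fun a => nb i k * a)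
   (g := fun a => \sum_(j < c i) nentry a (i + k) (i + j) *: nb i j)).
- by move=> b u v; rewrite mulrDr scalerAr.
- move=> b u v; rewrite scaler_sumr -big_split; apply: eq_bigr => j _.
  by rewrite nentry_lin scalerDl scalerA.
move=> p l; rewrite nbM.
under eq_bigr => j _ do rewrite nentry_nb //.
have [ckl|lc] := leqP (c i) (k + l).
  rewrite nb_out // if_same big1 // => j _.
  have -> : (j == k + l :> nat) = false by have := ltn_ord j; lia.
  by rewrite andbF scale0r.
rewrite (bigD1 (Ordinal lc)) //= eqxx andbT big1 ?addr0 => [|j jl].
  by case: ifP => _; rewrite ?scale1r ?scale0r.
have -> : (j == k + l :> nat) = false; last by rewrite andbF scale0r.
by apply: contraNF jl => /eqP jl; apply/eqP/val_inj.
Qed.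

(** The counterpart of [nb_mulr] for paths ending at the vertex [i + l]. As [c i <= l], such a path
    vanishes if it starts at [i] or earlier, so the starts [i.+1 + k] with [k < l] are enough. This
    makes the interval of length [l] from [i.+1] injective. *)
Lemma nb_mull i l j a : (c i <= l)%N -> (j < l)%N ->
  a * nb (i.+1 + j) (l.-1 - j) =
  \sum_(k < l) nentry a (i.+1 + k) (i.+1 + j) *: nb (i.+1 + k) (l.-1 - k).
Proof.
move=> cl jl; move: a; apply: (nak_linear_eq (f := fun a => a * _)
   (g := fun a => \sum_(k < l) nentry a (i.+1 + k) (i.+1 + j) *:
      nb (i.+1 + k) (l.-1 - k))).
- by move=> b u v; rewrite mulrDl scalerAl.
- move=> b u v; rewrite scaler_sumr -big_split; apply: eq_bigr => k _.
  by rewrite nentry_lin scalerDl scalerA.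
move=> p m; rewrite nbM.
have entry (k : 'I_l) : nentry (nb p m) (i.+1 + k) (i.+1 + j) =
    [&& i.+1 + k == p %[mod N], j == k + m & m < c (i.+1 + k)]%N%:R.
  rewrite /nentry nco_nb leq_add2l; case: (leqP k j) => kj; last first.
    have -> : (j == k + m)%N = false by lia.
    by rewrite andbF.
  have -> : (i.+1 + j - (i.+1 + k) == m)%N = (j == k + m)%N :> bool by lia.
  case: (eqVneq j (k + m)%N) => [->|_]; last by rewrite andbF.
  by rewrite subnDl addKn.
under eq_bigr => k _ do rewrite entry.
have [mj|jm] := leqP m j; last first.
  rewrite [RHS]big1 => [|k _]; last first.
    have -> : (j == k + m)%N = false by lia.
    by rewrite andbF scale0r.
  (* The product would start at or before [i] and run to [i + l]; since ends never move left, its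
     length is at least [c p]. *)
  case: eqP => // pm; rewrite nb_out //.
  have := kup_drop p (m - j.+1) kc.
  have -> : c (p + (m - j.+1))%N = c i; last by lia.
  apply/kup_eqmod/eqP; rewrite -(eqn_modDr j.+1).
  have -> : (p + (m - j.+1) + j.+1 = p + m)%N by lia.
  by rewrite pm; apply/eqP; congr (_ %% _)%N; lia.
have kl : (j - m < l)%N by lia.
rewrite (bigD1 (Ordinal kl)) //= big1 ?addr0 => [|k kjm]; last first.
  have -> : (j == k + m)%N = false; last by rewrite andbF scale0r.
  by apply: contraNF kjm => /eqP kjm; apply/eqP/val_inj => /=; lia.
have -> : (j == j - m + m)%N by lia.
rewrite /= -[in LHS](subnK mj) addnA eqn_modDr eq_sym.
case: eqP => [e|_]; last by rewrite scale0r.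
rewrite -(nb_eqmod _ e);
  have -> : (m + (l.-1 - (j - m + m)) = l.-1 - (j - m))%N by lia.
case: leqP => [cm|_]; last by rewrite scale1r.
by rewrite nb_out ?scaler0 //; lia.
Qed.

Lemma nentryE i k j a : (j < c i)%N ->
  nentry a (i + k) (i + j) = nco i j (nb i k * a).
Proof.
move=> ji; rewrite nb_mulr nco_sum (bigD1 (Ordinal ji)) //= big1 ?addr0.
  by rewrite ncoZ nco_nb !eqxx ji mulr1.
move=> m mj; rewrite ncoZ nco_nb eqxx /=.
have -> : (j == m :> nat) = false; last by rewrite mulr0.
by apply: contraNF mj => /eqP mj; apply/eqP/val_inj.
Qed.

(** The entries of an element form an upper triangular matrix, so cutting it down to the first [l]
    rows and columns stays multiplicative. *)
Lemma nentryM i k j l a b : (l <= c i)%N -> (j < l)%N ->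
  nentry (a * b) (i + k) (i + j) =
  \sum_(m < l) nentry a (i + k) (i + m) * nentry b (i + m) (i + j).
Proof.
move=> li jl; have ji := leq_trans jl li.
rewrite nentryE // mulrA nb_mulr mulr_suml nco_sum.
under eq_bigr => m _ do rewrite -scalerAl ncoZ -nentryE //.
rewrite (big_ord_widen _ (fun m => nentry a (i + k) (i + m) *
  nentry b (i + m) (i + j)) li) [RHS]big_mkcond; apply: eq_bigr => m _.
case: ltnP => // lm; rewrite /nentry [X in _ * X]ifF ?mulr0 //; lia.
Qed.

Lemma nentry1 p q : nentry 1 p q = (p == q)%N%:R.
Proof.
rewrite /nentry nco1 subn_eq0; case: leqP => pq; last by rewrite gtn_eqF.
by congr (_%:R); lia.
Qed.

End Nakayama.

(** * Uniserial modules *)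

Section RowCoordinates.
Variables (K : fieldType) (l : nat).
Implicit Types (x y : 'rV[K]_l).

(** Coordinates indexed by natural numbers and zero beyond the end, so that shifts need no
    ordinals. *)
Definition rco x (k : nat) : K := oapp (x 0) 0 (insub k).

Definition mkrow (f : nat -> K) : 'rV[K]_l := \row_k f k.

Lemma rco_ord x (k : 'I_l) : rco x k = x 0 k.
Proof. by rewrite /rco valK. Qed.

Lemma rco_out x k : (l <= k)%N -> rco x k = 0.
Proof. by move=> lk; rewrite /rco insubN // -leqNgt. Qed.

Lemma rco_mkrow f k : rco (mkrow f) k = if (k < l)%N then f k else 0.
Proof.
case: ltnP => [kl|/rco_out -> //].
by rewrite -[k in LHS]/(val (Ordinal kl)) rco_ord mxE.
Qed.

Lemma rcoP x y : (forall k, (k < l)%N -> rco x k = rco y k) -> x = y.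
Proof. by move=> xy; apply/rowP => k; rewrite -!rco_ord xy. Qed.

Lemma rco_lin a x y k : rco (a *: x + y) k = a * rco x k + rco y k.
Proof.
have [kl|lk] := ltnP k l; last by rewrite !rco_out // mulr0 addr0.
by rewrite -[k]/(val (Ordinal kl)) !rco_ord !mxE.
Qed.

Lemma rco0 k : rco 0 k = 0.
Proof.
have [kl|lk] := ltnP k l; last by rewrite !rco_out // mulr0 addr0.
by rewrite -[k]/(val (Ordinal kl)) !rco_ord !mxE.
Qed.

Lemma rcoZ a x k : rco (a *: x) k = a * rco x k.
Proof. by rewrite -[a *: x]addr0 rco_lin rco0 addr0. Qed.

Lemma rcoB x y k : rco (x - y) k = rco x k - rco y k.
Proof. by rewrite addrC -scaleN1r rco_lin mulN1r addrC. Qed.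

Definition rbasis (k : nat) : 'rV[K]_l := mkrow (fun j => (j == k)%:R).

Lemma rco_basis k j : (j < l)%N -> rco (rbasis k) j = (j == k)%:R.
Proof. by move=> jl; rewrite rco_mkrow jl. Qed.

(** A kernel, hence a subspace by construction. These turn out to be all submodules of an interval
    module ([submodule_eq_tail]). *)
Definition tail s : {vspace 'rV[K]_l} :=
  lker (linfun (fun x : 'rV[K]_l => \row_(k < s) rco x k)).

Lemma tailP s x : reflect (forall k, (k < s)%N -> rco x k = 0) (x \in tail s).
Proof.
have lin : linear (fun x : 'rV[K]_l => \row_(k < s) rco x k).
  by move=> a u v; apply/rowP => k; rewrite !mxE rco_lin.
apply: (iffP (lkerP _ _)) => [|e]; rewrite linfunE //.
  by move=> e k ks; have /rowP/(_ (Ordinal ks)) := e; rewrite !mxE.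
by apply/rowP => k; rewrite !mxE e.
Qed.

Lemma tail_sub s s' : (s' <= s)%N -> (tail s <= tail s')%VS.
Proof.
move=> ss; apply/subvP => x /tailP e; apply/tailP => k ks.
by apply: e; apply: leq_trans ss.
Qed.

Lemma tail0 : tail 0 = fullv.
Proof.
apply/eqP; rewrite eqEsubv subvf; apply/subvP => x _.
exact/tailP.
Qed.

Lemma tail_out s : (l <= s)%N -> tail s = 0%VS.
Proof.
move=> ls; apply/eqP; rewrite -subv0; apply/subvP => x /tailP e.
rewrite memv0; apply/eqP/rcoP => k kl; rewrite rco0.
by apply: e; apply: leq_trans ls.
Qed.

Lemma rbasis_tail s k : (k < l)%N -> (rbasis k \in tail s) = (s <= k)%N.
Proof.
move=> kl; apply/tailP/idP => [e|sk j js].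
  by rewrite leqNgt; apply/negP => /e; rewrite rco_basis // eqxx => /eqP;
    rewrite oner_eq0.
by rewrite rco_mkrow; case: ifP => //; rewrite ltn_eqF //; apply: leq_trans sk.
Qed.

Lemma tail_inj s s' : (s <= l)%N -> (s' <= l)%N -> tail s = tail s' -> s = s'.
Proof.
wlog ss : s s' / (s <= s')%N.
  by move=> W; have [/W//|/ltnW s's sl s'l /esym] := leqP s s'; move/W => ->.
move=> sl s'l e; apply/eqP; rewrite eqn_leq ss leqNgt; apply/negP => lt.
have sl' : (s < l)%N by apply: leq_trans s'l.
have := rbasis_tail s sl'; rewrite e (rbasis_tail s' sl') leqnn.
by rewrite leqNgt lt.
Qed.

End RowCoordinates.

Section IntervalModules.
Variables (K : fieldType) (A : falgType K) (N : nat) (c : nat -> nat).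
Variable nk : nak A N c.
Local Notation kc := (nak_kupisch nk).
Local Notation nb := (nb nk).
Local Notation nco := (nco nk).
Local Notation nentry := (nentry nk).

Section Def.
Variables (i l : nat) (li : (l <= c i)%N).

Definition iv_act (a : A) (x : 'rV[K]_l) : 'rV[K]_l :=
  mkrow l (fun j => \sum_(k < l) rco x k * nentry a (i + k) (i + j)).

Fact iv_act_lin a : linear (iv_act a).
Proof.
move=> b x y; apply: rcoP => j jl; rewrite rco_lin !rco_mkrow jl.
rewrite mulr_sumr -big_split; apply: eq_bigr => k _.
by rewrite rco_lin mulrDl mulrA.
Qed.

Fact iv_act_linA x : linear (iv_act^~ x).
Proof.
move=> b u v; apply: rcoP => j jl; rewrite rco_lin !rco_mkrow jl.
rewrite mulr_sumr -big_split; apply: eq_bigr => k _.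
by rewrite nentry_lin mulrDr mulrCA.
Qed.

Fact iv_act1 x : iv_act 1 x = x.
Proof.
apply: rcoP => j jl; rewrite rco_mkrow jl (bigD1 (Ordinal jl)) //= big1.
  by rewrite nentry1 eqxx mulr1 addr0.
move=> k kj; rewrite nentry1 eqn_add2l.
have -> : (k == j :> nat) = false; last by rewrite mulr0.
by apply: contraNF kj => /eqP kj; apply/eqP/val_inj.
Qed.

Fact iv_actM a b x : iv_act (a * b) x = iv_act b (iv_act a x).
Proof.
apply: rcoP => j jl; rewrite !rco_mkrow jl.
under [RHS]eq_bigr => m _ do rewrite rco_mkrow ltn_ord mulr_suml.
rewrite exchange_big; apply: eq_bigr => k _; rewrite (nentryM _ _ _ _ li jl).
by rewrite mulr_sumr; apply: eq_bigr => m _; rewrite mulrA.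
Qed.

(* The uniserial module with composition factors S_i, ..., S_(i+l-1). *)
Definition ivm : fdmod A :=
  action_module iv_act_lin iv_act_linA iv_act1 iv_actM.

Lemma rco_act a (x : ivm) j : (j < l)%N ->
  rco (mact ivm a x) j = \sum_(k < l) rco x k * nentry a (i + k) (i + j).
Proof. by move=> jl; rewrite action_moduleE rco_mkrow jl. Qed.

Lemma rco_act_nb p m (x : ivm) j : (j < l)%N ->
  rco (mact ivm (nb p m) x) j =
  if (m <= j)%N && (i + (j - m) == p %[mod N])%N then rco x (j - m) else 0.
Proof.
move=> jl; rewrite rco_act //.
have e (k : 'I_l) : nentry (nb p m) (i + k) (i + j) =
    ((i + k == p %[mod N]) && (j == k + m))%N%:R.
  by rewrite nentry_nb //; apply: leq_trans li.
under eq_bigr => k _ do rewrite e.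
have [mj|jm] /= := leqP m j; last first.
  rewrite big1 // => k _; have -> : (j == k + m)%N = false by lia.
  by rewrite andbF mulr0.
have kl : (j - m < l)%N by lia.
rewrite (bigD1 (Ordinal kl)) //= big1 ?addr0 => [|k kj].
  rewrite subnK // eqxx andbT.
  by case: ifP => _; rewrite ?mulr1 ?mulr0.
have -> : (j == k + m)%N = false; last by rewrite andbF mulr0.
by apply: contraNF kj => /eqP e'; apply/eqP/val_inj; rewrite /= e' addnK.
Qed.

(** [rbasis K l j] is zero for [l <= j], the right value when the path leaves the interval. *)
Lemma act_rbasis k m : mact ivm (nb (i + k) m) (rbasis K l k) = rbasis K l (k +
  m).
Proof.
apply: rcoP => j jl; rewrite rco_act_nb // !rco_mkrow jl.
have [jkm|jkm] := eqVneq j (k + m)%N.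
  by rewrite jkm leq_addl addnK !eqxx /= ifT //; lia.
case: ifP => // /andP[mj _]; case: ifP => // _.
by have -> : (j - m == k)%N = false by lia.
Qed.

End Def.

Section HomFrom.
Variables (i l : nat) (li : (l <= c i)%N) (X : fdmod A) (y : X).
Hypothesis y0 : mact X (nb i l) y = 0.

(** The interval is P_i modulo the path of length [l], so a map out of it is given by the image of
    the top; [y0] is the relation this image must satisfy. *)
Definition iv_from : 'Hom(ivm li, X) :=
  linfun (fun x : 'rV[K]_l => \sum_(k < l) rco x k *: mact X (nb i k) y).

Lemma iv_fromE x : iv_from x = \sum_(k < l) rco x k *: mact X (nb i k) y.
Proof.
rewrite /iv_from linfunE // => a u v.
rewrite scaler_sumr -big_split; apply: eq_bigr => k _.
by rewrite rco_lin scalerDl scalerA.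
Qed.

Lemma is_hom_iv_from : is_hom iv_from.
Proof.
have vanish k : (l <= k)%N -> mact X (nb i k) y = 0.
  move=> lk; have := nbM nk i l (i + l) (k - l).
  by rewrite eqxx subnKC // => <-; rewrite mact_mul y0 lfun0.
move=> a x; rewrite !iv_fromE lfun_sum.
transitivity (\sum_(j < l) \sum_(k < l)
    (rco x k * nentry a (i + k) (i + j)) *: mact X (nb i j) y).
  by apply: eq_bigr => j _; rewrite rco_act // scaler_suml.
rewrite exchange_big; apply: eq_bigr => k _.
rewrite lfunZ -mact_mul nb_mulr mact_sum scaler_sumr.
rewrite (big_ord_widen _ (fun j => (rco x k * nentry a (i + k) (i + j)) *:
  mact X (nb i j) y) li) big_mkcond; apply: eq_bigr => j _.
rewrite mactZ scalerA; case: ltnP => // lj.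
by rewrite vanish ?scaler0.
Qed.

Lemma iv_from_top : (0 < l)%N -> iv_from (rbasis K l 0) = mact X (nb i 0) y.
Proof.
move=> l0; rewrite iv_fromE (bigD1 (Ordinal l0)) //= big1 => [|k k0].
  by rewrite rco_basis // scale1r addr0.
rewrite rco_basis //; have -> : (k == 0 :> nat) = false;
  last by rewrite scale0r.
by apply: contraNF k0 => /eqP k0; apply/eqP/val_inj.
Qed.

End HomFrom.

Lemma iv_hom_top i l (li : (l <= c i)%N) (X : fdmod A)
    (h : 'Hom(ivm li, X)) (x : 'rV[K]_l) :
  is_hom h -> h x = \sum_(k < l) rco x k *: mact X (nb i k) (h (rbasis K l 0)).
Proof.
move=> hh; have {1}-> : x = \sum_(k < l) rco x k *: (rbasis K l k : ivm li).
  apply/rowP => j; rewrite summxE (bigD1 j) //= big1 => [|k kj].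
    by rewrite !mxE eqxx mulr1 addr0 rco_ord.
  rewrite !mxE; have -> : (j == k :> nat) = false; last by rewrite mulr0.
  by apply: contraNF kj => /eqP kj; apply/eqP/val_inj.
rewrite lfun_sum; apply: eq_bigr => k _; rewrite lfunZ -hh.
by have := act_rbasis li 0 k; rewrite addn0 => ->.
Qed.

Lemma iv_projective i (li : (c i <= c i)%N) : projective_module (ivm li).
Proof.
move=> X Y g h hg img hh.
have /limg_fullP/(_ (h (rbasis K _ 0)))[y gy] := img.
have y0 : mact X (nb i (c i)) y = 0 by rewrite nb_out // mact0.
exists (iv_from li y); first exact: is_hom_iv_from.
apply/lfunP => x; rewrite comp_lfunE iv_fromE lfun_sum (iv_hom_top _ hh).
by apply: eq_bigr => k _; rewrite lfunZ hg gy.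
Qed.

Section HomInto.
Variables (i l : nat) (li : (l <= c i.+1)%N) (X : fdmod A) (phi : 'Hom(X, K^o)).
Hypothesis cl : (c i <= l)%N.

(** Dual to [iv_from]: coordinate [k] is the value of the form [phi] after travelling from the
    vertex [i.+1 + k] to the last vertex [i + l]. *)
Definition iv_into : 'Hom(X, ivm li) :=
  linfun (fun x => mkrow l (fun k => phi (mact X (nb (i.+1 + k) (l.-1 - k))
    x))).

Lemma rco_iv_into x k : (k < l)%N ->
  rco (iv_into x : 'rV_l) k = phi (mact X (nb (i.+1 + k) (l.-1 - k)) x).
Proof.
move=> kl; rewrite /iv_into linfunE ?rco_mkrow ?kl // => a u v.
apply: rcoP => j jl; rewrite rco_lin !rco_mkrow jl.
by rewrite !linearP.
Qed.

Lemma is_hom_iv_into : is_hom iv_into.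
Proof.
move=> a x; apply: rcoP => j jl; rewrite rco_act // rco_iv_into //.
rewrite -mact_mul nb_mull // mact_sum lfun_sum; apply: eq_bigr => k _.
by rewrite mactZ lfunZ rco_iv_into // mulrC.
Qed.

End HomInto.

(** A map into this interval is determined by the form it induces at the socle coordinate, and every
    form yields such a map through [iv_into]. Forms extend along the injective linear map [g], hence
    so do homomorphisms. *)
Lemma iv_injective i l (li : (l <= c i.+1)%N) : (c i <= l)%N ->
  injective_module (ivm li).
Proof.
move=> cl X Y g h hg kg hh.
have l0 : (0 < l)%N by apply: leq_trans cl; apply: kup_pos kc i.
pose phi : 'Hom(ivm li, K^o) := linfun (fun x : 'rV[K]_l => rco x l.-1 : K^o).
have phiE x : phi x = rco x l.-1.
  by rewrite /phi linfunE // => a u v; rewrite rco_lin.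
pose psi : 'Hom(Y, K^o) := (phi \o (h \o g^-1))%VF.
exists (iv_into li psi); first exact: is_hom_iv_into.
have gK x : (g^-1)%VF (g x) = x by apply: lker0_lfunK; rewrite kg.
apply/lfunP => x; rewrite comp_lfunE; apply: rcoP => k kl.
rewrite rco_iv_into // -hg !comp_lfunE gK phiE hh rco_act_nb; last by lia.
have -> : (l.-1 - (l.-1 - k) = k)%N by lia.
by rewrite eqxx andbT leq_subr.
Qed.

Lemma iv0_injective i (li : (0 <= c i)%N) : injective_module (ivm li).
Proof.
move=> X Y g h _ _ _; exists 0; first exact: is_hom0.
by apply/lfunP => x; apply: rcoP.
Qed.

Section IntervalHom.
Variables (i l : nat) (li : (l <= c i)%N) (i' l' : nat) (li' : (l' <= c i')%N).
Variable d : nat.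
Hypothesis ii' : i = i' + d %[mod N].
Hypothesis ll' : (l' <= d + l)%N.

(** In the universal cover the source starts [d] steps after the target and, by [ll'], does not end
    before it. The map is the quotient onto the common part followed by its inclusion. *)
Definition ivhom : 'Hom(ivm li, ivm li') :=
  linfun (fun x : 'rV[K]_l =>
    mkrow l' (fun j => if (d <= j)%N then rco x (j - d) else 0)).

Lemma rco_ivhom x j : (j < l')%N ->
  rco (ivhom x : 'rV_l') j = if (d <= j)%N then rco x (j - d) else 0.
Proof.
move=> jl; rewrite /ivhom linfunE ?rco_mkrow ?jl // => a u v.
apply: rcoP => k kl; rewrite rco_lin !rco_mkrow kl; case: ifP => _.
  by rewrite rco_lin.
by rewrite mulr0 addr0.
Qed.

Lemma ivhomE x : ivhom x =
  \sum_(k < l) rco x k *: mact (ivm li') (nb i k) (rbasis K l' d : ivm li').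
Proof.
apply: rcoP => j jl; rewrite rco_ivhom //.
have -> : rco (\sum_(k < l) rco x k *: mact (ivm li') (nb i k) (rbasis K l' d))
  j
  = \sum_(k < l) rco x k * rco (mact (ivm li') (nb i k) (rbasis K l' d)) j.
  elim/big_rec2: _ => [|k u v _ <-]; first by rewrite rco0.
  by rewrite rco_lin.
under eq_bigr => k _ do rewrite (nb_eqmod nk _ ii') act_rbasis rco_basis //.
case: leqP => dj; last first.
  rewrite big1 // => k _; have -> : (j == d + k)%N = false by lia.
  by rewrite mulr0.
have kl : (j - d < l)%N by lia.
rewrite (bigD1 (Ordinal kl)) //= big1 => [|k kj].
  by rewrite subnKC // eqxx mulr1 addr0.
have -> : (j == d + k)%N = false; last by rewrite mulr0.
by apply: contraNF kj => /eqP e; apply/eqP/val_inj; rewrite /= e addKn.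
Qed.

Lemma is_hom_ivhom : is_hom ivhom.
Proof.
have y0 : mact (ivm li') (nb i l) (rbasis K l' d : ivm li') = 0.
  rewrite (nb_eqmod nk _ ii') act_rbasis; apply: rcoP => j jl.
  rewrite rco_basis // rco0; have -> // : (j == d + l)%N = false by lia.
have e x : ivhom x = iv_from li (rbasis K l' d : ivm li') x.
  by rewrite ivhomE iv_fromE.
by move=> a x; rewrite !e; apply: (is_hom_iv_from y0).
Qed.

Lemma lker_ivhom : lker ivhom = tail K l (l' - d).
Proof.
apply/eqP; rewrite eqEsubv; apply/andP; split; apply/subvP => x.
  move=> /lkerP hx; apply/tailP => k ks.
  have kl : (k + d < l')%N by lia.
  by have := rco_ivhom x kl; rewrite hx rco0 leq_addl addnK.
move=> /tailP e; apply/lkerP; apply: rcoP => j jl.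
rewrite rco_ivhom // rco0; case: leqP => // dj.
by apply: e; lia.
Qed.

Lemma limg_ivhom : limg ivhom = tail K l' d.
Proof.
apply/eqP; rewrite eqEsubv; apply/andP; split; apply/subvP => x.
  move=> /memv_imgP[y _ ->]; apply/tailP => k kd.
  have [kl|lk] := ltnP k l'; last by rewrite rco_out.
  by rewrite rco_ivhom // leqNgt kd.
move=> /tailP e; pose y : ivm li := mkrow l (fun k => rco x (k + d)).
have -> : x = ivhom y.
  apply: rcoP => j jl; rewrite rco_ivhom //; case: leqP => dj; last exact: e.
  by rewrite rco_mkrow subnK // ifT //; lia.
by rewrite memv_img ?memvf.
Qed.

End IntervalHom.

Arguments is_hom_ivhom {i l} li {i' l'} li' {d}.
Arguments lker_ivhom {i l} li {i' l'} li' {d}.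
Arguments limg_ivhom {i l} li {i' l'} li' {d}.

Lemma iv_iso i l (li : (l <= c i)%N) i' (li' : (l <= c i')%N) :
  i = i' %[mod N] -> mod_iso (ivm li) (ivm li').
Proof.
move=> ii'; have ii0 : i = i' + 0 %[mod N] by rewrite addn0.
exists (ivhom li li' 0); split.
- exact: is_hom_ivhom.
- by rewrite (lker_ivhom li li' ii0) // subn0 tail_out.
- by rewrite (limg_ivhom li li' ii0) // tail0.
Qed.

Section Uniserial.
Variables (i l : nat) (li : (l <= c i)%N).

Lemma submodule_tail s : submodule (tail K l s : {vspace ivm li}).
Proof.
move=> a x /tailP e; apply/tailP => j js.
have [jl|lj] := ltnP j l; last by rewrite rco_out.
rewrite rco_act // big1 // => k _; have [ks|sk] := ltnP k s.
  by rewrite e ?mul0r.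
by rewrite /nentry ifF ?mulr0 //; lia.
Qed.

(** Uniseriality. Let [s] be the first coordinate occurring in [U]. Paths applied to an element
    nonzero there give vectors with every leading position from [s] on, and elimination yields the
    whole tail. *)
Lemma submodule_eq_tail (U : {vspace ivm li}) : submodule U ->
  exists2 s, (s <= l)%N & U = tail K l s.
Proof.
(* The alternative [s == l] lets the search succeed for the zero submodule. *)
move=> sU; pose P s := (s == l) || `[< exists2 u, u \in U & rco (u : 'rV_l) s
  <> 0 >].
have exP : exists s, P s by exists l; rewrite /P eqxx.
have [s Ps min] := ex_minnP exP.
have sl : (s <= l)%N by apply: min; rewrite /P eqxx.
exists s => //; apply/eqP; rewrite eqEsubv; apply/andP; split; apply/subvP => x.
  move=> xU; apply/tailP => k ks; apply/eqP; apply: contraLR ks => /eqP xk.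
  by rewrite -leqNgt; apply: min; rewrite /P; apply/orP; right; apply/asboolP;
    exists x.
case/orP: Ps => [/eqP ->|/asboolP[u uU us]].
  by rewrite tail_out // memv0 => /eqP ->; apply: mem0v.
have usU k : (k < s)%N -> rco (u : 'rV_l) k = 0.
  move=> ks; apply/eqP; apply: contraLR ks => /eqP uk.
  by rewrite -leqNgt; apply: min; rewrite /P; apply/orP; right; apply/asboolP;
    exists u.
(* Induction from the socle upwards: each stage admits one more leading coordinate. *)
suff tU m : forall x, x \in tail K l (s + (l - s - m)) -> x \in U.
  by move=> xs; apply: (tU (l - s)%N); rewrite subnn addn0.
elim: m => [|m IH] {}x.
  by rewrite subn0 subnKC // tail_out // memv0 => /eqP ->; apply: mem0v.
have [lm|ml] := leqP (l - s) m.
  have -> : (l - s - m.+1 = l - s - m)%N by lia.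
  exact: IH.
set k := (l - s - m.+1)%N => /tailP xk.
pose w := mact (ivm li) (nb (i + s) k) u.
have skl : (s + k < l)%N by rewrite /k; lia.
have wsk : rco (w : 'rV_l) (s + k) = rco (u : 'rV_l) s.
  by rewrite rco_act_nb // leq_addl addnK eqxx.
have wlt j : (j < s + k)%N -> rco (w : 'rV_l) j = 0.
  move=> js; rewrite rco_act_nb; last by lia.
  by case: ifP => // /andP[kj _]; rewrite usU //; lia.
pose z := x - (rco (x : 'rV_l) (s + k) / rco (u : 'rV_l) s) *: w.
have zU : z \in U.
  apply: IH; apply/tailP => j js; rewrite rcoB rcoZ.
  have [jk|jk] := leqP (s + k) j; last by rewrite wlt // xk // mulr0 subr0.
  have -> : j = (s + k)%N by rewrite /k in jk js *; lia.
  by rewrite wsk divfK ?subrr //; apply/eqP.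
have -> : x = z + (rco (x : 'rV_l) (s + k) / rco (u : 'rV_l) s) *: w.
  by rewrite /z subrK.
by rewrite memvD // memvZ // sU.
Qed.

Lemma iv_superfluous (U : {vspace ivm li}) : submodule U -> U <> fullv ->
  superfluous U.
Proof.
move=> /submodule_eq_tail[s sl ->] sf W /submodule_eq_tail[[|s'] sl' ->].
  by rewrite tail0.
case: s => [|s] in sl sf *; first by rewrite tail0 in sf.
move=> e; case: sf; apply/eqP; rewrite eqEsubv subvf /=.
have l0 : (0 < l)%N by apply: leq_trans sl.
have : rbasis K l 0 \in (fullv : {vspace ivm li}) by apply: memvf.
have : (tail K l s.+1 + tail K l s'.+1 <= tail K l 1)%VS.
  by rewrite subv_add !tail_sub.
by rewrite e => /subvP le /le; rewrite rbasis_tail.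
Qed.

Lemma iv_essential (U : {vspace ivm li}) : submodule U -> U <> 0%VS ->
  essential U.
Proof.
move=> /submodule_eq_tail[s sl ->] s0 W /submodule_eq_tail[s' sl' ->].
have ss : (s < l)%N.
  by rewrite ltn_neqAle sl andbT; apply/eqP => e; apply: s0; rewrite e tail_out.
have [ls'|s'l] := leqP l s'; first by rewrite [tail K l s']tail_out.
move=> cap; have : rbasis K l l.-1 \in (tail K l s :&: tail K l s')%VS.
  by rewrite memv_cap !rbasis_tail; lia.
rewrite cap memv0 => /eqP /(congr1 (fun x : 'rV[K]_l => rco x l.-1)).
rewrite rco0 rco_basis ?eqxx; last by lia.
by move/eqP; rewrite oner_eq0.
Qed.

Lemma iv_indecomposable : (0 < l)%N -> indecomposable (ivm li).
Proof.
move=> l0; split.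
  move=> f0; have : rbasis K l 0 \in (fullv : {vspace ivm li}) by apply: memvf.
  by rewrite f0 -(tail_out K (leqnn l)) rbasis_tail //; lia.
move=> U W sU sW _ UW; have [->|U0] := pselect (U = 0%VS); first by left.
by right; apply: (iv_essential sU U0) UW.
Qed.

End Uniserial.

(** The interval is the radical of the one of length [l.+1] from [i], which exists because
    [l < c i]. A retraction would write its top as the arrow [nb i 1] applied to something, but the
    arrow lands in the radical. *)
Lemma iv_not_injective i l (li : (l <= c i.+1)%N) : (0 < l)%N -> (l < c i)%N ->
  ~ injective_module (ivm li).
Proof.
move=> l0 lc inj.
have ii : i.+1 = i + 1 %[mod N] by rewrite addn1.
have ll : (l.+1 <= 1 + l)%N by [].
have [|r hr gr] := injective_split inj (is_hom_ivhom li lc ii ll).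
  by rewrite (lker_ivhom li lc ii) // subn1 tail_out.
set g := ivhom li lc 1 in gr; pose u : ivm lc := rbasis K l.+1 0.
have gu : g (rbasis K l 0) = mact (ivm lc) (nb i 1) u.
  have := act_rbasis lc 0 1; rewrite addn0 => ->.
  apply: rcoP => j jl; rewrite rco_ivhom // !rco_mkrow jl.
  case: j jl => [|j] jl //=; rewrite subn1 /= add0n eqSS.
  by rewrite ifT.
have := gr (rbasis K l 0);
  rewrite gu hr => /(congr1 (fun x : 'rV[K]_l => rco x 0)).
rewrite rco_act_nb // rco_basis // eqxx /= => /esym/eqP.
by rewrite oner_eq0.
Qed.

(** A section of the surjection from P_i would send the top to an element with nonzero top
    coordinate killed by the path of length [l]; as [l < c i], that path kills no such element of
    P_i. *)
Lemma iv_not_projective i l (li : (l <= c i)%N) : (0 < l)%N -> (l < c i)%N ->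
  ~ projective_module (ivm li).
Proof.
move=> l0 lc pr.
have ii : i = i + 0 %[mod N] by rewrite addn0.
have ll : (l <= 0 + c i)%N by [].
have := limg_ivhom (leqnn (c i)) li ii ll; rewrite tail0 => img.
have [s hs sg] := projective_split pr (is_hom_ivhom (leqnn _) li ii ll) img.
set g := ivhom (leqnn (c i)) li 0 in sg img.
have e0 : mact (ivm li) (nb i l) (rbasis K l 0 : ivm li) = 0.
  have := act_rbasis li 0 l; rewrite addn0 => ->.
  apply: rcoP => j jl; rewrite rco_basis // rco0 add0n.
  by rewrite ltn_eqF.
have := hs (nb i l) (rbasis K l 0); rewrite e0 lfun0.
move=> /esym/(congr1 (fun x : 'rV[K]_(c i) => rco x l)).
rewrite rco0 rco_act_nb // leqnn subnn addn0 eqxx /=.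
have := sg (rbasis K l 0); move=> /(congr1 (fun x : 'rV[K]_l => rco x 0)).
rewrite rco_ivhom // subnn rco_basis // eqxx /= => -> /eqP.
by rewrite oner_eq0.
Qed.

Lemma iv_quotient_injective i l (li : (l <= c i.+1)%N) s (sc : (s <= c i.+1)%N)
  :
  (s <= l)%N ->
  (exists (Y : fdmod A) (f : 'Hom(ivm li, Y)),
     [/\ is_hom f, limg f = fullv, lker f = tail K l s & injective_module Y])
       <->
  injective_module (ivm sc).
Proof.
move=> sl; have ii : i.+1 = i.+1 + 0 %[mod N] by rewrite addn0.
have ll : (s <= 0 + l)%N by [].
have hf := is_hom_ivhom li sc ii ll.
have imf := limg_ivhom li sc ii ll; rewrite tail0 in imf.
have kf := lker_ivhom li sc ii ll; rewrite subn0 in kf.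
split=> [[Y [g [hg img kg iY]]]|inj]; last by exists (ivm sc), (ivhom li sc 0).
by apply: (injective_iso _ iY); apply: (same_kernel_iso hf hg) => //;
  rewrite kf kg.
Qed.

(** By uniseriality the nonzero proper quotients are the shorter intervals from [i.+1]; the one of
    length [s] is injective precisely when [c i <= s]. *)
Lemma injective_quotients_iv i l (li : (l <= c i.+1)%N) :
  [set U : {vspace ivm li} | proper_injective_quotient U]%classic =
  [set` [fset tail K l s | s in iota (c i) (l - c i)]%fset]%classic.
Proof.
rewrite eqEsubset; split=> U /=.
  move=> [U0 Uf [Y [f [hf imf kf iY]]]].
  have sU : submodule U by rewrite -kf; apply: submodule_lker.
  have [s sl Us] := submodule_eq_tail sU.
  have s0 : (0 < s)%N.
    by case: s Us {sl} => // Us; case: Uf; rewrite Us tail0.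
  have sl' : (s < l)%N.
    by rewrite ltn_neqAle sl andbT; apply/eqP => e; apply: U0;
      rewrite Us e tail_out.
  have sc : (s <= c i.+1)%N by exact: leq_trans sl li.
  have inj : injective_module (ivm sc).
    apply/(iv_quotient_injective li sc sl).
    by exists Y, f; rewrite -Us.
  apply/imfsetP; exists s => //=; rewrite mem_iota.
  have [ci|lt] := leqP (c i) s; first by lia.
  by case: (iv_not_injective (li := sc) s0 lt inj).
move=> /imfsetP[s /=]; rewrite mem_iota => slt ->.
have c0 := kup_pos kc i.
have l0 : (0 < l)%N by lia.
have sc : (s <= c i.+1)%N by lia.
have sl : (s <= l)%N by lia.
split.
- rewrite -(tail_out K (leqnn l)) => /tail_inj => e.
  by have := e sl (leqnn l); lia.
- by rewrite -tail0 => /tail_inj => e; have := e sl (leq0n l); lia.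
- by apply/(iv_quotient_injective li sc sl)/iv_injective; lia.
Qed.

Lemma defect_iv i l (li : (l <= c i.+1)%N) : defect (ivm li) = (l - c i)%N.
Proof.
rewrite /defect injective_quotients_iv set_fsetK.
rewrite card_in_imfset /= ?card_fseq ?undup_id ?iota_uniq ?size_iota //.
move=> s s'; rewrite !mem_iota => sl s'l; apply: tail_inj; lia.
Qed.

(** Modulo the radical of the target only the idempotent at [i'] acts nontrivially, so a map from an
    interval at another vertex misses the top. *)
Lemma iv_iso_eqmod i l (li : (l <= c i)%N) i' l' (li' : (l' <= c i')%N) :
  (0 < l)%N -> (0 < l')%N -> mod_iso (ivm li) (ivm li') -> i = i' %[mod N].
Proof.
move=> l0 l'0 [f [hf kf imf]].
apply/eqP; apply: contraT => ii'.
have /limg_fullP/(_ (rbasis K l' 0))[x fx] := imf.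
have := congr1 (fun x : 'rV[K]_l' => rco x 0) fx.
rewrite (iv_hom_top _ hf) rco_basis // eqxx.
have -> : rco (\sum_(k < l) rco x k *: mact (ivm li') (nb i k) (f (rbasis K l
  0))
               : 'rV_l') 0 = 0.
  elim/big_rec: _ => [|k u _ u0]; first exact: rco0.
  rewrite rco_lin u0 addr0 rco_act_nb // sub0n addn0.
  case: ifP => [/andP[_ /eqP e]|]; last by rewrite mulr0.
  by rewrite e eqxx in ii'.
by move/esym/eqP; rewrite oner_eq0.
Qed.

End IntervalModules.

Arguments is_hom_ivhom {K A N c nk i l} li {i' l'} li' {d}.
Arguments lker_ivhom {K A N c nk i l} li {i' l'} li' {d}.
Arguments limg_ivhom {K A N c nk i l} li {i' l'} li' {d}.

(** * Simple modules, projective covers and the translate *)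

Section VertexModules.
Variables (K : fieldType) (A : falgType K) (N : nat) (c : nat -> nat).
Variable nk : nak A N c.
Local Notation kc := (nak_kupisch nk).
Local Notation nb := (nb nk).
Local Notation nco := (nco nk).
Local Notation nentry := (nentry nk).

Definition vsimple i : fdmod A := ivm nk (kup_pos kc i).
Definition vproj i : fdmod A := ivm nk (leqnn (c i)).

Lemma vsimpleP i : simple_module (vsimple i).
Proof.
split; first exact: submodule_full.
  by have [] := iv_indecomposable nk (kup_pos kc i) (ltn0Sn 0).
move=> W /submodule_eq_tail[s s1 ->] _.
case: s s1 => [|[|//]] _; first by right; rewrite tail0.
by left; rewrite tail_out.
Qed.

Definition vtop i : 'Hom(vproj i, vsimple i) :=
  ivhom nk (leqnn (c i)) (kup_pos kc i) 0.

Lemma lker_vtop i : lker (vtop i) = tail K (c i) 1.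
Proof.
have ii : i = i + 0 %[mod N] by rewrite addn0.
have l1 : (1 <= 0 + c i)%N := kup_pos kc i.
by rewrite (lker_ivhom _ _ ii) ?subn0.
Qed.

Lemma vtop_cover i : projective_cover_map (vtop i).
Proof.
have ii : i = i + 0 %[mod N] by rewrite addn0.
have l1 : (1 <= 0 + c i)%N := kup_pos kc i.
split.
- exact: is_hom_ivhom.
- exact: iv_projective.
- by rewrite (limg_ivhom _ _ ii) // tail0.
rewrite lker_vtop; apply: iv_superfluous; first exact: submodule_tail.
rewrite -(tail0 K (c i)) => /tail_inj e.
by have := e (kup_pos kc i) (leq0n _).
Qed.

Lemma vproj_cover i : projective_cover (vproj i) (vsimple i).
Proof. by exists (vtop i); apply: vtop_cover. Qed.

(** Some vertex idempotent acts nontrivially on [X], so P_i maps onto [X]. The kernels of P_i -> X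
    and P_i -> S_i are both the largest proper submodule. *)
Lemma simple_iso_vsimple X : simple_module X -> exists i, mod_iso X (vsimple i).
Proof.
move=> sX; have [_ X0 Xmin] := sX.
have [i [y y0]] : exists i, exists y : X, mact X (nb i 0) y <> 0.
  apply: contrapT => no; apply: X0; apply/eqP; rewrite -subv0.
  apply/subvP => y _;
    rewrite -[y]mact_one -(nb_sum1 nk) mact_sum big1 ?mem0v //.
  by move=> i _; apply: contrapT => yi; apply: no; exists i, y.
exists i; apply: mod_iso_sym.
have yc : mact X (nb i (c i)) y = 0 by rewrite nb_out // mact0.
pose f : 'Hom(vproj i, X) := iv_from nk (leqnn (c i)) y.
have hf : is_hom f := is_hom_iv_from yc.
have imf : limg f = fullv.
  have [|f0|//] := Xmin (limg f) (submodule_limg hf); first exact: subvf.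
  case: y0; rewrite -(iv_from_top nk (leqnn (c i)) y (kup_pos kc i)).
  apply/eqP; rewrite -memv0 -f0; apply: memv_img; exact: memvf.
have [p cp] := vproj_cover i; have [hp _ imp _] := cp.
have kp : lker p <> fullv := cover_lker_proper (vsimpleP i) cp.
have cf : projective_cover_map f.
  split=> //; first exact: iv_projective.
  apply: iv_superfluous; first exact: submodule_lker.
  move=> kf; apply: X0; rewrite -imf; apply/eqP; rewrite -subv0.
  apply/subvP => z /memv_imgP[x xf ->].
  by rewrite -kf in xf; move/lkerP: xf => ->; rewrite mem0v.
have kf : lker f <> fullv := cover_lker_proper sX cf.
apply: (same_kernel_iso hp hf) => //; apply/eqP; rewrite eqEsubv.
have [//|->] := cover_submodule sX cf (submodule_lker hp).
by have [//|->] := cover_submodule (vsimpleP i) cp (submodule_lker hf).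
Qed.

Lemma vsimple_iso i j : i = j %[mod N] -> mod_iso (vsimple i) (vsimple j).
Proof. exact: iv_iso. Qed.

(** The offset [m] chooses the window of the universal cover that supplies representatives: 1 gives
    every vertex a predecessor, and a large offset leaves room for searches to the left. *)
Lemma complete_vsimple m :
  complete_reps (@simple_module K A) (fun i : 'I_N => vsimple (m + i)).
Proof.
split=> [i|i j ij|X /simple_iso_vsimple[i Xi]]; first exact: vsimpleP.
  have /eqP := iv_iso_eqmod (ltn0Sn 0) (ltn0Sn 0) ij.
  by rewrite eqn_modDl !modn_small // => /eqP /val_inj.
have N0 := kup_gt0 kc.
(* Modulo [N], adding [m * N.-1] subtracts [m]. *)
have jN : ((i + m * N.-1) %% N < N)%N by rewrite ltn_mod.
exists (Ordinal jN); apply: mod_iso_trans Xi _; apply: vsimple_iso => /=.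
rewrite modnDmr addnCA -mulnS prednK //.
by rewrite -modnDmr modnMl addn0.
Qed.

Lemma complete_vproj m : complete_reps (@indecomposable_projective K A)
  (fun i : 'I_N => vproj (m + i)).
Proof. exact: complete_covers (complete_vsimple m) (fun i => vproj_cover _).
  Qed.

Lemma defect_vproj P i : mod_iso P (vproj i.+1) -> defect P = (c i.+1 - c i)%N.
Proof.
move=> /mod_iso_sym isoP; rewrite -(defect_iv nk (leqnn (c i.+1))).
apply: defect_iso isoP; rewrite injective_quotients_iv; exact: finite_fset.
Qed.

Lemma sum_defect (P : 'I_N -> fdmod A) :
  complete_reps (@indecomposable_projective K A) P ->
  \sum_i defect (P i) = \sum_(i < N) (c i.+1 - c i)%N.
Proof.
move=> [indP injP _]; have [_ _ vrep] := complete_vproj 1.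
have [s sP] := choice (fun i => vrep _ (indP i)).
have s_inj : injective s.
  move=> i j sij; apply: injP; apply: mod_iso_trans (sP i) _.
  by rewrite sij; apply: mod_iso_sym.
rewrite [RHS](reindex_inj s_inj); apply: eq_bigr => i _.
exact: defect_vproj.
Qed.

Lemma algebra_defect_nak : algebra_defect A (\sum_(i < N) (c i.+1 - c i))%N.
Proof.
exists N, (fun i : 'I_N => vproj (1 + i)); have rep := complete_vproj 1.
by split=> //; rewrite sum_defect.
Qed.

Lemma nb_mulr0 i a : nb i 0 * a = \sum_(k < c i) nco i k a *: nb i k.
Proof.
rewrite nb_mulr; apply: eq_bigr => k _; congr (_ *: _).
by rewrite /nentry leq_add2l leq0n subnDl subn0; apply: nco_eqmod;
  rewrite addn0.
Qed.

Lemma nco0M i a b : nco i 0 (a * b) = nco i 0 a * nco i 0 b.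
Proof.
have := nentryM nk (i := i) 0 a b (kup_pos kc i) (ltn0Sn 0).
by rewrite big_ord1 !addn0 /nentry leqnn subnn.
Qed.

(* A path ending at i+1 is stationary or passes through the arrow from i. *)
Lemma nb_endl i y :
  exists z, y * nb i.+1 0 = nco i.+1 0 y *: nb i.+1 0 + z * nb i 1.
Proof.
pose P y := exists z, y * nb i.+1 0 = nco i.+1 0 y *: nb i.+1 0 + z * nb i 1.
have PD u v : P u -> P v -> P (u + v).
  move=> [w eu] [w' ev]; exists (w + w').
  by rewrite mulrDl eu ev ncoD scalerDl mulrDl addrACA.
have P0 : P 0 by exists 0; rewrite !mul0r nco0 scale0r addr0.
rewrite -/(P y) (nak_span nk y); apply: (big_ind P) => // j _.
apply: (big_ind P) => // k _; move: (nco j k y) => a {y}.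
rewrite /P ncoZ -scalerAl nbM nco_nb addn0 -scalerA.
case: (val k) => [|l].
  rewrite addn0 eq_sym (kup_pos kc) !andbT; exists 0; rewrite mul0r addr0.
  case: eqP => [/(nb_eqmod nk 0) ->|_]; first by rewrite scale1r.
  by rewrite scale0r.
rewrite andbF scale0r scaler0.
case: ifP => [jl|_]; last by exists 0; rewrite mul0r addr0 scaler0.
exists (a *: nb j l); rewrite add0r -scalerAl nbM ifT ?addn1 //.
by rewrite -(eqn_modDr 1) !addn1 -addnS.
Qed.

(** The minimal presentation is P_(i+1) -> P_i -> S_i: by [1 < c i] the radical of P_i is nonzero,
    so P_(i+1) covers it. Evaluation at the top identifies Hom(P_(i+1), A) with the span of the
    paths ending at i+1, and maps factoring through [p] with those using the arrow from i. The
    stationary path spans the quotient, and its coefficient defines [b]. *)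
Lemma is_tau_vsimple i : (1 < c i)%N -> is_tau (vsimple i) (vsimple i.+1).
Proof.
move=> ci; have ii : i.+1 = i + 1 %[mod N] by rewrite addn1.
have ll : (c i <= 1 + c i.+1)%N by exact: kup_step kc i.
pose p : 'Hom(vproj i.+1, vproj i) :=
  ivhom nk (leqnn (c i.+1)) (leqnn (c i)) 1.
have hp : is_hom p by apply: is_hom_ivhom.
exists (vproj i.+1), (vproj i), p, (vtop i); split.
  split=> //.
  - exact: vtop_cover.
  - exact: iv_projective.
  - by rewrite (limg_ivhom _ _ ii) // lker_vtop.
  rewrite (lker_ivhom _ _ ii) //; apply: iv_superfluous.
    exact: submodule_tail.
  rewrite -(tail0 K (c i.+1)) => /tail_inj e.
  by have := e ltac:(lia) (leq0n _); lia.
pose v0 : vproj i.+1 := rbasis K (c i.+1) 0.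
pose u0 : vproj i := rbasis K (c i) 0.
have v0e : mact (vproj i.+1) (nb i.+1 0) v0 = v0.
  by have := act_rbasis nk (leqnn (c i.+1)) 0 0; rewrite addn0.
have pv0 : p v0 = mact (vproj i) (nb i 1) u0.
  have := act_rbasis nk (leqnn (c i)) 0 1; rewrite addn0 => ->.
  apply: rcoP => j jl; rewrite rco_ivhom // !rco_mkrow jl.
  case: j jl => [|j] jl //=; rewrite subn1 /= add0n eqSS ifT //.
  by have := kup_step kc i; lia.
pose bf (x : 'rV[K]_1) (g : 'Hom(vproj i.+1, A)) : K^o :=
  rco x 0 * nco i.+1 0 (g v0).
pose b : 'Hom(vsimple i.+1, 'Hom('Hom(vproj i.+1, A), K^o)) :=
  linfun (fun x => linfun (bf x)).
have bE x g : b x g = bf x g.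
  have lin y : linear (bf y).
    move=> a g1 g2; rewrite /bf add_lfunE scale_lfunE nco_lin mulrDr.
    by rewrite mulrCA.
  rewrite /b linfunE ?linfunE // => a u v; apply/lfunP => g'.
  by rewrite add_lfunE scale_lfunE !linfunE // /bf rco_lin mulrDl -mulrA.
pose R := regular_module A.
have AhomP (P : fdmod A) (g : 'Hom(P, A)) :
    is_Ahom g <-> is_hom (g : 'Hom(P, R)).
  by split=> hg a x; have := hg a x; rewrite regular_moduleE.
pose h (j : nat) (z : A) : 'Hom(vproj j, A) := iv_from nk (leqnn (c j)) (z : R).
have hh j z : is_Ahom (h j z).
  by apply/AhomP/is_hom_iv_from; rewrite regular_moduleE nb_out ?mulr0.
have h0 j z : h j z (rbasis K (c j) 0) = z * nb j 0.
  rewrite -[RHS]regular_moduleE.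
  exact: (iv_from_top nk (leqnn (c j)) (z : R) (kup_pos kc j)).
exists b; split.
- move=> a x g hg; rewrite !bE /bf comp_lfunE lfunE /= nco0M mulrA.
  by rewrite rco_act // big_ord1 /nentry leqnn subnn addn0.
- move=> x g hg; rewrite bE /bf comp_lfunE pv0 hg nco0M nco_nb andbF.
  by rewrite !mulr0.
- move=> x b0; have := b0 (h i.+1 1) (hh _ _).
  rewrite bE /bf h0 mul1r nco_nb !eqxx (kup_pos kc) mulr1 => x0.
  by apply: rcoP => k k0; rewrite rco0; case: k k0.
move=> phi phi0; exists (mkrow 1 (fun=> phi (h i.+1 1))) => g hg.
have [z gz] := nb_endl i (g v0).
(* By [nb_endl], [g] is a multiple of the map given by the stationary path plus a map through [p],
   which [phi] kills. *)
have gE : g = nco i.+1 0 (g v0) *: h i.+1 1 + (h i z \o p)%VF.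
  have hr : is_hom (nco i.+1 0 (g v0) *: h i.+1 1 + (h i z \o p)%VF
                    : 'Hom(vproj i.+1, R)).
    move=> a x; rewrite regular_moduleE !add_lfunE !scale_lfunE !comp_lfunE.
    by rewrite hp !hh mulrDl scalerAl.
  apply/lfunP => x; rewrite (iv_hom_top x (proj1 (AhomP _ _) hg)).
  rewrite (iv_hom_top x hr); apply: eq_bigr => k _; congr (_ *: mact R _ _).
  rewrite -/v0 -{1}v0e hg gz add_lfunE scale_lfunE comp_lfunE pv0 hh !h0.
  by rewrite mul1r -mulrA nbM addn0 eqxx.
rewrite bE /bf rco_mkrow /= [in RHS]gE linearD linearZ /= phi0 //.
by rewrite addr0 mulrC.
Qed.

End VertexModules.

(** * Socles *)

Section Socles.
Variables (K : fieldType) (A : falgType K).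
Implicit Types P S : fdmod A.

Lemma simple_submodule_img P P' (h : 'Hom(P, P')) (g : 'Hom(P', P))
    (W : {vspace P}) : is_hom h -> is_hom g -> cancel h g -> cancel g h ->
  simple_submodule W -> simple_submodule (h @: W)%VS.
Proof.
move=> hh hg hgK ghK [sW W0 Wmin]; split; first exact: submodule_img.
  by move=> hW; apply: W0; rewrite -(limg_can W hgK) hW limg0.
move=> V sV VW; have [||gV|gV] := Wmin (g @: V)%VS.
- exact: submodule_img.
- by rewrite -(limg_can W hgK) limgS.
- by left; rewrite -(limg_can V ghK) gV limg0.
- by right; rewrite -(limg_can V ghK) gV.
Qed.

Lemma is_socle_img P P' (h : 'Hom(P, P')) (g : 'Hom(P', P))
    (U : {vspace P}) : is_hom h -> is_hom g -> cancel h g -> cancel g h ->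
  is_socle U -> is_socle (h @: U)%VS.
Proof.
move=> hh hg hgK ghK [Umax Umin]; split=> [W sW|V Vmax].
  by rewrite -(limg_can W ghK) limgS // Umax //; apply: simple_submodule_img sW.
rewrite -(limg_can V ghK) limgS // Umin // => W sW.
rewrite -(limg_can W hgK) limgS // Vmax //.
exact: simple_submodule_img sW.
Qed.

Lemma is_socle_unique P (U V : {vspace P}) : is_socle U -> is_socle V -> U = V.
Proof.
move=> [U1 U2] [V1 V2]; apply/eqP; rewrite eqEsubv.
by rewrite U2 // V2.
Qed.

Lemma same_image_iso P S S' (f : 'Hom(S, P)) (g : 'Hom(S', P)) :
  is_hom f -> is_hom g -> lker f = 0%VS -> lker g = 0%VS ->
  limg f = limg g -> mod_iso S S'.
Proof.
move=> hf hg kf kg fg.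
have gK x : g ((g^-1)%VF (f x)) = f x.
  by rewrite limg_lfunVK // -fg memv_img ?memvf.
have fK x : f ((f^-1)%VF (g x)) = g x.
  by rewrite limg_lfunVK // fg memv_img ?memvf.
apply: (can_mod_iso (f := (g^-1 \o f)%VF) (g := (f^-1 \o g)%VF)).
- by move=> a x; apply: (lker0_inj kg); rewrite hg !comp_lfunE !gK hf.
- by move=> x; apply: (lker0_inj kf); rewrite !comp_lfunE fK gK.
- by move=> x; apply: (lker0_inj kg); rewrite !comp_lfunE gK fK.
Qed.

Lemma socle_of_iso P P' S S' : mod_iso P P' -> mod_iso S' S ->
  socle_of P S -> socle_of P' S'.
Proof.
move=> [h [hh kh imh]] [u [hu ku imu]] [f [hf kf sf]].
have [g hg [hgK ghK]] := iso_inverse hh kh imh.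
exists (h \o (f \o u))%VF; split.
- by do 2?apply: is_hom_comp.
- apply: lker_eq0 => x; rewrite !comp_lfunE.
  by move=> /(lker0_eq0 kh)/(lker0_eq0 kf)/(lker0_eq0 ku).
- by rewrite limg_comp limg_comp imu; apply: is_socle_img hh hg hgK ghK sf.
Qed.

Lemma socle_of_unique P S S' : socle_of P S -> socle_of P S' -> mod_iso S S'.
Proof.
move=> [f [hf kf sf]] [g [hg kg sg]].
by apply: (same_image_iso hf hg) => //; apply: is_socle_unique.
Qed.

Variables (N : nat) (c : nat -> nat) (nk : nak A N c).

Lemma socle_of_iv i l (li : (l <= c i)%N) : (0 < l)%N ->
  socle_of (ivm nk li) (vsimple nk (i + l.-1)).
Proof.
case: l li => // l li _ /=.
have ll : (l.+1 <= l + 1)%N by rewrite addn1.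
have sub : simple_submodule (tail K l.+1 l : {vspace ivm nk li}).
  split; first exact: submodule_tail.
    by rewrite -(tail_out K (leqnn l.+1)) => /tail_inj e;
      have := e _ (leqnn _); lia.
  move=> W /submodule_eq_tail[s sl ->]; case: (leqP s l) => [ls|ls]; last first.
    by left; rewrite tail_out.
  move=> /subvP/(_ (rbasis K l.+1 s));
    rewrite !rbasis_tail // leqnn => /(_ isT).
  by move=> ls'; right; congr (tail _ _ _); lia.
exists (ivhom nk (kup_pos (nak_kupisch nk) (i + l)) li l); split.
- exact: is_hom_ivhom.
- by rewrite (lker_ivhom _ _ (erefl _)) // subSnn tail_out.
rewrite (limg_ivhom _ _ (erefl _)) //; split=> [W [sW W0 Wmin]|V]; last exact.
have [s sl Ws] := submodule_eq_tail sW.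
have [ls|sl'] := leqP l.+1 s; first by case: W0; rewrite Ws tail_out.
have [sub_l nz _] := sub.
have [|/nz //|->] := Wmin (tail K l.+1 l) sub_l; last exact: subvv.
by rewrite Ws tail_sub.
Qed.

Lemma socle_of_vproj i :
  socle_of (vproj nk i) (vsimple nk (i + (c i).-1)).
Proof.
exact: socle_of_iv (kup_pos (nak_kupisch nk) i).
Qed.

End Socles.

(** * The algebra epsilon *)

Section Epsilon.
Variables (K : fieldType) (A : falgType K) (B : algType K).
Variables (N : nat) (c : nat -> nat) (nk : nak A N c).
Variables (N' : nat) (c' : nat -> nat) (nk' : nak B N' c').
Local Notation kc := (nak_kupisch nk).
Local Notation kc' := (nak_kupisch nk').

(* The vertices t j of A are the tops of the modules P(tau S), and
   soc P(t j) = tau^-1 S(t (j + c' j)). *)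
Variable t : nat -> nat.
Hypothesis t0 : t 0 = 0.
Hypothesis t_mono : forall j, (t j < t j.+1)%N.
Hypothesis t_period : forall j, t (j + N')%N = (t j + N)%N.
Hypothesis t_proj : forall j, (t j + c (t j) = t (j + c' j))%N.
Hypothesis t_top : forall i, exists j, (i + c i = t j)%N.
Hypothesis t_hit : forall j, exists i, (i + c i = t j %[mod N])%N.
Hypothesis c_gt1 : forall i, (1 < c i)%N.

Lemma t_lt i j : (i < j)%N -> (t i < t j)%N.
Proof.
elim: j => // j IH; rewrite ltnS leq_eqVlt => /orP[/eqP -> //|/IH ij].
exact: ltn_trans ij (t_mono j).
Qed.

Lemma t_le i j : (t i <= t j)%N = (i <= j)%N.
Proof.
have [|/t_lt] := leqP i j; last by rewrite ltnNge => /negbTE.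
by rewrite leq_eqVlt => /orP[/eqP ->|/t_lt/ltnW]; rewrite ?leqnn.
Qed.

Lemma t_inj i j : t i = t j -> i = j.
Proof.
by move=> e; apply/eqP; rewrite eqn_leq -(t_le i) -(t_le j) e leqnn.
Qed.

Lemma t_periodM j q : t (q * N' + j)%N = (q * N + t j)%N.
Proof.
elim: q => [|q IH] //.
by rewrite mulSn -addnA addnC t_period IH mulSn; lia.
Qed.

Lemma t_small j : (j < N')%N -> (t j < N)%N.
Proof. by move/t_lt; have := t_period 0; rewrite add0n t0 => ->. Qed.

Lemma t_modn j : (t j %% N = t (j %% N'))%N.
Proof.
rewrite {1}(divn_eq j N') t_periodM modnMDl modn_small //.
by rewrite t_small // ltn_mod (kup_gt0 kc').
Qed.

Lemma t_eqmod i j : (t i == t j %[mod N])%N = (i == j %[mod N'])%N.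
Proof.
rewrite !t_modn; apply/eqP/eqP => [|-> //].
exact: t_inj.
Qed.

Lemma t_mod_exists p j : p = t j %[mod N] -> exists k, p = t k.
Proof.
move=> pj; exists (p %/ N * N' + j %% N')%N.
by rewrite t_periodM -t_modn -pj -divn_eq.
Qed.

Lemma t_gap i k j l : i = j %[mod N'] ->
  (t (i + k) - t i == t (j + l) - t j)%N = (k == l).
Proof.
move=> ij; rewrite (divn_eq i N') (divn_eq j N') -!addnA !t_periodM !subnDl ij.
set r := (j %% N')%N; have rk := t_le r (r + k); have rl := t_le r (r + l).
rewrite !leq_addr in rk rl.
rewrite -(eqn_add2r (t r)) !subnK //; apply/eqP/eqP => [/t_inj|-> //].
exact: addnI.
Qed.

(** The path of B from [i] with [k] steps goes to the path of A from [t i] to [t (i + k)]; the image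
    is the corner of A at the vertices [t j]. *)
Definition corner_map (x : B) : A :=
  \sum_(i < N') \sum_(k < c' i) nco nk' i k x *: nb nk (t i) (t (i + k) - t i).

Lemma corner_map_lin : linear corner_map.
Proof.
move=> a x y; rewrite scaler_sumr -big_split; apply: eq_bigr => i _.
rewrite scaler_sumr -big_split; apply: eq_bigr => k _.
by rewrite nco_lin scalerDl scalerA.
Qed.

Lemma corner_map0 : corner_map 0 = 0.
Proof. by rewrite /corner_map big1 // => i _; rewrite big1 // => k _;
  rewrite nco0 scale0r. Qed.

(** This extends the definition to vertices outside the fundamental domain and to vanishing paths:
    by [t_proj] a path of B vanishes exactly when its image does. *)
Lemma corner_map_nb i k : corner_map (nb nk' i k) = nb nk (t i) (t (i + k) - t
  i).
Proof.
have [ck|kc'i] := leqP (c' i) k.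
  rewrite nb_out // [RHS]nb_out; last first.
    rewrite -(leq_add2l (t i)) t_proj subnKC ?t_le ?leq_add2l //.
    exact: leq_addr.
  by rewrite /corner_map big1 // => j _; rewrite big1 // => l _;
    rewrite nco0 scale0r.
have iN : (i %% N' < N')%N by rewrite ltn_mod (kup_gt0 kc').
rewrite /corner_map (bigD1 (Ordinal iN)) //= [X in _ + X]big1 ?addr0;
  last first.
  move=> j ji; rewrite big1 // => l _; rewrite nco_nb; case: eqP => [e|_].
    case/eqP: ji; apply: val_inj; rewrite /= -e modn_small //.
  by rewrite scale0r.
have cmod : c' (i %% N')%N = c' i.
  by apply: (kup_eqmod nk'); rewrite modn_mod.
have ki : (k < c' (i %% N'))%N by rewrite cmod.
rewrite (bigD1 (Ordinal ki)) //= big1 ?addr0; last first.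
  move=> l lk; rewrite nco_nb; have -> : (l == k :> nat) = false.
    by apply: contraNF lk => /eqP e; apply/eqP/val_inj.
  by rewrite andbF scale0r.
rewrite nco_nb modn_mod !eqxx ki scale1r.
have -> : (t (i %% N' + k) - t (i %% N') = t (i + k) - t i)%N.
  by apply/eqP; rewrite t_gap ?modn_mod.
by apply: nb_eqmod; apply/eqP; rewrite t_eqmod modn_mod.
Qed.

Lemma corner_mapM x y : corner_map (x * y) = corner_map x * corner_map y.
Proof.
move: x; apply: (nak_linear_eq (nk := nk') (V := A) (f := fun x => corner_map
  (x * y))
  (g := fun x => corner_map x * corner_map y)).
- by move=> a u v; rewrite mulrDl -scalerAl corner_map_lin.
- by move=> a u v; rewrite corner_map_lin mulrDl scalerAl.
move=> i k; move: y; apply: (nak_linear_eq (nk := nk') (V := A)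
  (f := fun y => corner_map (nb nk' i k * y)) (g := fun y => corner_map (nb nk'
    i k) * corner_map y)).
- by move=> a u v; rewrite mulrDr -scalerAr corner_map_lin.
- by move=> a u v; rewrite corner_map_lin mulrDr scalerAr.
move=> j l; have tik : (t i <= t (i + k))%N by rewrite t_le leq_addr.
rewrite nbM !corner_map_nb nbM subnKC // t_eqmod.
case: eqP => [e|_]; last exact: corner_map0.
rewrite corner_map_nb; congr (nb nk _ _).
have -> : (t (j + l) - t j = t (i + k + l) - t (i + k))%N.
  by apply/eqP; rewrite t_gap.
have := t_le (i + k) (i + k + l); rewrite leq_addr.
by rewrite addnA; lia.
Qed.

Lemma nco_corner_map (i : 'I_N') k x : (k < c' i)%N ->
  nco nk (t i) (t (i + k) - t i) (corner_map x) = nco nk' i k x.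
Proof.
move=> ki; move: x; apply: (nak_linear_eq (nk := nk') (V := K^o)
  (f := fun x => nco nk (t i) (t (i + k) - t i) (corner_map x))).
- by move=> a u v; rewrite corner_map_lin nco_lin.
- by move=> a u v; rewrite nco_lin.
move=> j l; rewrite corner_map_nb !nco_nb t_eqmod.
case: eqP => [e|_] //=; rewrite t_gap // ki; congr (_ && _)%:R.
rewrite -(ltn_add2l (t i)) t_proj subnKC ?t_le ?leq_addr //.
by rewrite ltnNge t_le -ltnNge ltn_add2l.
Qed.

Lemma corner_map_inj x : corner_map x = 0 -> x = 0.
Proof.
move=> px; rewrite (nak_span nk' x) big1 // => i _; rewrite big1 // => k _.
by rewrite -nco_corner_map // px nco0 scale0r.
Qed.

Definition corner_idem : A := corner_map 1.

Lemma corner_idemE : corner_idem = \sum_(j < N') nb nk (t j) 0.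
Proof.
rewrite /corner_idem -(nb_sum1 nk').
have corner_mapD x y : corner_map (x + y) = corner_map x + corner_map y.
  by rewrite -{1}[x]scale1r corner_map_lin scale1r.
rewrite (big_morph corner_map corner_mapD corner_map0); apply: eq_bigr => j _.
by rewrite corner_map_nb addn0 subnn.
Qed.

(** A path between two chosen vertices ends at some [t m] of the universal cover, so it is the image
    of a path of B. *)
Lemma corner_map_surj z : corner_idem * z * corner_idem = z -> exists x,
  corner_map x = z.
Proof.
pose P z := exists x, corner_map x = z.
have P0 : P 0 by exists 0; apply: corner_map0.
have PD u v : P u -> P v -> P (u + v).
  by move=> [x <-] [y <-]; exists (x + y);
    rewrite -[x]scale1r corner_map_lin !scale1r.
have PZ a u : P u -> P (a *: u).
  by move=> [x <-]; exists (a *: x);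
    rewrite -[a *: x]addr0 corner_map_lin corner_map0 addr0.
move=> <-; rewrite -/(P _) corner_idemE mulr_suml mulr_suml;
  apply: (big_ind P) => // j _.
rewrite nb_mulr0 mulr_sumr; apply: (big_ind P) => // j' _.
rewrite mulr_suml; apply: (big_ind P) => // k _; rewrite -scalerAl; apply: PZ.
rewrite nbM; case: eqP => [/t_mod_exists[m tm]|_] //.
have jm : (j <= m)%N by rewrite -t_le -tm leq_addr.
by exists (nb nk' j (m - j)); rewrite addn0 corner_map_nb subnKC // -tm addKn.
Qed.

Lemma corner_idemK : corner_idem * corner_idem = corner_idem.
Proof. by rewrite -corner_mapM mulr1. Qed.

(** The vertex before [t j]; adding [N.-1] avoids a predecessor of [t 0 = 0]. *)
Let u j := (t j + N.-1)%N.

Lemma u_mod j : (u j).+1 = t j %[mod N].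
Proof. by rewrite /u -addnS prednK ?modnDr // (kup_gt0 kc). Qed.

Lemma nb_u j k : nb nk (u j).+1 k = nb nk (t j) k.
Proof. exact: nb_eqmod (u_mod j). Qed.

(** The socle of P_i sits just before [i + c i]. By [t_top] this is before some [t j], and by
    [t_hit] every such place occurs. *)
Lemma complete_socles : complete_reps
  (fun S => exists2 P, indecomposable_projective P & socle_of P S)
  (fun j : 'I_N' => vsimple nk (u j)).
Proof.
have end_socle i j : (i + c i = t j %[mod N])%N ->
    (i + (c i).-1 = u j %[mod N])%N.
  move=> e; apply/eqP; rewrite -(eqn_modDr 1) !addn1 u_mod -e -addnS.
  by rewrite prednK // (kup_pos kc).
split=> [j|i j ij|S [P indP socP]].
- have [i ij] := t_hit j; exists (vproj nk i).
    exact: cover_indecomposable (vsimpleP nk i) (vproj_cover nk i).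
  apply: (socle_of_iso _ _ (socle_of_vproj nk i)).
    by apply: iv_iso.
  by apply/vsimple_iso/esym/end_socle.
- apply: val_inj; apply/eqP.
  have /eqP : u i = u j %[mod N] := iv_iso_eqmod (ltn0Sn 0) (ltn0Sn 0) ij.
  by rewrite eqn_modDr t_eqmod !modn_small.
have [_ _ /(_ _ indP)[i Pi]] := complete_vproj nk 0.
have [j /(congr1 (modn^~ N)) e] := t_top i.
have jN : (j %% N' < N')%N by rewrite ltn_mod (kup_gt0 kc').
exists (Ordinal jN).
have SP : socle_of (vproj nk (0 + i)) S.
  by apply: (socle_of_iso Pi _ socP); apply: mod_iso_refl.
apply: mod_iso_trans (socle_of_unique SP (socle_of_vproj nk _)) _.
apply/vsimple_iso; rewrite add0n; apply: end_socle; rewrite [LHS]e; apply/eqP.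
by rewrite t_eqmod modn_mod.
Qed.

(** With [e = corner_idem], the module is [M = e A], the sum of the projectives at the [t j]. Its
    endomorphisms are the left multiplications by elements of [e A e], which [corner_map] identifies
    with [B]. *)
Lemma epsilon_corner : epsilon_iso A B.
Proof.
pose R := regular_module A.
have he : is_hom (amull corner_idem : 'Hom(R, R)).
  by move=> a x; rewrite !regular_moduleE !lfunE /= mulrA.
have [M [iota [hi ki imi]]] := submodule_mod (submodule_limg he).
have iI := lker0_inj ki.
have eiota x : corner_idem * iota x = iota x.
  have : iota x \in limg iota by rewrite memv_img ?memvf.
  rewrite imi => /memv_imgP[y _ ->].
  by rewrite lfunE /= mulrA corner_idemK.
have iotaM a x : iota (mact M a x) = iota x * a.
  by rewrite hi regular_moduleE.
have lift z : corner_idem * z = z -> exists x, iota x = z.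
  move=> ez; have : z \in limg iota.
    rewrite imi; have -> : z = amull corner_idem z by rewrite lfunE.
    by rewrite memv_img ?memvf.
  by move=> /memv_imgP[x _ ->]; exists x.
have e_tj (j : 'I_N') : corner_idem * nb nk (t j) 0 = nb nk (t j) 0.
  rewrite corner_idemE mulr_suml (bigD1 j) //= nbM addn0 eqxx big1 ?addr0 // =>
    k kj.
  rewrite nbM addn0 t_eqmod !modn_small // ifF //.
  by apply: contraNF kj => /eqP e; apply/eqP/val_inj.
(* [y j] is the idempotent at [t j] seen in [M]; it generates the summand P(t j). *)
have [y yE] := choice (fun j : 'I_N' => lift _ (e_tj j)).
pose f (j : 'I_N') : 'Hom(vproj nk (u j).+1, M) := iv_from nk (leqnn _) (y j).
have hf j : is_hom (f j).
  apply: is_hom_iv_from; apply: iI; rewrite iotaM yE lfun0 nb_u nbM addn0 eqxx.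
  rewrite add0n nb_out // (kup_eqmod nk (u_mod j)) //.
have iotaf j x : iota (f j x) =
    \sum_(k < c (u j).+1) rco (x : 'rV_(c (u j).+1)) k *: nb nk (t j) k.
  rewrite iv_fromE lfun_sum; apply: eq_bigr => k _.
  by rewrite lfunZ iotaM yE nb_u nbM addn0 eqxx add0n.
have kf j : lker (f j) = 0%VS.
  apply: lker_eq0 => x /(congr1 iota); rewrite iotaf lfun0.
  move=> /(congr1 (nco nk (t j) _)) e; apply: rcoP => k kl.
  have := e k; rewrite nco0 nco_sum (bigD1 (Ordinal kl)) //= big1 => [|l lk].
    rewrite ncoZ nco_nb !eqxx -(kup_eqmod nk (u_mod j)) kl mulr1 addr0 => ->.
    by rewrite rco0.
  rewrite ncoZ nco_nb; have -> : (k == l :> nat) = false;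
    last by rewrite andbF mulr0.
  by apply: contraNF lk => /eqP lk; apply/eqP/val_inj.
have ef (j : 'I_N') x : nb nk (t j) 0 * iota (f j x) = iota (f j x).
  rewrite iotaf mulr_sumr; apply: eq_bigr => k _.
  by rewrite -scalerAr nbM addn0 eqxx add0n.
have ef0 (j j' : 'I_N') x : j' != j -> nb nk (t j) 0 * iota (f j' x) = 0.
  move=> jj; rewrite -ef mulrA nbM addn0 t_eqmod !modn_small // ifF ?mul0r //.
  by apply: contraNF jj => /eqP e; apply/eqP/val_inj.
exists N', (fun j => vsimple nk (u j)), (fun j => vsimple nk (u j).+1),
  (fun j => vproj nk (u j).+1), M; split.
- exact: complete_socles.
- by move=> j; apply: is_tau_vsimple.
- by move=> j; apply: vproj_cover.
- exists f; split=> //.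
    apply/eqP; rewrite eqEsubv subvf; apply/subvP => x _.
    have [g gE] : exists g : forall j : 'I_N', vproj nk (u j).+1,
        forall j, iota (f j (g j)) = nb nk (t j) 0 * iota x.
      exists (fun j => mkrow (c (u j).+1) (fun k => nco nk (t j) k (iota x))).
      move=> j; rewrite iotaf nb_mulr0 -(kup_eqmod nk (u_mod j)).
      by apply: eq_bigr => k _; rewrite rco_mkrow ltn_ord.
    have -> : x = \sum_j f j (g j).
      apply: iI; rewrite lfun_sum -{1}[iota x]eiota corner_idemE mulr_suml.
      by apply: eq_bigr => j _; rewrite gE.
    by apply: memv_sumr => j _; rewrite memv_img ?memvf.
  (* Left multiplication by the idempotent at [t j] fixes the summand of index [j] and kills the
     others. *)
  apply/directv_sumP => j _; apply/eqP; rewrite -subv0; apply/subvP => x.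
  move=> /memv_capP[/memv_imgP[z _ ->] /memv_sumP[v vP e]].
  rewrite memv0; apply/eqP/iI; rewrite lfun0 -ef e lfun_sum mulr_sumr big1 //.
  by move=> j' jj'; have /memv_imgP[w _ ->] := vP j' jj'; apply: ef0.
pose phi b : 'End(M) := (iota^-1 \o (amull (corner_map b) \o iota))%VF.
have map_e b : corner_idem * corner_map b = corner_map b by rewrite
  -corner_mapM mul1r.
have phiE b x : iota (phi b x) = corner_map b * iota x.
  have [x' ex] := lift (corner_map b * iota x) ltac:(by rewrite mulrA map_e).
  rewrite /phi !comp_lfunE [amull _ _]lfunE /= limg_lfunVK // -ex.
  by rewrite memv_img ?memvf.
have [y1 y1E] := lift corner_idem corner_idemK.
exists phi; split.
- move=> a b b'; apply/lfunP => x; apply: iI.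
  by rewrite add_lfunE scale_lfunE lfunD lfunZ !phiE corner_map_lin mulrDl
    scalerAl.
- move=> b b' /lfunP/(_ y1)/(congr1 iota);
    rewrite !phiE y1E -!corner_mapM !mulr1.
  move=> e; apply/eqP; rewrite -subr_eq0; apply/eqP/corner_map_inj.
  have -> : b - b' = (-1) *: b' + b by rewrite scaleN1r addrC.
  by rewrite corner_map_lin scaleN1r e addNr.
- by apply/lfunP => x; apply: iI; rewrite phiE id_lfunE -/corner_idem eiota.
- by move=> b b'; apply/lfunP => x; apply: iI;
    rewrite comp_lfunE !phiE corner_mapM mulrA.
move=> g; split=> [hg|[b <-] a x]; last first.
  by apply: iI; rewrite iotaM !phiE iotaM mulrA.
(* [y1] is [corner_idem] seen in [M] and generates it, so [g] is left multiplication by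
   [iota (g y1)], an element of the corner. *)
have y1K x : x = mact M (iota x) y1 by apply: iI; rewrite iotaM y1E eiota.
have [b bE] : exists b, corner_map b = iota (g y1).
  apply: corner_map_surj; rewrite eiota -iotaM -hg.
  by have -> : mact M corner_idem y1 = y1 by apply: iI;
    rewrite iotaM y1E corner_idemK.
exists b; apply/lfunP => x; apply: iI.
by rewrite phiE bE -iotaM -hg -y1K.
Qed.

End Epsilon.

(** * Linear Nakayama algebras *)

Section NakOfBasis.
Variables (K : fieldType) (A : algType K) (N : nat) (c : nat -> nat).
Variable b : nat -> nat -> A.
Hypothesis kc : kupisch N c.
Hypothesis b_mod : forall i k, b (i + N) k = b i k.
Hypothesis bM : forall i k j l,
  b i k * b j l = if (i + k == j %[mod N])%N then b i (k + l) else 0.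
Hypothesis b_out : forall i k, (c i <= k)%N -> b i k = 0.
Hypothesis b_sum1 : \sum_(i < N) b i 0 = 1.
Hypothesis b_span : forall x, exists a : nat -> nat -> K,
  x = \sum_(i < N) \sum_(k < c i) a i k *: b i k.
Hypothesis b_free : forall a : nat -> nat -> K,
  \sum_(i < N) \sum_(k < c i) a i k *: b i k = 0 ->
  forall i k, (i < N)%N -> (k < c i)%N -> a i k = 0.

(** Freeness makes the chosen coefficients unique, hence linear; [co] reduces the vertex modulo [N]
    and is zero from length [c i] on, as [nco_nb] demands. *)
Lemma nak_of_basis : inhabited (nak A N c).
Proof.
have [al alE] := choice b_span.
have al_eq x (a : nat -> nat -> K) : x = \sum_(i < N) \sum_(k < c i) a i k *: b
  i k ->
    forall i k, (i < N)%N -> (k < c i)%N -> al x i k = a i k.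
  move=> xE i k iN kc'; apply/eqP; rewrite -subr_eq0; apply/eqP.
  pose d i k := al x i k - a i k; apply: (b_free (a := d)) iN kc'.
  transitivity (x - x); last by rewrite subrr.
  rewrite {1}(alE x) {2}xE -sumrB; apply: eq_bigr => j _.
  by rewrite -sumrB; apply: eq_bigr => l _; rewrite scalerBl.
pose co i k x := if (k < c i)%N then al x (i %% N)%N k else 0.
have iN i : (i %% N < N)%N by rewrite ltn_mod (kup_gt0 kc).
have cm i : c (i %% N)%N = c i.
  by apply: (periodic_modn (kup_mod kc)); rewrite modn_mod.
constructor; apply: (Nak (nco := co) kc b_mod bM b_out b_sum1).
- move=> i k a x y; rewrite /co; case: ifP => kci; last by rewrite mulr0 addr0.
  apply: (al_eq _ (fun i k => a * al x i k + al y i k)); rewrite ?cm //.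
  rewrite {1}(alE x) {1}(alE y) scaler_sumr -big_split; apply: eq_bigr => j _.
  rewrite scaler_sumr -big_split; apply: eq_bigr => l _.
  by rewrite scalerDl scalerA.
- move=> i k j l; rewrite /co; case: ifP => kci; last by rewrite !andbF.
  rewrite andbT; pose d i k : K := ((i == j %% N) && (k == l))%N%:R.
  transitivity (d (i %% N)%N k) => //; apply: al_eq; rewrite ?cm //.
  rewrite (bigD1 (Ordinal (iN j))) //= [X in _ + X]big1 ?addr0; last first.
    move=> i' ij; rewrite big1 // => l' _; rewrite /d.
    have -> : (i' == j %% N :> nat)%N = false; last by rewrite scale0r.
    by apply: contraNF ij => /eqP e; apply/eqP/val_inj.
  have bj k' : b (j %% N)%N k' = b j k'.
    apply: (periodic_modn (N := N) (f := b^~ k')); last exact: modn_mod.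
    by move=> i'; apply: b_mod.
  have [lc|cl] := ltnP l (c j); last first.
    rewrite b_out // big1 // => k' _; rewrite /d.
    have -> : (k' == l :> nat)%N = false; last by rewrite andbF scale0r.
    have k'c : (k' < c j)%N by rewrite (leq_trans (ltn_ord k')) ?cm.
    by apply/negbTE; rewrite neq_ltn (leq_trans k'c cl).
  have lc' : (l < c (j %% N))%N by rewrite cm.
  rewrite (bigD1 (Ordinal lc')) //= big1 => [|k' kl].
    by rewrite /d !eqxx scale1r addr0 bj.
  rewrite /d; have -> : (k' == l :> nat)%N = false;
    last by rewrite andbF scale0r.
  by apply: contraNF kl => /eqP e; apply/eqP/val_inj.
- move=> x; rewrite {1}(alE x); apply: eq_bigr => i _; apply: eq_bigr => k _.
  by rewrite /co ltn_ord modn_small.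
Qed.

End NakOfBasis.

(** * Paths in a quiver with at most one arrow out of each vertex *)

Section NakayamaQuivers.
Variables (m : nat) (Q : quiver) (val : vertex Q -> nat).
Hypothesis val_inj : injective val.
Hypothesis val_lt : forall v, (val v < m.+1)%N.
Hypothesis arrow_source : forall a a' : arrow Q, source a = source a' -> a = a'.
Hypothesis arrow_target :
  forall a : arrow Q, val (target a) = ((val (source a)).+1 %% m.+1)%N.

Lemma qpath_unique (p q : qpath Q) : path_source p = path_source q ->
  path_length p = path_length q -> p = q.
Proof.
move=> pq; rewrite /path_length => lpq; apply: qpath_eq => //.
have := valP p; have := valP q; rewrite -/(path_source p) -/(path_source q).
rewrite -/(path_arrows p) -/(path_arrows q) pq; move: lpq (path_source q).
elim: (path_arrows p) (path_arrows q) => [|a s IH] [|a' s'] //= [/IH ss'] v.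
move=> /andP[/eqP <- cs'] /andP[/eqP/arrow_source aa' cs].
by rewrite -aa' in cs'; rewrite aa' (ss' _ cs' cs).
Qed.

Lemma val_path_target (p : qpath Q) : val (path_target p) =
  ((val (path_source p) + path_length p) %% m.+1)%N.
Proof.
have := valP p; rewrite /path_target /path_length.
rewrite -/(path_source p) -/(path_arrows p);
  elim: (path_arrows p) (path_source p).
  by move=> v _; rewrite /= addn0 modn_small.
move=> a s IH v /= /andP[/eqP <- /IH ->].
by rewrite arrow_target modnDml addSnnS.
Qed.

Lemma path_target_eq (p q : qpath Q) : (path_target p == path_source q) =
  (val (path_source p) + path_length p == val (path_source q) %[mod m.+1])%N.
Proof.
by rewrite -(inj_eq val_inj) val_path_target [in RHS](modn_small (val_lt
  (path_source q))).
Qed.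

Lemma path_split (r : qpath Q) k l : path_length r = (k + l)%N ->
  exists p q : qpath Q, [/\ path_source p = path_source r, path_length p = k,
    path_target p = path_source q & path_length q = l].
Proof.
move=> rkl; have := valP r; rewrite -/(path_source r) -/(path_arrows r).
rewrite -{1}(cat_take_drop k (path_arrows r)) composable_cat => /andP[cp cq].
exists (@QPath Q (path_source r, take k (path_arrows r)) cp), (@QPath Q (_, _)
  cq).
rewrite /path_length in rkl.
split=> //; rewrite /path_length /path_arrows /=.
  by rewrite size_takel // rkl leq_addr.
by rewrite size_drop rkl addKn.
Qed.

End NakayamaQuivers.

Lemma linear_quiver_target m (a : arrow (linear_quiver m)) :
  (target a : 'I_m.+1) = ((source a : 'I_m.+1).+1 %% m.+1)%N :> nat.
Proof. by rewrite /= modn_small // ltnS. Qed.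

Lemma linear_quiver_source m (a a' : arrow (linear_quiver m)) :
  source a = source a' -> a = a'.
Proof. by move=> /(congr1 val) /= e; apply: val_inj. Qed.

Lemma linear_path_length m (p : qpath (linear_quiver m)) :
  ((path_source p : 'I_m.+1) + path_length p <= m)%N.
Proof.
have := valP p; rewrite /path_length -/(path_source p) -/(path_arrows p).
elim: (path_arrows p) (path_source p) => [|a s IH] v /=.
  by rewrite addn0 -ltnS.
move=> /andP[/eqP <- /IH] /=; rewrite /bump /=; lia.
Qed.

Section LinearNakayama.
Variables (K : fieldType) (m : nat) (A : falgType K).
Local Notation Q := (linear_quiver m).
Variable f : {lrmorphism path_algebra K Q -> A}.
Hypothesis f_surj : forall a, exists x, f x = a.
Hypothesis f_ker : forall x, f x = 0 -> arrow_ideal 2 x.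
Local Notation N := m.+1.

Let pth i k (p : qpath Q) :=
  (path_source p : 'I_N) = (i %% N)%N :> nat /\ path_length p = k.

(** The value is 0 when the path would run past the last vertex; with this default the
    multiplication rule of a cycle modulo [N] holds. *)
Let b i k : A :=
  if pselect (exists p, pth i k p) is left e then f << projT1 (cid e) >> else 0.

Let b_path i k p : pth i k p -> b i k = f << p >>.
Proof.
move=> ep; rewrite /b; case: pselect => [e|]; last by case; exists p.
case: (cid e) => q /= [sq lq]; case: ep => sp lp.
congr (f << _ >>); apply: (qpath_unique (@linear_quiver_source m)).
  by apply: val_inj; rewrite /= sq sp.
by rewrite lq lp.
Qed.

Let b_none i k : ~ (exists p, pth i k p) -> b i k = 0.
Proof. by rewrite /b; case: pselect. Qed.

Let bU (p : qpath Q) : f << p >> = b (path_source p : 'I_N) (path_length p).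
Proof. by rewrite (b_path (p := p)) //; split=> //; rewrite modn_small. Qed.

Let b_eqmod i j k : i = j %[mod N] -> b i k = b j k.
Proof.
move=> ij; have [[p [sp lp]]|no] := pselect (exists p, pth i k p).
  by rewrite !(b_path (p := p)) //; split=> //; rewrite sp ij.
rewrite !b_none // => -[p [sp lp]]; apply: no.
by exists p; split=> //; rewrite ij.
Qed.

Let bM i k j l :
  b i k * b j l = if (i + k == j %[mod N])%N then b i (k + l) else 0.
Proof.
have tE := path_target_eq (val_inj : injective (fun v : vertex Q => v : nat))
  (fun v : vertex Q => ltn_ord v) (@linear_quiver_target m).
have [[p [sp lp]]|no] := pselect (exists p, pth i k p); last first.
  rewrite b_none // mul0r; case: ifP => // _; rewrite b_none // => -[r [sr lr]].
  have [p [q [sp lp _ _]]] := path_split lr.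
  by apply: no; exists p; split=> //; rewrite sp.
have [[q [sq lq]]|no] := pselect (exists p, pth j l p); last first.
  rewrite [b j l]b_none // mulr0; case: eqP => // ij.
  rewrite b_none // => -[r [sr lr]].
  have [p' [q [sp' lp' tpq lq]]] := path_split lr.
  apply: no; exists q; split=> //; move/eqP: tpq.
  by rewrite tE sp' lp' sr modnDml ij => /eqP ->; rewrite modn_small.
rewrite (b_path (p := p)) // (b_path (p := q)) //.
have <- : f (pa_mul << p >> << q >>) = f << p >> * f << q >>.
  exact: (rmorphM f (<< p >> : path_algebra K Q) (<< q >> : path_algebra K Q)).
rewrite pa_mulUU /path_mul.
have -> : (i + k == j %[mod N])%N = (path_target p == path_source q).
  by rewrite tE sp lp sq modn_mod modnDml.
case: path_catP => [r e sr ar|/eqP/negPf ->]; last by rewrite linear0.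
rewrite e eqxx (b_path (p := r)) //; split; first by rewrite sr.
by rewrite /path_length ar size_cat -lp -lq.
Qed.

Let b_long i k : (N <= i %% N + k)%N -> b i k = 0.
Proof.
move=> ik; apply: b_none => -[p [sp lp]].
by have := linear_path_length p; rewrite sp lp; lia.
Qed.

Let iN i : (i %% N < N)%N. Proof. by rewrite ltn_mod. Qed.

Let b_zero i : exists k, b i k == 0.
Proof. by exists N; rewrite b_long // leq_addl. Qed.

Let c i := ex_minn (b_zero i).

Let b_neq0 i k : (k < c i)%N -> b i k <> 0.
Proof. by rewrite /c; case: ex_minnP => n _ mn kn /eqP /mn; lia. Qed.

Let b_out i k : (c i <= k)%N -> b i k = 0.
Proof.
rewrite /c; case: ex_minnP => n /eqP bn _ nk.
by have := bM i n (i + n) (k - n); rewrite eqxx subnKC // bn mul0r.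
Qed.

Let c_min i k : b i k = 0 -> (c i <= k)%N.
Proof. by move=> bk; rewrite leqNgt; apply/negP => /b_neq0. Qed.

Let f_short (p : qpath Q) : (path_length p < 2)%N -> f << p >> <> 0.
Proof.
move=> lp /f_ker/(_ p); rewrite mcoeffUU oner_neq0 => /(_ isT).
by rewrite leqNgt lp.
Qed.

Let c_pos i : (0 < c i)%N.
Proof.
rewrite lt0n; apply/eqP => ci.
have := b_out (i := i) (k := 0); rewrite ci => /(_ isT).
rewrite (b_path (p := stationary (Ordinal (iN i) : vertex Q))) //.
exact: f_short.
Qed.

Let c_gt1 i : (i %% N < m)%N -> (1 < c i)%N.
Proof.
move=> im; rewrite ltnNge; apply/negP => /b_out.
pose a : arrow Q := Ordinal im.
have ca : composable (source a) [:: a] by rewrite /= eqxx.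
rewrite (b_path (p := QPath (path_val := (source a, [:: a])) ca)) //.
exact: f_short.
Qed.

Let c_bound i : (i %% N + c i <= N)%N.
Proof.
have := iN i => lt; have : (c i <= N - i %% N)%N; last by lia.
by apply/c_min/b_long; lia.
Qed.

Let c_eqmod i j : i = j %[mod N] -> c i = c j.
Proof.
move=> ij; apply/eqP; rewrite eqn_leq.
by rewrite !c_min //;
  [rewrite -(b_eqmod _ ij) b_out | rewrite (b_eqmod _ ij) b_out].
Qed.

Let kup : kupisch N c.
Proof.
split=> // i; first by apply: c_eqmod; rewrite modnDr.
apply: c_min; have := bM i 1 i.+1 (c i.+1).
by rewrite addn1 eqxx add1n => <-; rewrite [b i.+1 _]b_out ?mulr0.
Qed.

Let b_sum1 : \sum_(i < N) b i 0 = 1.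
Proof.
transitivity (\sum_(v : vertex Q) f << stationary v >>).
  by apply: eq_bigr => i _; rewrite bU.
transitivity (f 1); last exact: rmorph1.
exact/esym/(linear_sum f _ _ (fun v : vertex Q => << stationary v >>)).
Qed.

Let b_span x : exists a : nat -> nat -> K,
  x = \sum_(i < N) \sum_(k < c i) a i k *: b i k.
Proof.
have [z <-] := f_surj x; rewrite (malg_sum z).
have -> : f (\sum_(p <- msupp z) mcoeff p z *: << p >>) =
    \sum_(p <- msupp z) f (mcoeff p z *: << p >>).
  exact: (linear_sum f _ _ (fun p : qpath Q => mcoeff p z *: << p >>)).
pose P x := exists a : nat -> nat -> K,
  x = \sum_(i < N) \sum_(k < c i) a i k *: b i k.
apply: (big_ind P) => [|u v [au ->] [av ->]|p _].
- exists (fun _ _ => 0); rewrite big1 // => i _.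
  by rewrite big1 // => k _; rewrite scale0r.
- exists (fun i k => au i k + av i k); rewrite -big_split;
    apply: eq_bigr => i _.
  by rewrite -big_split; apply: eq_bigr => k _; rewrite scalerDl.
rewrite linearZ /= bU; set i := (path_source p : 'I_N); set k := path_length p.
exists (fun i' k' : nat => if (i' == i :> nat) && (k' == k) then mcoeff p z
  else 0).
rewrite (bigD1 i) //= [X in _ + X]big1 ?addr0 => [|j ji]; last first.
  rewrite big1 // => l _; have -> : (j == i :> nat) = false.
    by apply: contraNF ji => /eqP e; apply/eqP/val_inj.
  by rewrite scale0r.
have [kci|cik] := ltnP k (c i).
  rewrite (bigD1 (Ordinal kci)) //= !eqxx big1 ?addr0 // => l lk.
  have -> : (l == k :> nat) = false; last by rewrite andbF scale0r.
  by apply: contraNF lk => /eqP e; apply/eqP/val_inj.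
rewrite b_out // scaler0 big1 // => l _.
have -> : (l == k :> nat) = false; last by rewrite andbF scale0r.
by have := ltn_ord l; lia.
Qed.

(** Multiplying by the idempotents at [i] and [i + k] isolates one coefficient: by [c_bound] nonzero
    paths do not wrap around, so a path is determined by its two ends. *)
Let b_free (a : nat -> nat -> K) :
  \sum_(i < N) \sum_(k < c i) a i k *: b i k = 0 ->
  forall i k, (i < N)%N -> (k < c i)%N -> a i k = 0.
Proof.
move=> s0 i k iN' kc.
have : b i 0 * (\sum_(i < N) \sum_(k < c i) a i k *: b i k) * b (i + k) 0 = 0.
  by rewrite s0 mulr0 mul0r.
rewrite mulr_sumr mulr_suml (bigD1 (Ordinal iN')) //= [X in _ + X]big1 ?addr0.
  rewrite mulr_sumr mulr_suml (bigD1 (Ordinal kc)) //= big1 ?addr0.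
    rewrite -scalerAr -scalerAl bM addn0 eqxx add0n bM eqxx addn0.
    by move/eqP; rewrite scaler_eq0 => /orP[/eqP //|/eqP/(b_neq0 kc)].
  move=> l lk;
    rewrite -scalerAr -scalerAl bM addn0 eqxx add0n bM eqn_modDl addn0.
  have cb := c_bound i; rewrite modn_small // in cb.
  rewrite !modn_small; try by have := ltn_ord l; lia.
  rewrite ifF ?scaler0 //.
  by apply: contraNF lk => /eqP e; apply/eqP/val_inj.
move=> j ji; rewrite mulr_sumr mulr_suml big1 // => l _.
rewrite -scalerAr -scalerAl bM addn0 !modn_small // ifF ?mul0r ?scaler0 //.
by apply: contraNF ji => /eqP e; apply/eqP/val_inj.
Qed.

Lemma linear_nak : exists c : nat -> nat,
  [/\ inhabited (nak A N c), forall i, (i < N -> i + c i <= N)%N &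
      forall i, (i < m -> 1 < c i)%N].
Proof.
exists c; split.
- apply: (nak_of_basis kup (b := b)) => //.
  by move=> i k; apply: b_eqmod; rewrite modnDr.
- by move=> i iN'; have := c_bound i; rewrite modn_small.
- by move=> i im; apply: c_gt1; rewrite modn_small //; lia.
Qed.

End LinearNakayama.

Lemma connected_linear_nak (K : fieldType) n (A : falgType K) :
  connected_linear_nakayama n A -> exists c : nat -> nat,
  [/\ inhabited (nak A n c), forall i, (i < n -> i + c i <= n)%N &
      forall i, (i.+1 < n -> 1 < c i)%N].
Proof. by move=> [m -> [f [surj [_ ker]]]]; apply: linear_nak surj ker. Qed.

(** * The product of a linear Nakayama algebra with the field *)

Section ProductWithField.
Variables (K : fieldType) (A : algType K) (n : nat) (c : nat -> nat).
Hypothesis c_lin : forall i, (i < n -> i + c i <= n)%N.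

Definition ext_kup j := if (j %% n.+1 < n)%N then c (j %% n.+1)%N else 1%N.

Lemma ext_kupisch : kupisch n c -> kupisch n.+1 ext_kup.
Proof.
move=> kc; rewrite /ext_kup; split=> // i.
- by case: ifP => // _; apply: kup_pos kc _.
- by rewrite modnDr.
have iN : (i %% n.+1 < n.+1)%N by rewrite ltn_mod.
have -> : (i.+1 %% n.+1 = (i %% n.+1).+1 %% n.+1)%N by rewrite -[i.+1]addn1
  -[(i %% _).+1]addn1 modnDml.
move: (i %% n.+1)%N iN => r rn; case: ifP => // r_n.
have [rn'|rn'] := ltnP r.+1 n.
  by rewrite modn_small ?rn' ?(kup_step kc) //; lia.
by have := c_lin r_n; lia.
Qed.

Variable nk : nak A n c.

Definition ext_nb j k : (A * K^o)%type :=
  if (j %% n.+1 < n)%N then (nb nk (j %% n.+1) k, 0) else (0, (k == 0)%N%:R).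

Definition ext_nco j k (x : (A * K^o)%type) : K :=
  if (j %% n.+1 < n)%N then nco nk (j %% n.+1) k x.1
  else if (k == 0)%N then x.2 else 0.

(** Congruence modulo [n] in the factor and modulo [n.+1] here agree where it matters: by [c_lin]
    nonzero paths of the factor end before the vertex [n]. *)
Lemma ext_nbM i k j l : ext_nb i k * ext_nb j l =
  if (i + k == j %[mod n.+1])%N then ext_nb i (k + l) else 0.
Proof.
have iN : (i %% n.+1 < n.+1)%N by rewrite ltn_mod.
have jN : (j %% n.+1 < n.+1)%N by rewrite ltn_mod.
rewrite /ext_nb -[((i + k) %% _)%N]modnDml; move: (i %% n.+1)%N iN => r rN.
move: (j %% n.+1)%N jN => s sN; case: ltnP => rn.
  have [ck|kc] := leqP (c r) k.
    rewrite (nb_out nk ck) (nb_out nk (leq_trans ck (leq_addr l k))).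
    by rewrite -[(0, 0)]/(0 : (A * K^o)%type) mul0r if_same.
  have rk : (r + k < n)%N by have := c_lin rn; lia.
  rewrite [((r + k) %% _)%N]modn_small; last by lia.
  case: ltnP => sn.
    rewrite [LHS](_ : _ = (nb nk r k * nb nk s l, 0 * 0)) // nbM mulr0.
    by rewrite !modn_small //; case: ifP.
  rewrite ifF; last by lia.
  by congr pair; rewrite /= ?mulr0 ?mul0r.
have -> : r = n by lia.
case: ltnP => sn.
  rewrite [LHS](_ : _ = (0 * nb nk s l, (k == 0)%N%:R * 0)) // mulr0 mul0r.
  case: k => [|k]; last by case: ifP.
  by rewrite addn0 modn_small // ifF //; lia.
rewrite [LHS](_ : _ = (0 * 0, (k == 0)%N%:R * (l == 0)%N%:R)) // mulr0.
have -> : s = n by lia.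
case: k => [|k]; last by rewrite mul0r; case: ifP.
by rewrite addn0 modn_small // !eqxx mul1r.
Qed.

Lemma ext_nak : inhabited (nak (A * K^o)%type n.+1 ext_kup).
Proof.
have kc := nak_kupisch nk.
constructor; apply: (Nak (nb := ext_nb) (nco := ext_nco) (ext_kupisch kc)).
- by move=> i k; rewrite /ext_nb modnDr.
- exact: ext_nbM.
- move=> i k; rewrite /ext_kup /ext_nb; case: ifP => _ ck.
    by rewrite nb_out.
  by rewrite gtn_eqF.
- have fstE : \sum_(i < n) ext_nb i 0 = (1, 0).
    rewrite -(nb_sum1 nk); elim/big_rec2: _ => // i y z _ ->.
    rewrite /ext_nb modn_small; last by rewrite ltnS ltnW.
    by rewrite ltn_ord; congr pair; rewrite /= addr0.
  rewrite big_ord_recr /= fstE /ext_nb modn_small // ltnn eqxx.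
  by congr pair; rewrite /= ?addr0 ?add0r.
- move=> i k a x y; rewrite /ext_nco; case: ifP => _; first exact: nco_lin.
  by case: ifP => // _; rewrite mulr0 addr0.
- move=> i k j l; rewrite /ext_nco /ext_nb /ext_kup.
  have iN : (i %% n.+1 < n.+1)%N by rewrite ltn_mod.
  have jN : (j %% n.+1 < n.+1)%N by rewrite ltn_mod.
  move: (i %% n.+1)%N iN => r rN; move: (j %% n.+1)%N jN => s sN.
  case: (ltnP r n) => rn; case: (ltnP s n) => sn /=.
  + by rewrite nco_nb !modn_small.
  + by rewrite nco0 [(r == s)%N]ltn_eqF //; lia.
  + by rewrite if_same [(r == s)%N]gtn_eqF //; lia.
  + have -> : (r == s)%N by lia.
    by case: k => [|k] /=; rewrite ?andbT ?andbF // eq_sym.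
move=> x; rewrite big_ord_recr /= {1}[x]surjective_pairing.
have kn : ext_kup n = 1%N by rewrite /ext_kup modn_small // ltnn.
rewrite kn big_ord1 /ext_nco /ext_nb modn_small // ltnn /=.
have -> : \sum_(i < n) \sum_(k < ext_kup i)
    (if (i %% n.+1 < n)%N then nco nk (i %% n.+1) k x.1 else if (k == 0 :>
      nat)%N then x.2 else 0)
     *: (if (i %% n.+1 < n)%N then (nb nk (i %% n.+1) k, 0) else (0, (k == 0 :>
       nat)%N%:R))
  = (x.1, 0) :> (A * K^o)%type.
  rewrite {2}(nak_span nk x.1).
  elim/big_rec2: _ => // i y z _ ->.
  have iN : (i < n.+1)%N by rewrite ltnS ltnW.
  have -> : ext_kup i = c i by rewrite /ext_kup modn_small // ltn_ord.
  rewrite modn_small // ltn_ord.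
  have -> : \sum_(k < c i) nco nk i k x.1 *: ((nb nk i k, 0) : (A * K^o)%type) =
     (\sum_(k < c i) nco nk i k x.1 *: nb nk i k, 0).
    elim/big_rec2: _ => // k y' z' _ ->; congr pair;
      rewrite /= ?scaler0 ?addr0 //.
  by congr pair; rewrite /= addr0.
by congr pair; rewrite /= ?scaler0 ?addr0 ?add0r // [RHS]mulr1.
Qed.

End ProductWithField.

(** * Cyclic Nakayama algebras with a given Kupisch series *)

Section Existence.
Variables (K : fieldType) (N : nat) (c : nat -> nat).
Hypothesis kc : kupisch N c.

Import FalgLfun.

(** A common bound for vertices and lengths, so that one square format holds all coefficients. *)
Let L := (N + \sum_(i < N) c i)%N.

Let c_modn i : c (i %% N)%N = c i.
Proof. by apply: (periodic_modn (kup_mod kc)); rewrite modn_mod. Qed.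

Let cL i : (c i <= L)%N.
Proof.
have iN : (i %% N < N)%N by rewrite ltn_mod (kup_gt0 kc).
by rewrite -c_modn /L (bigD1 (Ordinal iN)) //=; lia.
Qed.

(* The right regular representation on matrices whose row i holds the
   coefficients of the paths starting at i; it vanishes on the entries with
   N <= i or c i <= k. *)
Let cond i k j l :=
  [&& i < N, k < c i, l <= k & i + (k - l) == j %[mod N]]%N.

Let op_fun j l (X : 'M[K]_L.+1) : 'M[K]_L.+1 :=
  \matrix_(i, k) if cond i k j l then X i (inord (k - l)) else 0.

Let op_lin j l : linear (op_fun j l).
Proof.
move=> a X Y; apply/matrixP => i k; rewrite !mxE; case: ifP => // _.
by rewrite mulr0 addr0.
Qed.

Let op j l : 'End('M[K]_L.+1) := linfun (op_fun j l).

Let opE j l X (i k : 'I_L.+1) :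
  op j l X i k = if cond i k j l then X i (inord (k - l)) else 0.
Proof. by rewrite /op linfunE ?mxE. Qed.

Let op_mod j l : op (j + N) l = op j l.
Proof.
apply/lfunP => X; apply/matrixP => i k; rewrite !opE.
by rewrite /cond modnDr.
Qed.

Let op_out j l : (c j <= l)%N -> op j l = 0.
Proof.
move=> cl; apply/lfunP => X; apply/matrixP => i k; rewrite opE zero_lfunE mxE.
case: ifP => // /and4P[_ ki lk /eqP e].
have := kup_drop i (k - l) kc; rewrite -(c_modn (i + (k - l))) e c_modn.
by lia.
Qed.

Let opM i k j l :
  op i k * op j l = if (i + k == j %[mod N])%N then op i (k + l) else 0.
Proof.
(* The product of [FalgLfun] applies its left factor first, in accordance with the composition of
   paths. *)
apply/lfunP => X; apply/matrixP => p q; rewrite lfun_mulE opE.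
have qL := ltn_ord q.
have -> : (if (i + k == j %[mod N])%N then op i (k + l) else 0) X p q =
    if (i + k == j %[mod N])%N && cond p q i (k + l)
    then X p (inord (q - (k + l))) else 0.
  by case: ifP => _ /=; rewrite ?opE // zero_lfunE mxE.
rewrite opE inordK; last by lia.
rewrite -if_and /cond -subnDA [(l + k)%N]addnC; congr (if _ then _ else _).
have sub_mod : (k + l <= q)%N -> (p + (q - (k + l)) == i %[mod N])%N ->
    (p + (q - l) == j %[mod N])%N = (i + k == j %[mod N])%N.
  move=> klq /eqP e; have -> : (p + (q - l) = p + (q - (k + l)) + k)%N by lia.
  by rewrite -modnDml e modnDml.
apply/idP/idP => [/andP[/and4P[pN qc lq e] /and4P[_ _ kq e']]|].
  have klq : (k + l <= q)%N by rewrite addnC -leq_subRL.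
  by rewrite -(sub_mod klq e') e pN qc klq e'.
move=> /andP[e /and4P[pN qc klq e']]; rewrite pN e' (sub_mod klq e') e qc.
have lq : (l <= q)%N := leq_trans (leq_addl k l) klq.
by rewrite lq (leq_ltn_trans (leq_subr _ _) qc) leq_subRL // addnC klq.
Qed.

Let iN i : (i %% N < N)%N. Proof. by rewrite ltn_mod (kup_gt0 kc). Qed.

Let op_modn i k : op (i %% N) k = op i k.
Proof.
apply: (periodic_modn (N := N) (f := op^~ k)); last exact: modn_mod.
by move=> i'; apply: op_mod.
Qed.

Let U : {vspace 'End('M[K]_L.+1)} :=
  (\sum_(i < N) \sum_(k < c i) <[op i k]>)%VS.

Let op_in i k : op i k \in U.
Proof.
have [ck|kc'] := leqP (c i) k; first by rewrite op_out ?mem0v.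
have ki : (k < c (i %% N))%N by rewrite c_modn.
rewrite -op_modn memvE (sumv_sup (Ordinal (iN i))) //.
by rewrite (sumv_sup (Ordinal ki)).
Qed.

Let U_sub (W : {vspace 'End('M[K]_L.+1)}) :
  (forall i k, op i k \in W) -> (U <= W)%VS.
Proof.
by move=> opW; apply/subv_sumP => i _; apply/subv_sumP => k _; rewrite -memvE.
Qed.

Let mulU : {in U & U, forall u v, u * v \in U}.
Proof.
have mul_op u j l : u \in U -> u * op j l \in U.
  have le : (U <= amulr (op j l) @^-1: U)%VS.
    apply: U_sub => i k; rewrite -memv_preim lfunE /= opM.
    by case: ifP => _; rewrite ?op_in ?mem0v.
  by move=> /(subvP le); rewrite -memv_preim lfunE.
move=> u v uU; have le : (U <= amull u @^-1: U)%VS.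
  by apply: U_sub => j l; rewrite -memv_preim lfunE; apply: mul_op.
by move=> /(subvP le); rewrite -memv_preim lfunE.
Qed.

Let e := \sum_(i < N) op i 0.

Let eU : e \in U. Proof. by apply: memv_suml => i _; apply: op_in. Qed.

Let mul_e u : u \in U -> e * u = u.
Proof.
have le : (U <= lker (amull e - \1)%VF)%VS.
  apply: U_sub => i k; apply/lkerP.
  rewrite add_lfunE opp_lfunE id_lfunE lfunE /= /e mulr_suml.
  rewrite (bigD1 (Ordinal (iN i))) //= big1 => [|j ji].
    by rewrite opM addn0 modn_mod eqxx add0n op_modn addr0 subrr.
  rewrite opM addn0 ifF // modn_small //.
  by apply: contraNF ji => /eqP e'; apply/eqP/val_inj.
move=> /(subvP le)/lkerP/eqP.
by rewrite add_lfunE opp_lfunE id_lfunE lfunE subr_eq0 => /eqP.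
Qed.

Let e_mul u : u \in U -> u * e = u.
Proof.
have le : (U <= lker (amulr e - \1)%VF)%VS.
  apply: U_sub => i k; apply/lkerP.
  rewrite add_lfunE opp_lfunE id_lfunE lfunE /= /e mulr_sumr.
  rewrite (bigD1 (Ordinal (iN (i + k)))) //= big1 => [|j ji].
    by rewrite opM modn_mod eqxx addn0 addr0 subrr.
  rewrite opM ifF // [(j %% N)%N]modn_small //.
  by apply: contraNF ji => /eqP e'; apply/eqP/val_inj.
move=> /(subvP le)/lkerP/eqP.
by rewrite add_lfunE opp_lfunE id_lfunE lfunE subr_eq0 => /eqP.
Qed.

(** Coefficients are read off from the image of the matrix unit that represents the stationary path
    at [i]. *)
Let co_fun i k (u : 'End('M[K]_L.+1)) : K :=
  if (k < c i)%N then
    u (delta_mx (inord (i %% N)) (inord 0)) (inord (i %% N)) (inord k)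
  else 0.

Let iL i : (i %% N < L.+1)%N.
Proof. by rewrite ltnS (leq_trans (ltnW (iN i))) // leq_addr. Qed.

Let co_op i k j l :
  co_fun i k (op j l) = [&& i == j %[mod N], k == l & k < c i]%N%:R.
Proof.
rewrite /co_fun; case: ifP => kci; last by rewrite !andbF.
have kL : (k < L.+1)%N by rewrite ltnS (leq_trans (ltnW kci)).
rewrite opE /cond !inordK // c_modn iN kci !andbT /= mxE eqxx /=.
have [->|kl] := eqVneq k l; last first.
  rewrite andbF; case: ifP => // /andP[lk _].
  rewrite -val_eqE /= !inordK //; last by lia.
  by have -> : (k - l == 0)%N = false by lia.
by rewrite leqnn subnn addn0 modn_mod andbT /= eqxx; case: eqP.
Qed.

Let co_lin i k : scalar (co_fun i k).
Proof.
move=> a u v; rewrite /co_fun; case: ifP => _; last by rewrite mulr0 addr0.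
by rewrite add_lfunE scale_lfunE !mxE.
Qed.

Let u_span u : u \in U ->
  u = \sum_(i < N) \sum_(k < c i) co_fun i k u *: op i k.
Proof.
pose g (u : 'End('M[K]_L.+1)) := \sum_(i < N) \sum_(k < c i) co_fun i k u *: op
  i k.
have g_lin : linear g.
  move=> a x y; rewrite scaler_sumr -big_split; apply: eq_bigr => i _.
  rewrite scaler_sumr -big_split; apply: eq_bigr => k _.
  by rewrite co_lin scalerDl scalerA.
have le : (U <= lker (linfun g - \1)%VF)%VS.
  apply: U_sub => j l; apply/lkerP.
  rewrite add_lfunE opp_lfunE id_lfunE linfunE // /g.
  apply/eqP; rewrite subr_eq0; apply/eqP.
  rewrite (bigD1 (Ordinal (iN j))) //= [X in _ + X]big1 ?addr0; last first.
    move=> i ij; rewrite big1 // => k _; rewrite co_op modn_small //.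
    have -> : (i == j %% N :> nat)%N = false; last by rewrite scale0r.
    by apply: contraNF ij => /eqP e'; apply/eqP/val_inj.
  have [cl|lc] := leqP (c j) l.
    rewrite [RHS]op_out // big1 // => k _; rewrite co_op.
    have kc' : (k < c j)%N by rewrite (leq_trans (ltn_ord k)) ?c_modn.
    have -> : (k == l :> nat)%N = false; last by rewrite andbF scale0r.
    by apply/negbTE; rewrite neq_ltn (leq_trans kc' cl).
  have lc' : (l < c (j %% N))%N by rewrite c_modn.
  rewrite (bigD1 (Ordinal lc')) //= big1 => [|k kl].
    by rewrite co_op modn_mod !eqxx lc' scale1r addr0 op_modn.
  rewrite co_op; have -> : (k == l :> nat)%N = false;
    last by rewrite andbF scale0r.
  by apply: contraNF kl => /eqP e'; apply/eqP/val_inj.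
move=> /(subvP le)/lkerP/eqP.
by rewrite add_lfunE opp_lfunE id_lfunE linfunE // subr_eq0 => /eqP.
Qed.

Lemma nak_exists : exists A : falgType K, inhabited (nak A N c).
Proof.
have e0 : e != 0.
  apply/eqP => e0; have := co_op 0 0 0 0; rewrite !eqxx (kup_pos kc).
  have -> : op 0 0 = 0 by rewrite -(mul_e (op_in 0 0)) e0 mul0r.
  rewrite /co_fun (kup_pos kc) zero_lfunE mxE => /eqP.
  by rewrite eq_sym oner_eq0.
have asU : is_aspace U.
  apply/andP; split; last exact/prodvP.
  by apply/has_algidP; exists e; split=> // u uU; rewrite mul_e ?e_mul.
pose V := ASpace asU; pose B := subvs_of V.
have vB i k : op i k \in V by apply: op_in.
have alg1 : algid V = e by rewrite -(mul_e (memv_algid V)) algidr.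
pose b i k : B := vsproj V (op i k).
have bE i k : vsval (b i k) = op i k by rewrite vsprojK.
exists B; constructor.
apply: (@Nak K B N c b (fun i k x => co_fun i k (vsval x)) kc).
- by move=> i k; rewrite /b op_mod.
- move=> i k j l; apply: val_inj; rewrite /= !bE opM.
  by case: ifP => _ /=; rewrite ?bE.
- by move=> i k ck; apply: val_inj; rewrite /= bE op_out.
- by apply: val_inj; rewrite linear_sum /= alg1; apply: eq_bigr => i _;
    rewrite bE.
- by move=> i k a x y; rewrite /= co_lin.
- by move=> i k j l; rewrite bE co_op.
move=> x; apply: val_inj; rewrite /= {1}(u_span (subvsP x)) linear_sum.
apply: eq_bigr => i _; rewrite linear_sum; apply: eq_bigr => k _.
by rewrite linearZ /= bE.
Qed.

End Existence.

(** * Presentation by the cyclic quiver *)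

Lemma malg_linear_eq (K : fieldType) (T : choiceType) (V : lmodType K)
    (f g : {malg K[T]} -> V) : linear f -> linear g ->
  (forall p, f << p >> = g << p >>) -> f =1 g.
Proof.
move=> lf lg; pose X := {malg K[T]}.
pose f' : {linear X -> V} := HB.pack f (GRing.isLinear.Build K X V _ f lf).
pose g' : {linear X -> V} := HB.pack g (GRing.isLinear.Build K X V _ g lg).
exact: (eq_linear_malg (f := f') (g := g')).
Qed.

Section CyclicNakayama.
Variables (K : fieldType) (A : falgType K) (m : nat) (c : nat -> nat).
Variable nk : nak A m.+1 c.
Hypothesis c_gt1 : forall i, (1 < c i)%N.
Local Notation Q := (cyclic_quiver m).
Local Notation N := m.+1.

Lemma cyclic_quiver_target (a : arrow Q) :
  (target a : 'I_N) = ((source a : 'I_N).+1 %% N)%N :> nat.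
Proof. by []. Qed.

Lemma cyclic_quiver_source (a a' : arrow Q) : source a = source a' -> a = a'.
Proof. by []. Qed.

Lemma cyclic_path (v : vertex Q) k :
  exists p : qpath Q, path_source p = v /\ path_length p = k.
Proof.
suff [s cs ss] : exists2 s, composable v s & size s = k.
  by exists (QPath (path_val := (v, s)) cs).
elim: k v => [|k IH] v; first by exists [::].
have [s cs ss] := IH (ordS v); exists (v :: s) => /=; last by rewrite ss.
by rewrite eqxx.
Qed.

Let path_img (p : qpath Q) : A :=
  nb nk (path_source p : 'I_N) (path_length p).

Definition path_eval (x : path_algebra K Q) : A := lin_ext path_img x.

Fact path_eval_lin : linear path_eval.
Proof. exact: (lin_ext_linear path_img). Qed.

Let path_evalU (p : qpath Q) : path_eval << p >> = path_img p.
Proof. exact: lin_extU. Qed.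

Let path_eval0 : path_eval 0 = 0.
Proof. by rewrite -[0 in LHS](subrr 0) -scaleN1r addrC path_eval_lin scaleN1r
  addNr. Qed.

Let path_evalM x y : path_eval (x * y) = path_eval x * path_eval y.
Proof.
move: x; apply: (malg_linear_eq (f := fun x => path_eval (pa_mul x y))
  (g := fun x => path_eval x * path_eval y)).
- by move=> a u v; rewrite pa_mul_linear_l; apply: path_eval_lin.
- move=> a u v; rewrite [path_eval _](path_eval_lin a u v).
  by rewrite mulrDl scalerAl.
move=> p; move: y; apply: (malg_linear_eq
  (f := fun y => path_eval (pa_mul << p >> y))
  (g := fun y => path_eval << p >> * path_eval y)).
- by move=> a u v; rewrite pa_mul_linear_r; apply: path_eval_lin.
- move=> a u v; rewrite [X in _ * X](path_eval_lin a u v).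
  by rewrite mulrDr scalerAr.
move=> q; rewrite pa_mulUU.
have -> : path_eval << p >> * path_eval << q >> = path_img p * path_img q.
  exact: (congr2 *%R (path_evalU p) (path_evalU q)).
rewrite /path_mul /path_img nbM -(path_target_eq (val_inj : injective (fun v :
  vertex Q => v : nat))
  (fun v : vertex Q => ltn_ord v) cyclic_quiver_target).
case: path_catP => [r e sr ar|/eqP/negPf ->]; last exact: path_eval0.
rewrite e eqxx path_evalU /path_img sr; congr (nb nk _ _).
by rewrite /path_length ar size_cat.
Qed.

Let path_eval1 : path_eval 1 = 1.
Proof.
rewrite -(nb_sum1 nk).
exact: etrans (linear_sum (lin_ext path_img : {linear _ -> A}) _ _
  (fun v : vertex Q => << stationary v >>)) (eq_bigr _ (fun v _ => path_evalU
    _)).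
Qed.

Let path_eval_morph : monoid_morphism path_eval.
Proof. by split; [exact: path_eval1 | exact: path_evalM]. Qed.

Let path_eval_hom : {lrmorphism path_algebra K Q -> A} :=
  HB.pack path_eval
    (GRing.isLinear.Build K (path_algebra K Q) A _ path_eval path_eval_lin)
    (GRing.isMonoidMorphism.Build (path_algebra K Q) A path_eval
      path_eval_morph).

Let path_evalE (x : path_algebra K Q) :
  path_eval x = \sum_(p <- msupp x) mcoeff p x *: path_img p.
Proof. by []. Qed.

Lemma nak_succ_cyclic : cyclic_nakayama A.
Proof.
exists m, path_eval_hom; split.
  move=> a; pose P a := exists x, path_eval x = a.
  have PD u v : P u -> P v -> P (u + v).
    move=> [x <-] [y <-]; exists (1 *: x + y).
    by rewrite path_eval_lin scale1r.
  have P0 : P 0 by exists 0; apply: path_eval0.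
  rewrite -/(P a) (nak_span nk a); apply: (big_ind P) => // i _.
  apply: (big_ind P) => // k _; have [p [sp lp]] := cyclic_path i k.
  exists (nco nk i k a *: << p >> + 0).
  by rewrite path_eval_lin path_eval0 addr0 path_evalU /path_img sp lp.
split.
  (* The sum bounds every [c i], so paths of length at least [M] vanish; the 2 is the least exponent
     that admissibility permits. *)
  pose M := (2 + \sum_(i < N) c i)%N; exists M; first exact: leq_addr.
  move=> x xM; rewrite -[LHS]/(path_eval x) path_evalE big_seq big1 // => p.
  rewrite -mcoeff_neq0 => /xM Mp; rewrite /path_img nb_out ?scaler0 //.
  apply: leq_trans Mp; rewrite /M (bigD1 (path_source p : 'I_N)) //=; lia.
(* A path of length below 2 is shorter than every [c i], so its coefficient survives in the image
   and must vanish. *)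
move=> x; rewrite -[X in X = 0]/(path_eval x) => x0 p xp; rewrite leqNgt.
apply/negP => lp; move/eqP: xp; apply.
have lc : (path_length p < c (path_source p : 'I_N))%N.
  by have := c_gt1 (path_source p : 'I_N); lia.
have := congr1 (nco nk (path_source p : 'I_N) (path_length p)) x0.
rewrite nco0 path_evalE nco_sum.
have [px|px] := boolP (p \in msupp x); last by rewrite mcoeff_outdom.
rewrite (bigD1_seq p px (fset_uniq _)) /= big1 => [|q qp].
  by rewrite ncoZ nco_nb !eqxx lc mulr1 addr0.
rewrite ncoZ nco_nb !modn_small //.
case: eqP => [/val_inj e|_]; last by rewrite mulr0.
case: eqP => [e'|_]; last by rewrite andbF mulr0.
case/eqP: qp; apply: (qpath_unique cyclic_quiver_source) => //.
Qed.

End CyclicNakayama.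

Lemma nak_cyclic (K : fieldType) (A : falgType K) N c (nk : nak A N c) :
  (forall i, 1 < c i)%N -> cyclic_nakayama A.
Proof.
case: N nk => [|m] nk; first by have := kup_gt0 (nak_kupisch nk).
exact: nak_succ_cyclic nk.
Qed.

Local Close Scope ring_scope.

(** * The Kupisch series of Lambda *)

Section KupischSeries.
Variables (n : nat) (c' : nat -> nat).
Hypothesis n_gt1 : 1 < n.
Hypothesis kc' : kupisch n.+1 c'.
Hypothesis c'_last : c' n = 1.
Hypothesis c'_prev : c' n.-1 = 1.
Hypothesis c'_gt1 : forall j, j < n.-1 -> 1 < c' j.

(** At residue [n] this is [c' 0 - 1], the defect of the first projective of Theta. *)
Definition gap j := c' j.+1 - c' j + (j %% n.+1 == n.-1).

Definition top j := \sum_(i < j) (gap i).+1.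

Definition block_next (jk : nat * nat) :=
  if jk.2 < gap jk.1 then (jk.1, jk.2.+1) else (jk.1.+1, 0).

(* The vertex p is [top j + k] with 0 <= k <= gap j, where (j, k) = block p. *)
Definition block p := iter p block_next (0, 0).

(* soc P(p) is the vertex before [top (soc_index p)]. *)
Definition soc_index p := (block p).1 + c' (block p).1 + (block p).2.

Definition lift_rank := top n.+1.

(** The subtraction is never truncated, by [top_soc_index]. *)
Definition lift_kup p := top (soc_index p) - p.

Lemma c'_mod j : c' (j %% n.+1) = c' j.
Proof. by apply: (periodic_modn (kup_mod kc')); rewrite modn_mod. Qed.

Lemma gap_mod j : gap (j + n.+1) = gap j.
Proof. by rewrite /gap -addSn !(kup_mod kc') modnDr. Qed.

Lemma topS j : top j.+1 = top j + (gap j).+1.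
Proof. by rewrite /top big_ord_recr. Qed.

Lemma top_period j : top (j + n.+1) = top j + lift_rank.
Proof.
elim: j => [|j IH]; first by rewrite add0n {2}/top big_ord0.
by rewrite addSn !topS IH gap_mod; lia.
Qed.

Lemma top_add j k : top j + k <= top (j + k).
Proof. by elim: k => [|k IH]; rewrite ?addn0 // !addnS topS; lia. Qed.

Lemma top_lt i j : i < j -> top i < top j.
Proof. by move=> ij; have := top_add i (j - i); rewrite subnKC; lia. Qed.

Lemma top_le i j : (top i <= top j) = (i <= j).
Proof.
have [|/top_lt] := leqP i j; last by rewrite ltnNge => /negbTE.
by rewrite leq_eqVlt => /orP[/eqP ->|/top_lt/ltnW]; rewrite ?leqnn.
Qed.

Lemma blockP p : top (block p).1 + (block p).2 = p /\ (block p).2 <= gap (block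
  p).1.
Proof.
elim: p => [|p [IH le]]; first by rewrite /= /top big_ord0.
rewrite /block iterS -/(block p) /block_next.
by case: ltnP => lt /=; rewrite ?topS; split; lia.
Qed.

Lemma block_unique p j k : top j + k = p -> k <= gap j -> block p = (j, k).
Proof.
have [e le] := blockP p; rewrite [block p]surjective_pairing; move: e le.
move: (block p).1 (block p).2 => i l e le e' le'.
have ij : i = j.
  apply/eqP; rewrite eqn_leq; apply/andP; split; rewrite leqNgt;
    apply/negP => lt.
    by have := top_le j.+1 i; rewrite lt topS; lia.
  by have := top_le i.+1 j; rewrite lt topS; lia.
by rewrite -ij in e' *; congr pair; lia.
Qed.

Lemma block_period p : block (p + lift_rank) = ((block p).1 + n.+1, (block
  p).2).
Proof.
have [e le] := blockP p; apply: block_unique; rewrite ?gap_mod // top_period;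
  lia.
Qed.

Lemma soc_index_period p : soc_index (p + lift_rank) = soc_index p + n.+1.
Proof. by rewrite /soc_index block_period /= (kup_mod kc'); lia. Qed.

Lemma soc_index_top j : soc_index (top j) = j + c' j.
Proof. by rewrite /soc_index (block_unique (addn0 _)) // addn0. Qed.

(** Inside a block the index rises. On entering the next block the gap compensates a growth of [c'],
    so the index rises again; it stalls if [c'] drops by one, or after the block of residue [n.-1],
    where the extra vertex has used up the rise. *)
Lemma soc_indexS p : soc_index p.+1 = (soc_index p).+1 \/
  soc_index p.+1 = soc_index p /\ p.+1 = top (block p).1.+1.
Proof.
have [e le] := blockP p;
  rewrite /soc_index /block iterS -/(block p) /block_next.
case: ltnP => lt /=; first by left; lia.
have := kup_step kc' (block p).1; move: e le lt; rewrite topS /gap.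
case: eqP => [e'|_]; last by lia.
have -> : c' (block p).1 = 1 by rewrite -c'_mod e'.
have -> : c' (block p).1.+1 = 1; last by lia.
by rewrite -c'_mod -addn1 -modnDml e' addn1 prednK ?modn_small //; lia.
Qed.

(** Length 1 occurs only at the residues [n.-1] and [n]: the extra vertex serves the former and
    [1 < c' 0] the latter. This keeps the lengths of Lambda above 1. *)
Lemma gap_pos j : c' j = 1 -> 0 < gap j.
Proof.
move=> cj; have jN : j %% n.+1 < n.+1 by rewrite ltn_mod.
have := c'_mod j; rewrite cj /gap cj; case: eqP => [|jn cjm]; first by lia.
have [lt|ge] := ltnP (j %% n.+1) n.-1; first by have := c'_gt1 lt; lia.
have e : j %% n.+1 = n by lia.
have -> : c' j.+1 = c' 0.
  by rewrite -c'_mod -addn1 -modnDml e addn1 modnn.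
by have : 1 < c' 0; [apply: c'_gt1; lia | lia].
Qed.

Lemma top_soc_index p : p.+2 <= top (soc_index p).
Proof.
have [e le] := blockP p; rewrite /soc_index; move: e le.
move: (block p).1 (block p).2 => j k e le.
have cp := kup_pos kc' j; have [c1|c1] := eqVneq (c' j) 1.
  have := gap_pos c1; have := top_add j.+1 k; rewrite topS c1 addn1; lia.
by have := top_add j (c' j + k); rewrite [j + (_ + _)]addnA; lia.
Qed.

Lemma lift_kupE p : p + lift_kup p = top (soc_index p).
Proof. by rewrite /lift_kup subnKC //; have := top_soc_index p; lia. Qed.

Lemma lift_kup_gt1 p : 1 < lift_kup p.
Proof. by have := top_soc_index p; have := lift_kupE p; lia. Qed.

Lemma soc_index_le p q : p <= q -> soc_index p <= soc_index q.
Proof.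
move=> pq; rewrite -(subnKC pq); elim: (q - p) => [|d IH];
  first by rewrite addn0.
by rewrite addnS; have := soc_indexS (p + d); lia.
Qed.

Lemma soc_index_lt p q : soc_index p < soc_index q -> p < q.
Proof. by move=> lt; rewrite ltnNge; apply/negP => /soc_index_le; lia. Qed.

Lemma lift_kupisch : kupisch lift_rank lift_kup.
Proof.
split.
- by have := top_lt (ltn0Sn n); rewrite /lift_rank; lia.
- by move=> p; have := lift_kup_gt1 p; lia.
- move=> p; have := lift_kupE (p + lift_rank); have := lift_kupE p.
  by rewrite soc_index_period top_period; lia.
move=> p; have := lift_kupE p; have := lift_kupE p.+1.
by have := top_le (soc_index p) (soc_index p.+1); rewrite soc_index_le; lia.
Qed.

Lemma lift_kup_rise p : soc_index p < soc_index p.+1 -> lift_kup p <= lift_kup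
  p.+1.
Proof.
by move=> /top_lt; have := lift_kupE p; have := lift_kupE p.+1; lia.
Qed.

(** [b.+1] is the first position whose projective ends just before [top v]; since the end has just
    risen there, [lift_kup_rise] makes that projective injective. *)
Lemma soc_index_first v : soc_index 0 < v ->
  exists b, soc_index b.+1 = v /\ (soc_index b).+1 = v.
Proof.
move=> v0; have ex : exists p, v <= soc_index p.
  exists (v * lift_rank).
  have -> : soc_index (v * lift_rank) = soc_index 0 + v * n.+1.
    elim: (v) => [|u IH]; first by rewrite addn0.
    by rewrite mulSn addnC soc_index_period IH; lia.
  by rewrite mulnS; lia.
have [[|b] vb min] := ex_minnP ex; first by lia.
have vb' : soc_index b < v.
  by rewrite ltnNge; apply/negP => /min; lia.
by exists b; have := soc_indexS b; lia.
Qed.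

Lemma sum_lift_defect :
  \sum_(p < lift_rank) (lift_kup p.+1 - lift_kup p) = lift_rank - n.+1.
Proof.
have S_mono v : v <= top v by have := top_add 0 v; rewrite add0n; lia.
(* Telescoping with the potential [top s - s] at [s = soc_index p]: a rise of [s] adds [gap s] to
   both sides, and at a stall the drop in length is truncated to 0. *)
have tele m : \sum_(p < m) (lift_kup p.+1 - lift_kup p) +
    (top (soc_index 0) - soc_index 0) = top (soc_index m) - soc_index m.
  elim: m => [|m IH]; first by rewrite big_ord0.
  rewrite big_ord_recr /= addnAC IH; have := lift_kupE m;
    have := lift_kupE m.+1.
  have := S_mono (soc_index m); case: (soc_indexS m) => [->|[-> _]];
    last by lia.
  by rewrite topS; lia.
have := tele lift_rank; have := soc_index_period 0; rewrite add0n => ->.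
rewrite top_period; have := S_mono (soc_index 0); have := S_mono n.+1.
by rewrite -/lift_rank; lia.
Qed.

(** The left side counts the inserted vertices. The [c' 0 - 1] of residue [n] and the extra one
    after [n.-1] combine to [c' 0]. *)
Lemma lift_rank_gap : lift_rank - n.+1 = \sum_(j < n) (c' j.+1 - c' j) + c' 0.
Proof.
have topE v : top v = v + \sum_(i < v) gap i.
  elim: v => [|v IH]; first by rewrite /top !big_ord0.
  by rewrite topS big_ord_recr /= IH addnS addSn addnA.
rewrite /lift_rank topE addKn big_ord_recr /= /gap.
have -> : c' n.+1 = c' 0 by rewrite -c'_mod modnn.
rewrite modn_small // big_split /= c'_last [n == _]gtn_eqF; last by lia.
have -> : \sum_(i < n) (i %% n.+1 == n.-1) = 1.
  have n1 : n.-1 < n by lia.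
  rewrite (bigD1 (Ordinal n1)) //= modn_small ?eqxx; last by lia.
  rewrite big1 // => i i_n; rewrite modn_small; last by have := ltn_ord i; lia.
  have -> // : (i == n.-1 :> nat) = false.
  by apply: contraNF i_n => /eqP e; apply/eqP/val_inj.
by have := kup_pos kc' 0; lia.
Qed.

Lemma soc_index_hit j : exists p, top (soc_index p) = top j %[mod lift_rank].
Proof.
(* Whole periods are added to reach a value above [soc_index 0], where [soc_index_first] applies. *)
have lt : soc_index 0 < j + (soc_index 0).+1 * n.+1 by rewrite mulSn mulnS; lia.
have [b [e _]] := soc_index_first lt; exists b.+1; rewrite e.
elim: (soc_index 0).+1 => [|q IH]; first by rewrite addn0.
by rewrite mulSn [n.+1 + _]addnC addnA top_period modnDr.
Qed.

(** A stall forces [p.+1] to be a top. Then [a.+1] is the first start with the same end as [p.+1],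
    giving the injective envelope, and [b.+1] the first start of a projective ending where the
    cosyzygy ends. The bound on [p] keeps both among the natural numbers. *)
Lemma lift_cosyzygy p : top (soc_index 0).+1 <= p.+1 ->
  lift_kup p <= lift_kup p.+1 \/
  exists a b, [/\ b <= a < p.+1, a.+1 + lift_kup a.+1 = p.+1 + lift_kup p.+1,
    lift_kup a <= lift_kup a.+1, b.+1 + lift_kup b.+1 = p.+1 &
    lift_kup b <= lift_kup b.+1].
Proof.
move=> pm; have [rise|[stall ptop]] := soc_indexS p.
  by left; apply: lift_kup_rise; rewrite rise.
right; set j := (block p).1.+1 in ptop.
have gj : soc_index 0 < j by rewrite -top_le -ptop.
have jv : j < soc_index p.+1.
  rewrite ltnNge -top_le -ptop; have := lift_kupE p.+1.
  by have := lift_kup_gt1 p.+1; lia.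
have [b [b1 b0]] := soc_index_first gj.
have [a [a1 a0]] := soc_index_first (ltn_trans gj jv).
have ba : b < a by apply: soc_index_lt; lia.
have ap : a < p.+1 by apply: soc_index_lt; lia.
exists a, b; split.
- by rewrite (ltnW ba).
- by rewrite !lift_kupE a1.
- by apply: lift_kup_rise; lia.
- by rewrite lift_kupE b1.
- by apply: lift_kup_rise; lia.
Qed.

Hypothesis c'0_le : c' 0 <= n.

(* The vertex w+1 inserted between the tops of the blocks of P_n and A_1 is not
   itself a top. *)
Lemma lift_dominant_dimension : exists w b,
  [/\ b <= w, lift_kup w.+1 = (lift_kup w.+2).+1, lift_kup w <= lift_kup w.+1,
      b.+1 + lift_kup b.+1 = w.+2 & lift_kup b < lift_kup b.+1].
Proof.
(* The second period is taken because [soc_index 0 = c' 0] may equal [n], while [soc_index_first]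
   needs it below [j.+1]. *)
set j := n.-1 + n.+1.
have c'j : c' j = 1 by rewrite /j (kup_mod kc').
have j1 : j.+1 = n + n.+1 by rewrite /j -addSn prednK //; lia.
have c'j1 : c' j.+1 = 1 by rewrite j1 (kup_mod kc').
have gapj : gap j = 1.
  rewrite /gap c'j c'j1 subnn /j modnDr modn_small ?eqxx //; lia.
have gw : soc_index (top j) = j.+1 by rewrite soc_index_top c'j addn1.
have gw1 : soc_index (top j).+1 = j.+2.
  rewrite /soc_index (@block_unique _ j 1) ?addn1 ?gapj //=.
  by rewrite c'j !addn1.
have w2 : (top j).+2 = top j.+1 by rewrite topS gapj addn2.
have gw2 : soc_index (top j).+2 = j.+2 by rewrite w2 soc_index_top c'j1 addn1.
have lt : soc_index 0 < j.+1 by rewrite /soc_index /=; lia.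
have [b [b1 b0]] := soc_index_first lt.
have bw : b < top j by apply: soc_index_lt; lia.
exists (top j), b; split.
- exact: ltnW.
- by have := lift_kupE (top j).+1; have := lift_kupE (top j).+2;
    rewrite gw1 gw2; lia.
- by apply: lift_kup_rise; rewrite gw gw1.
- by rewrite lift_kupE b1 w2.
(* The block of [j] has two vertices, so from [b] to [b.+1] the end advances by 2 and the length
   grows by 1; hence the strict inequality. *)
have := lift_kupE b; have := lift_kupE b.+1; rewrite b1.
have -> : soc_index b = j by lia.
by rewrite -w2; lia.
Qed.

End KupischSeries.

Local Open Scope ring_scope.

(** * Dominant dimension *)

Section DominantDimension.
Variables (K : fieldType) (A : falgType K) (N : nat) (c : nat -> nat).
Variable nk : nak A N c.

Lemma vproj_injective i : (c i <= c i.+1)%N -> injective_module (vproj nk i.+1).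
Proof. exact: iv_injective. Qed.

Lemma vproj_projective i : projective_module (vproj nk i).
Proof. exact: iv_projective. Qed.

Lemma injective_copresentation i : (c i <= c i.+1)%N ->
  projective_injective_copresentation (vproj nk i.+1).
Proof.
move=> ci; have inj := @vproj_injective i ci.
have pr := @vproj_projective i.+1.
exists (vproj nk i.+1), (vproj nk i.+1), \1%VF, 0; split=> //.
- split; first exact: is_hom_id.
  by apply: lker_eq0 => x; rewrite id_lfunE.
- exact: is_hom0.
apply/eqP; rewrite eqEsubv lim1g subvf /=; apply/subvP => x _.
by apply/lkerP; rewrite zero_lfunE.
Qed.

(* In terms of intervals: [p, p + c p) -> [a+1, p + c p) -> [b+1, p). *)
Lemma interval_copresentation p a b : (b <= a < p)%N ->
  (a.+1 + c a.+1 = p + c p)%N -> (c a <= c a.+1)%N ->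
  (b.+1 + c b.+1 = p)%N -> (c b <= c b.+1)%N ->
  projective_injective_copresentation (vproj nk p).
Proof.
move=> bap ap ca bp cb.
have lf : (c a.+1 <= p - a.+1 + c p)%N by lia.
have lg : (c b.+1 <= a - b + c a.+1)%N by lia.
have kf : (c p <= c a.+1 - (p - a.+1))%N by lia.
have kg : (c b.+1 - (a - b) = p - a.+1)%N by lia.
have pa : p = a.+1 + (p - a.+1) %[mod N] by rewrite subnKC //; case/andP: bap.
have ab : a.+1 = b.+1 + (a - b) %[mod N] by rewrite addSn subnKC //;
  case/andP: bap.
exists (vproj nk a.+1), (vproj nk b.+1),
  (ivhom nk (leqnn (c p)) (leqnn (c a.+1)) (p - a.+1)),
  (ivhom nk (leqnn (c a.+1)) (leqnn (c b.+1)) (a - b)); split.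
- by split; [apply: vproj_projective | apply: vproj_injective].
- by split; [apply: vproj_projective | apply: vproj_injective].
- split; first exact: is_hom_ivhom.
  by rewrite (lker_ivhom _ _ pa) // tail_out.
- exact: is_hom_ivhom.
- by rewrite (lker_ivhom _ _ ab) // (limg_ivhom _ _ pa) // kg.
Qed.

(* The minimal injective resolution is
   [w+2, e) -> [w+1, e) -> [b+1, w+2) -> [b+1, w+1) -> 0. *)
Lemma dominant_dimension_vproj w b :
  (b <= w)%N -> (c w.+1 = (c w.+2).+1)%N -> (c w <= c w.+1)%N ->
  (b.+1 + c b.+1 = w.+2)%N -> (c b < c b.+1)%N -> 
  dominant_dimension (vproj nk w.+2) 2.
Proof.
move=> bw cw cw1 bp cb.
have cb0 := kup_pos (nak_kupisch nk) b.
have cp0 := kup_pos (nak_kupisch nk) w.+2.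
(* From degree 3 on the terms are the zero interval at [b.+1], so that [ivhom] gives all
   differentials uniformly. *)
pose st j := if j is 0 then w.+1 else b.+1.
pose ln j := match j with 0 => c w.+1 | 1 => c b.+1 | 2 => (c b.+1).-1 | _ =>
  0%N end.
have li j : (ln j <= c (st j))%N.
  by case: j => [|[|[|j]]] //=; apply: leq_pred.
pose dl j := (st j - st j.+1)%N.
have ii j : st j = st j.+1 + dl j %[mod N].
  by congr (_ %% _)%N; rewrite /dl; case: j => [|j] /=; lia.
have ll j : (ln j.+1 <= dl j + ln j)%N.
  by rewrite /dl; case: j => [|[|[|j]]] /=; lia.
pose I j := ivm nk (li j).
pose d j : 'Hom(I j, I j.+1) := ivhom nk (li j) (li j.+1) (dl j).
have l0 : (c w.+1 <= 1 + c w.+2)%N by lia.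
have ke : (c w.+2 <= c w.+1 - 1)%N by lia.
have i0 : w.+2 = w.+1 + 1 %[mod N] by rewrite addn1.
pose e : 'Hom(vproj nk w.+2, I 0%N) := ivhom nk (leqnn _) (li 0%N) 1.
have imd j : limg (d j) = tail K (ln j.+1) (dl j).
  by apply: limg_ivhom.
have kd j : lker (d j) = tail K (ln j) (ln j.+1 - dl j).
  by apply: lker_ivhom.
have ime : limg e = tail K (ln 0%N) 1 by apply: limg_ivhom.
have essential_tail j s : (s < ln j)%N -> essential (tail K (ln j) s : {vspace
  I j}).
  move=> sl; apply: iv_essential; first exact: submodule_tail.
  by rewrite -(tail_out K (leqnn (ln j))) => /tail_inj e'; have := e' _ _; lia.
exists I, e, d; split.
- split.
  + split; first exact: is_hom_ivhom.
      by rewrite (lker_ivhom _ _ i0) // tail_out.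
    by rewrite ime; apply: (essential_tail 0%N) => /=; lia.
  + move=> [|[|[|j]]].
    * exact: iv_injective.
    * by apply: iv_injective; rewrite /=; lia.
    * by apply: iv_injective; rewrite /=; lia.
    * exact: iv0_injective.
  + move=> j; split; first exact: is_hom_ivhom.
    rewrite imd; have [lt|ge] := ltnP (dl j) (ln j.+1);
      first exact: (essential_tail j.+1).
    (* Only zero targets remain, where the image is the full space. *)
    have -> : dl j = 0%N by move: ge; rewrite /dl; case: j => [|j] /=; lia.
    rewrite tail0 => W _; rewrite (_ : (fullv :&: W)%VS = W) //.
    exact/capv_idPr/subvf.
  + by rewrite kd ime; congr (tail _ _ _); rewrite /dl /=; lia.
  + move=> j; rewrite kd imd; congr (tail _ _ _).
    by rewrite /dl; case: j => [|[|j]] /=; lia.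
- by move=> [|[|//]] _; apply: iv_projective.
by apply: iv_not_projective => /=; lia.
Qed.

(** The copresentations bound every resolution from below; the explicit one at [w.+2] attains the
    bound. *)
Lemma algebra_dominant_dimension_two w b m :
  (forall i, projective_injective_copresentation (vproj nk (m + i))) ->
  (b <= w)%N -> (c w.+1 = (c w.+2).+1)%N -> (c w <= c w.+1)%N ->
  (b.+1 + c b.+1 = w.+2)%N -> (c b < c b.+1)%N ->
  algebra_dominant_dimension A 2.
Proof.
move=> cop bw cw cw1 bp cb; split.
  exists (vproj nk w.+2); split.
  - exact: vproj_projective.
  - by apply: iv_not_injective; rewrite ?cw // (kup_pos (nak_kupisch nk)).
  - exact: dominant_dimension_vproj bw cw cw1 bp cb.
move=> M s pM _ [I [e [d [res Iproj Inot]]]].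
have cM : projective_injective_copresentation M.
  apply: (projective_copresentation (complete_vsimple nk m)
    (P := fun i : 'I_N => vproj nk (m + i))) => // i.
  exact: vproj_cover.
have [I0 I1] := copresentation_resolution cM res.
by case: s Inot {Iproj} => [|[|s]].
Qed.

End DominantDimension.

Theorem lemma4p5p3 (K : fieldType) (n : nat) (hn : (1 < n)%N)
    (Theta : falgType K) (hTheta : connected_linear_nakayama n Theta)
    (P : 'I_n -> fdmod Theta) (hP : standard_projectives P) :
  let v : n.-tuple nat := [tuple defect (P i) | i < n] in
  let w : seq nat := rcons v 1%N in
  exists defTheta : nat,
    [/\ algebra_defect Theta defTheta,
        sumn w = (1 + defTheta)%N &
        exists Lambda : falgType K,
          [/\ cyclic_nakayama Lambda,
              epsilon_iso Lambda (Theta * K^o)%type,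
              algebra_defect Lambda (1 + defTheta)%N &
              algebra_dominant_dimension Lambda 2]].
Proof.
move=> v w; have [S [repS _ coverP]] := hP.
have repP := complete_covers repS coverP.
exists (\sum_i defect (P i))%N; split.
- by exists n, P.
- by rewrite /w /v sumn_rcons sumnE big_map big_enum addnC.
have [cT [[nkT] cT_lin cT_gt1]] := connected_linear_nak hTheta.
have [nkB] := ext_nak cT_lin nkT.
have n0 : (0 < n)%N by lia.
rewrite (sum_defect nkT repP).
pose c' := ext_kup n cT; have kc' : kupisch n.+1 c' := nak_kupisch nkB.
have c'E j : (j < n)%N -> c' j = cT j.
  by move=> jn; rewrite /c' /ext_kup modn_small ?jn //; lia.
have c'_last : c' n = 1%N by rewrite /c' /ext_kup modn_small // ltnn.
have c'_prev : c' n.-1 = 1%N.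
  have n1 : (n.-1 < n)%N by lia.
  by rewrite c'E //; have := cT_lin _ n1;
    have := kup_pos (nak_kupisch nkT) n.-1; lia.
have c'_gt1 j : (j < n.-1)%N -> (1 < c' j)%N.
  by move=> jn; rewrite c'E; [apply: cT_gt1 | idtac]; lia.
have c'0 : (c' 0 <= n)%N by rewrite c'E //; have := cT_lin 0%N n0; lia.
have kc := lift_kupisch hn kc' c'_last c'_prev c'_gt1.
have c_gt1 := lift_kup_gt1 hn kc' c'_last c'_prev c'_gt1.
have cE := lift_kupE hn kc' c'_last c'_prev c'_gt1.
have [Lambda [nk]] := nak_exists K kc.
(* By periodicity of [cT] the last term for Theta is [cT 0 - 1]; the summand 1 completes it to the
   [c' 0] of [lift_rank_gap]. *)
have sumE : (1 + \sum_(i < n) (cT i.+1 - cT i) =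
    \sum_(p < lift_rank n c') (lift_kup n c' p.+1 - lift_kup n c' p))%N.
  rewrite (sum_lift_defect hn) // (lift_rank_gap hn) //.
  have sum_last k (F : nat -> nat) : (0 < k)%N ->
      (\sum_(i < k) F i = \sum_(i < k.-1) F i + F k.-1)%N.
    by case: k => // k _; rewrite big_ord_recr.
  have cTn : cT n = cT 0%N by have := kup_mod (nak_kupisch nkT) 0;
    rewrite add0n.
  have n1 : (n.-1 < n)%N by lia.
  have cT1 : cT n.-1 = 1%N by rewrite -c'E.
  have cT0 := kup_pos (nak_kupisch nkT) 0.
  rewrite (sum_last n (fun i => cT i.+1 - cT i)%N) //.
  rewrite (sum_last n (fun i => c' i.+1 - c' i)%N) // prednK // cTn cT1 c'_last
    c'_prev (c'E 0%N) //.
  have -> : (\sum_(i < n.-1) (c' i.+1 - c' i) =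
             \sum_(i < n.-1) (cT i.+1 - cT i))%N.
    by apply: eq_bigr => i _; rewrite !c'E //; have := ltn_ord i; lia.
  by lia.
exists Lambda; split.
- exact: nak_cyclic nk c_gt1.
- apply: (epsilon_corner nk nkB (t := top n c')).
  + by rewrite /top big_ord0.
  + by move=> j; apply: top_lt.
  + exact: top_period.
  + by move=> j; rewrite cE soc_index_top.
  + by move=> p; exists (soc_index n c' p); apply: cE.
  + move=> j; have [p e] := soc_index_hit hn kc' c'_last c'_prev j.
    by exists p; rewrite cE.
  + exact: c_gt1.
- by rewrite sumE; apply: algebra_defect_nak nk.
have [w1 [b [bw cw cw1 bp cb]]] :=
  lift_dominant_dimension hn kc' c'_last c'_prev c'_gt1 c'0.
(* The window of representatives starts where [lift_cosyzygy] begins to apply. *)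
pose m := top n c' (soc_index n c' 0).+1.
suff cop i : projective_injective_copresentation (vproj nk (m + i)).
  exact: algebra_dominant_dimension_two cop bw cw cw1 bp cb.
set p := (m + i)%N; have : (m <= p)%N by apply: leq_addr.
have : (0 < p)%N by rewrite /p /m topS !addnS.
case: p => // p _ /(lift_cosyzygy hn kc' c'_last c'_prev c'_gt1).
case=> [|[a [b' [ba ap ca bp' cb']]]]; first exact: injective_copresentation.
exact: interval_copresentation ba ap ca bp' cb'.
Qed.
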